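(* The double coset space $(\mathrm{Sp}(1)\times\{1\})\backslash\mathrm{Sp}(1,1)/\mathrm{Sp}(1)I_2$ has a natural manifold structure obtained from the quotient manifold theorem for free and proper smooth actions: the left action of $\mathrm{Sp}(1)\times\{1\}$ on the manifold $\mathrm{Sp}(1,1)/\mathrm{Sp}(1)I_2$ is smooth, free and proper, and the double coset space is given the resulting quotient manifold structure. Moreover, the map $$(\mathrm{Sp}(1)\times\{1\})\backslash\mathrm{Sp}(1,1)/\mathrm{Sp}(1)I_2\to\mathbb{B},\qquad(\mathrm{Sp}(1)\times\{1\})\,A\,\mathrm{Sp}(1)I_2\mapsto\big(\mathcal{F}_{A^{-1}}\big)^{-1}(0),$$ is a well defined diffeomorphism.
   Context: $\mathbb{H}$ denotes the quaternions and $\mathbb{B}=\{q\in\mathbb{H}: |q|<1\}$. $\mathrm{Sp}(1,1)=\{A\in M_2(\mathbb{H}): A^*I_{1,1}A=I_{1,1}\}$ with $I_{1,1}=\operatorname{diag}(1,-1)$, a Lie group. $\mathrm{Sp}(1)=\{q\in\mathbb{H}:|q|=1\}$; $\mathrm{Sp}(1)I_2=\{uI_2:u\in\mathrm{Sp}(1)\}$ is a closed subgroup of $\mathrm{Sp}(1,1)$; $\mathrm{Sp}(1)\times\{1\}$ is regarded as the subgroup $\{\operatorname{diag}(u,1):u\in\mathrm{Sp}(1)\}$ of $\mathrm{Sp}(1,1)$, acting by left multiplication. Quotient manifold theorem: if a Lie group $G$ acts smoothly, freely and properly on a manifold $P$, then the orbit space has a unique manifold structure for which the quotient map from $P$ is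 a submersion. The coset space $\mathrm{Sp}(1,1)/\mathrm{Sp}(1)I_2$ carries the manifold structure obtained in this way. A function $f:\mathbb{B}\to\mathbb{H}$ is (left) slice regular if for every $I\in\mathbb{H}$ with $I^2=-1$ one has $\frac12\left(\frac{\partial}{\partial x}+I\frac{\partial}{\partial y}\right)f(x+Iy)=0$ whenever $x,y\in\mathbb{R}$, $x+yI\in\mathbb{B}$. Such functions have power series expansions $f(q)=\sum_n q^na_n$ on $\mathbb{B}$. For $f(q)=\sum q^na_n$ and $g(q)=\sum q^nb_n$, the $*$-product is $(f*g)(q)=\sum_n q^n\sum_{k=0}^n a_kb_{n-k}$; the regular conjugate is $f^c(q)=\sum q^n\overline{a_n}$; the symmetrization is $f^s=f*f^c$; the $*$-reciprocal is $f^{-*}(q)=f^s(q)^{-1}f^c(q)$ off the zero set of $f^s$. For $a,b\in\mathbb{H}$ let $l_{(a,b)}(q)=qa+b$. For $A=\begin{pmatrix}a&c\\ b&d\end{pmatrix}\in\mathrm{Sp}(1,1)$, the slice regular M\''obius transformation $\mathcal{F}_A:\mathbb{B}\to\mathbb{B}$ is $\mathcal{F}_A=l_{(c,d)}^{-*}*l_{(a,b)}$, written $\mathcal{F}_A(q)=(qc+d)^{-*}*(qa+b)$. Each $\mathcal{F}_A$ is a well defined slice regular bijection of $\mathbb{B}$ onto itself, and $(\mathcal{F}_{A^{-1}})^{-1}$ denotes the inverse map of the bijection $\mathcal{F}_{A^{-1}}:\mathbb{B}\to\mathbb{B}$. *)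

(* Defs.v *)
From HB Require Import structures.
From mathcomp Require Import all_boot all_order all_algebra.
From mathcomp Require Import all_classical all_reals all_analysis.
From mathcomp Require Import ring lra.

Set Implicit Arguments.
Unset Strict Implicit.
Unset Printing Implicit Defensive.

Import Order.TTheory GRing.Theory Num.Theory.
Import numFieldNormedType.Exports.

Local Open Scope classical_set_scope.
Local Open Scope ring_scope.

(* Quaternions [a + b i + c j + d k] as real row vectors [(a, b, c, d)]. The
   norm inherited from ['rV[R]_4] is the sup norm: it is only used for its
   topology and for derivatives; the quaternionic modulus is [qabs]. *)
Definition quat (R : realType) : Type := 'rV[R]_4.

HB.instance Definition _ (R : realType) := NormedModule.copy (quat R) 'rV[R]_4.

Section Quaternions.
Context {R : realType}.
Implicit Types p q r : quat R.

Definition mkq (a b c d : R) : quat R :=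
  \row_(i < 4) nth 0 [:: a; b; c; d] i.

Definition re q : R := q 0 (inord 0).
Definition im1 q : R := q 0 (inord 1).
Definition im2 q : R := q 0 (inord 2).
Definition im3 q : R := q 0 (inord 3).

Lemma mkqE a b c d :
  ((re (mkq a b c d) = a) * (im1 (mkq a b c d) = b)
   * (im2 (mkq a b c d) = c) * (im3 (mkq a b c d) = d))%type.
Proof. by rewrite /re /im1 /im2 /im3 !mxE !inordK. Qed.

Lemma quatP (p q : quat R) : re p = re q -> im1 p = im1 q -> im2 p = im2 q ->
  im3 p = im3 q -> p = q.
Proof.
move=> e0 e1 e2 e3; apply/rowP => i; rewrite -[i]inord_val.
by case: i => -[|[|[|[|//]]]] ?.
Qed.

Lemma qaddE p q :
  ((re (p + q)%R = (re p + re q)%R)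
   * (im1 (p + q)%R = (im1 p + im1 q)%R)
   * (im2 (p + q)%R = (im2 p + im2 q)%R)
   * (im3 (p + q)%R = (im3 p + im3 q)%R))%type.
Proof. by rewrite /re /im1 /im2 /im3 !mxE. Qed.

Definition qone : quat R := mkq 1 0 0 0.

Definition qmul p q : quat R := mkq
  (re p * re q - im1 p * im1 q - im2 p * im2 q - im3 p * im3 q)
  (re p * im1 q + im1 p * re q + im2 p * im3 q - im3 p * im2 q)
  (re p * im2 q - im1 p * im3 q + im2 p * re q + im3 p * im1 q)
  (re p * im3 q + im1 p * im2 q - im2 p * im1 q + im3 p * re q).

Definition qconj q : quat R := mkq (re q) (- im1 q) (- im2 q) (- im3 q).

Definition qabs2 q : R := re q ^+ 2 + im1 q ^+ 2 + im2 q ^+ 2 + im3 q ^+ 2.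

Definition qabs q : R := Num.sqrt (qabs2 q).

Definition qinv q : quat R := (qabs2 q)^-1 *: qconj q.

Let qmulA : associative qmul.
Proof. by move=> p q r; apply: quatP; rewrite !mkqE; ring. Qed.

Let qmul1q : left_id qone qmul.
Proof. by move=> p; apply: quatP; rewrite !mkqE; ring. Qed.

Let qmulq1 : right_id qone qmul.
Proof. by move=> p; apply: quatP; rewrite !mkqE; ring. Qed.

Let qmulDl : left_distributive qmul +%R.
Proof. by move=> p q r; apply: quatP; rewrite !(mkqE, qaddE); ring. Qed.

Let qmulDr : right_distributive qmul +%R.
Proof. by move=> p q r; apply: quatP; rewrite !(mkqE, qaddE); ring. Qed.

Let qone_neq0 : qone != 0 :> quat R.
Proof.
by apply/eqP => /rowP /(_ 0); rewrite !mxE /= => /eqP; rewrite oner_eq0.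
Qed.

HB.instance Definition _ := GRing.Zmodule_isNzRing.Build (quat R)
  qmulA qmul1q qmulq1 qmulDl qmulDr qone_neq0.

Lemma qmulE p q : p * q = qmul p q. Proof. by []. Qed.

Lemma q0E : ((re (0 : quat R) = 0) * (im1 (0 : quat R) = 0)
  * (im2 (0 : quat R) = 0) * (im3 (0 : quat R) = 0))%type.
Proof. by rewrite /re /im1 /im2 /im3 !mxE. Qed.

Lemma q1E : ((re (1 : quat R) = 1) * (im1 (1 : quat R) = 0)
  * (im2 (1 : quat R) = 0) * (im3 (1 : quat R) = 0))%type.
Proof. exact: mkqE. Qed.

Lemma qoppE p :
  ((re (- p)%R = (- re p)%R)
   * (im1 (- p)%R = (- im1 p)%R)
   * (im2 (- p)%R = (- im2 p)%R)
   * (im3 (- p)%R = (- im3 p)%R))%type.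
Proof. by rewrite /re /im1 /im2 /im3 !mxE. Qed.

Lemma qscaleE (a : R) p :
  ((re (a *: p) = (a * re p)%R)
   * (im1 (a *: p) = (a * im1 p)%R)
   * (im2 (a *: p) = (a * im2 p)%R)
   * (im3 (a *: p) = (a * im3 p)%R))%type.
Proof. by rewrite /re /im1 /im2 /im3 !mxE. Qed.

Lemma qabs2_eq0 q : (qabs2 q == 0) = (q == 0).
Proof.
apply/eqP/eqP => [|->]; last by rewrite /qabs2 !q0E; ring.
rewrite /qabs2 => h.
have [[[h0 h1] h2] h3] := (sqr_ge0 (re q), sqr_ge0 (im1 q), sqr_ge0 (im2 q),
  sqr_ge0 (im3 q)).
suff [*] : [/\ re q = 0, im1 q = 0, im2 q = 0 & im3 q = 0].
  by apply: quatP; rewrite q0E.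
by split; apply/eqP; rewrite -sqrf_eq0 eq_le; apply/andP; split=> //; lra.
Qed.

Let qmulVq : {in [pred q : quat R | q != 0], left_inverse 1 qinv *%R}.
Proof.
move=> q; rewrite inE -qabs2_eq0 => q0.
apply: quatP; rewrite qmulE /qmul !mkqE !qscaleE !mkqE ?q1E; move: q0;
  by rewrite /qabs2 => q0; field.
Qed.

Let qmulqV : {in [pred q : quat R | q != 0], right_inverse 1 qinv *%R}.
Proof.
move=> q; rewrite inE -qabs2_eq0 => q0.
apply: quatP; rewrite qmulE /qmul !mkqE !qscaleE !mkqE ?q1E; move: q0;
  by rewrite /qabs2 => q0; field.
Qed.

Let qunitP p q : q * p = 1 /\ p * q = 1 -> p \in [pred q : quat R | q != 0].
Proof.
move=> [pq _]; rewrite inE; apply: contra_eq_neq pq => ->.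
by rewrite mulr0 eq_sym oner_neq0.
Qed.

Let qinv_out : {in [predC [pred q : quat R | q != 0]], qinv =1 id}.
Proof.
move=> q; rewrite !inE negbK => /eqP ->.
by apply: quatP; rewrite /qinv qscaleE !mkqE ?q0E; ring.
Qed.

HB.instance Definition _ := GRing.NzRing_hasMulInverse.Build (quat R)
  qmulVq qmulqV qunitP qinv_out.

Lemma qconjM p q : qconj (p * q) = qconj q * qconj p.
Proof. by apply: quatP; rewrite !qmulE /qmul !mkqE; ring. Qed.

Lemma qconjD p q : qconj (p + q) = qconj p + qconj q.
Proof. by apply: quatP; rewrite !(mkqE, qaddE); ring. Qed.

Lemma qconjK : involutive (@qconj).
Proof. by move=> q; apply: quatP; rewrite !mkqE ?opprK. Qed.

Lemma qconj0 : qconj (0 : quat R) = 0.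
Proof. by apply: quatP; rewrite !mkqE !q0E ?oppr0. Qed.

Lemma qconj1 : qconj (1 : quat R) = 1.
Proof. by apply: quatP; rewrite !mkqE ?q1E ?oppr0. Qed.

Lemma qabs2M p q : qabs2 (p * q) = qabs2 p * qabs2 q.
Proof. by rewrite /qabs2 !qmulE /qmul !mkqE; ring. Qed.

Lemma qabs2_conj q : qabs2 (qconj q) = qabs2 q.
Proof. by rewrite /qabs2 !mkqE; ring. Qed.

Lemma qabs2_ge0 q : 0 <= qabs2 q.
Proof. by rewrite /qabs2 !addr_ge0 ?sqr_ge0. Qed.

Lemma qmul_conj q : q * qconj q = mkq (qabs2 q) 0 0 0.
Proof. by apply: quatP; rewrite qmulE /qmul !mkqE /qabs2; ring. Qed.

Lemma qconj_mul q : qconj q * q = mkq (qabs2 q) 0 0 0.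
Proof. by apply: quatP; rewrite qmulE /qmul !mkqE /qabs2; ring. Qed.

Lemma mkq_realC (a : R) q : mkq a 0 0 0 * q = q * mkq a 0 0 0.
Proof. by apply: quatP; rewrite !qmulE /qmul !mkqE; ring. Qed.

Lemma mkq_realB (a b : R) : mkq a 0 0 0 - mkq b 0 0 0 = mkq (a - b) 0 0 0.
Proof. by apply: quatP; rewrite !(qaddE, qoppE, mkqE); ring. Qed.

Lemma mkq1 : mkq 1 0 0 0 = 1 :> quat R. Proof. by []. Qed.

Lemma qabsM p q : qabs (p * q) = qabs p * qabs q.
Proof. by rewrite /qabs qabs2M sqrtrM ?qabs2_ge0. Qed.

Lemma qabs_conj q : qabs (qconj q) = qabs q.
Proof. by rewrite /qabs qabs2_conj. Qed.

Lemma qabs1 : qabs (1 : quat R) = 1.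
Proof. by rewrite /qabs /qabs2 !q1E !expr0n expr1n !addr0 sqrtr1. Qed.

Lemma qabs_eq1 q : qabs q = 1 -> qabs2 q = 1.
Proof. by move=> h; rewrite -[LHS]sqr_sqrtr ?qabs2_ge0// -/(qabs q) h expr1n. Qed.

End Quaternions.

Definition qball (R : realType) : set (quat R) := [set q | qabs q < 1].

Section SliceRegular.
Context {R : realType}.
Implicit Types (f g : quat R -> quat R) (a : nat -> quat R).

Definition qseries a (q : quat R) : nat -> quat R :=
  series (fun n => q ^+ n * a n).

Definition has_expansion f a : Prop :=
  forall q, qball q -> qseries a q @ \oo --> f q.

(* The (unique) coefficients of the expansion of [f] on the unit ball;
   arbitrary when [f] has no such expansion. *)
Definition qcoef f : nat -> quat R := xget (fun=> 0) [set a | has_expansion f a].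

Definition star_mul f g (q : quat R) : quat R :=
  lim (qseries (fun n => \sum_(k < n.+1) qcoef f k * qcoef g (n - k)) q @ \oo).

Definition reg_conj f (q : quat R) : quat R :=
  lim (qseries (fun n => qconj (qcoef f n)) q @ \oo).

Definition symmetrization f : quat R -> quat R := star_mul f (reg_conj f).

Definition star_inv f (q : quat R) : quat R :=
  (symmetrization f q)^-1 * reg_conj f q.

Definition qaffine (a b : quat R) (q : quat R) : quat R := q * a + b.

(* Row [0] of the matrix is [(a, c)] and row [1] is [(b, d)]. *)
Definition mobius (A : 'M[quat R]_2) : quat R -> quat R :=
  star_mul (star_inv (qaffine (A 0 1) (A 1 1))) (qaffine (A 0 0) (A 1 0)).

(* Inverse map of [mobius A] as a map of the unit ball to itself. *)
Definition mobius_inv (A : 'M[quat R]_2) : quat R -> quat R :=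
  'pinv_(fun=> 0) (@qball R) (mobius A).

End SliceRegular.

Section Groups.
Context {R : realType}.
Implicit Types A B : 'M[quat R]_2.

Definition adjmx A : 'M[quat R]_2 := (map_mx qconj A)^T.

Definition diag2 (x y : quat R) : 'M[quat R]_2 :=
  diag_mx (\row_(j < 2) (if j == 0 then x else y)).

Definition I11 : 'M[quat R]_2 := diag2 1 (-1).

Definition Sp11 : set 'M[quat R]_2 := [set A | adjmx A *m I11 *m A = I11].

Definition Sp1x1 : set 'M[quat R]_2 :=
  [set A | exists2 u : quat R, qabs u = 1 & A = diag2 u 1].

Definition Sp1I2 : set 'M[quat R]_2 :=
  [set A | exists2 u : quat R, qabs u = 1 & A = u%:M].

Lemma adjmxM A B : adjmx (A *m B) = adjmx B *m adjmx A.
Proof.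
apply/matrixP => i j; rewrite !mxE !big_ord_recl !big_ord0 !addr0 !mxE.
by rewrite qconjD !qconjM.
Qed.

Lemma adjmxK : involutive adjmx.
Proof. by move=> A; apply/matrixP => i j; rewrite !mxE qconjK. Qed.

Lemma adj_diag2 (x y : quat R) : adjmx (diag2 x y) = diag2 (qconj x) (qconj y).
Proof.
apply/matrixP => i j; rewrite !mxE [i == j]eq_sym.
by case: (j =P i) => [->|_]; rewrite ?mulr1n ?mulr0n ?qconj0//; case: ifP.
Qed.

Lemma mul_diag2 (x y z t : quat R) :
  diag2 x y *m diag2 z t = diag2 (x * z) (y * t).
Proof.
rewrite mulmx_diag; congr diag_mx; apply/rowP => i; rewrite !mxE.
by case: ifP.
Qed.

Lemma I11K : I11 *m I11 = 1%:M.
Proof.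
rewrite mul_diag2 mulrNN !mulr1; apply/matrixP => i j; rewrite !mxE.
by rewrite if_same.
Qed.

Lemma adj_I11 : adjmx I11 = I11.
Proof.
rewrite adj_diag2 qconj1; congr diag2.
by apply: quatP; rewrite !mkqE !qoppE !q1E ?oppr0 ?opprK.
Qed.

Lemma Sp11_mul A B : Sp11 A -> Sp11 B -> Sp11 (A *m B).
Proof.
move=> hA hB; rewrite /Sp11/= adjmxM -!mulmxA (mulmxA I11) (mulmxA (adjmx A)).
by rewrite (mulmxA (adjmx A)) hA mulmxA.
Qed.

Lemma Sp1x1_sub : @Sp1x1 `<=` @Sp11.
Proof.
move=> _ [u /qabs_eq1 u1 ->]; rewrite /Sp11/= /I11 adj_diag2 !mul_diag2.
by rewrite mulr1 qconj_mul u1 mkq1 qconj1 mul1r mulr1.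
Qed.

Lemma Sp1I2_diag (u : quat R) : u%:M = diag2 u u.
Proof. by apply/matrixP => i j; rewrite !mxE if_same. Qed.

Lemma Sp1I2_sub : @Sp1I2 `<=` @Sp11.
Proof.
move=> _ [u /qabs_eq1 u1 ->]; rewrite Sp1I2_diag /Sp11/= /I11 adj_diag2.
by rewrite !mul_diag2 mulr1 mulrN mulr1 mulNr qconj_mul u1 mkq1.
Qed.

Lemma Sp1I2_1 : Sp1I2 1%:M.
Proof. by exists 1 => //; exact: qabs1. Qed.

Lemma Sp1I2_mul A B : Sp1I2 A -> Sp1I2 B -> Sp1I2 (A *m B).
Proof.
move=> [u u1 ->] [v v1 ->]; exists (u * v); first by rewrite qabsM u1 v1 mulr1.
by rewrite !Sp1I2_diag mul_diag2.
Qed.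

Lemma Sp1I2_inv A : Sp1I2 A -> exists2 B, Sp1I2 B & A *m B = 1%:M.
Proof.
move=> [u u1 ->]; exists (qconj u)%:M.
  by exists (qconj u) => //; rewrite qabs_conj.
by rewrite !Sp1I2_diag mul_diag2 qmul_conj qabs_eq1.
Qed.

Lemma Sp1x1_1 : Sp1x1 1%:M.
Proof. by exists 1; rewrite ?Sp1I2_diag//; exact: qabs1. Qed.

Lemma Sp1x1_mul A B : Sp1x1 A -> Sp1x1 B -> Sp1x1 (A *m B).
Proof.
move=> [u u1 ->] [v v1 ->]; exists (u * v); first by rewrite qabsM u1 v1 mulr1.
by rewrite mul_diag2 mulr1.
Qed.

Lemma Sp1x1_inv A : Sp1x1 A -> exists2 B, Sp1x1 B & B *m A = 1%:M.
Proof.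
move=> [u u1 ->]; exists (diag2 (qconj u) 1).
  by exists (qconj u) => //; rewrite qabs_conj.
by rewrite Sp1I2_diag mul_diag2 qconj_mul qabs_eq1// mulr1.
Qed.

Definition invSp A : 'M[quat R]_2 := I11 *m adjmx A *m I11.

Lemma invSp_mul A : Sp11 A -> invSp A *m A = 1%:M.
Proof. by move=> hA; rewrite /invSp -!mulmxA (mulmxA _ I11) hA I11K. Qed.

Lemma mul_invSp A : Sp11 A -> A *m invSp A = 1%:M.
Proof.
move=> hA.
pose a := A 0 0; pose c := A 0 1; pose b := A 1 0; pose d := A 1 1.
have ord2 (P : 'I_2 -> Prop) : P 0 -> P 1 -> forall i, P i.
  move=> P0 P1; case=> -[|[|//]] ?; [move: P0|move: P1];
    by congr P; exact: val_inj.
have ent B C i j : (B *m C : 'M[quat R]_2) i j = B i 0 * C 0 j + B i 1 * C 1 j.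
  rewrite !mxE !big_ord_recl big_ord0 addr0; congr (_ + _ * _);
    by congr (_ _ _); exact: val_inj.
have IE : ((I11 0 0 = 1 :> quat R) * (I11 0 1 = 0 :> quat R)
    * (I11 1 0 = 0 :> quat R) * (I11 1 1 = - 1 :> quat R))%type.
  by rewrite !mxE.
have adjE i j : adjmx A i j = qconj (A j i) by rewrite !mxE.
have E i j : qconj (A 0 i) * A 0 j - qconj (A 1 i) * A 1 j = I11 i j.
  move/matrixP: hA => /(_ i j) <-; rewrite !ent !IE !adjE !mulr0 !mulr1 !addr0.
  by rewrite add0r mulrN1 mulNr.
have F i j : (A *m invSp A) i j =
    (A i 0 * qconj (A j 0) - A i 1 * qconj (A j 1)) * I11 j j.
  rewrite /invSp !ent !IE !mul1r !mul0r !addr0 !add0r !adjE.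
  move: j; apply: ord2; rewrite !IE !(mulr1, mulr0, addr0, add0r);
    by rewrite ?mulN1r ?mulrN1 ?mulrN ?opprK ?mulrBl// opprD opprK.
have /esym E01 : qconj a * c = qconj b * d.
  by apply/eqP; rewrite -subr_eq0 E IE.
have E00 : qabs2 a - qabs2 b = 1.
  by have := E 0 0; rewrite !qconj_mul mkq_realB IE => /(congr1 re); rewrite !mkqE ?q1E.
have E11 : qabs2 c - qabs2 d = - 1.
  by have := E 1 1; rewrite !qconj_mul mkq_realB IE => /(congr1 re); rewrite !mkqE qoppE ?mkqE ?q1E.
have N : qabs2 b * qabs2 d = qabs2 a * qabs2 c.
  by have := congr1 qabs2 E01; rewrite !qabs2M !qabs2_conj.
have bc : qabs2 b = qabs2 c by nra.
have ad : qabs2 a = qabs2 d by lra.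
have a0 : mkq (qabs2 a) 0 0 0 != 0 :> quat R.
  apply/eqP => /(congr1 re); rewrite mkqE q0E => a0.
  by have := qabs2_ge0 b; lra.
have G : a * qconj b = c * qconj d.
  have U : mkq (qabs2 a) 0 0 0 \is a (@GRing.unit (quat R)) by [].
  apply: (mulrI U); rewrite mkq_realC {1}ad -qmul_conj -[in RHS]qmul_conj.
  by rewrite !mulrA -(mulrA a (qconj b)) E01 !mulrA.
have G' : b * qconj a = d * qconj c.
  by have := congr1 qconj G; rewrite !qconjM !qconjK.
apply/matrixP => i j; rewrite F; move: i j.
apply: (ord2); apply: (ord2); rewrite -?/a -?/b -?/c -?/d IE mxE/=.
- by rewrite !qmul_conj mkq_realB mulr1 -bc E00.
- by rewrite G subrr mul0r.
- by rewrite G' subrr mul0r.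
- rewrite !qmul_conj mkq_realB -ad bc -opprB -bc E00 mulrN1.
  by apply: quatP; rewrite !(qoppE, mkqE, q1E); ring.
Qed.

End Groups.
(* [cmap] is only meaningful on [cdom], and [cinv] on the image of [cdom]. *)
Record chart (R : realType) (T : Type) (n : nat) := Chart {
  cdom : set T;
  cmap : T -> 'rV[R]_n;
  cinv : 'rV[R]_n -> T }.

Section SmoothManifolds.
Context {R : realType}.

(* For [O] open in a finite-dimensional space, [Ck k O f] states that [f] is of
   class C^k on [O]: all iterated directional derivatives up to order [k] exist
   and are continuous. *)
Fixpoint Ck (k : nat) (V W : normedModType R) (O : set V) (f : V -> W) : Prop :=
  match k with
  | 0 => forall x, O x -> {for x, continuous f}
  | k'.+1 => (forall x, O x -> differentiable f x) /\
             (forall v, Ck k' O (fun x => 'D_v f x))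
  end.

Definition smooth_on (V W : normedModType R) (O : set V) (f : V -> W) : Prop :=
  forall k, Ck k O f.

Definition cimg (T : Type) n (phi : chart R T n) : set 'rV[R]_n :=
  cmap phi @` cdom phi.

Definition is_chart (T : topologicalType) n (phi : chart R T n) : Prop :=
  [/\ open (cdom phi), open (cimg phi),
      forall x, cdom phi x -> cinv phi (cmap phi x) = x,
      forall x, cdom phi x -> {for x, continuous (cmap phi)} &
      forall y, cimg phi y -> {for y, continuous (cinv phi)}].

(* [A] is a (not necessarily maximal) smooth atlas making [T] a smooth manifold
   of dimension [n]. *)
Definition smooth_manifold (T : topologicalType) n (A : set (chart R T n)) : Prop :=
  [/\ hausdorff_space T /\ @second_countable T,
      forall phi, A phi -> is_chart phi,
      forall p : T, exists2 phi, A phi & cdom phi p &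
      forall phi psi, A phi -> A psi ->
        smooth_on (cmap phi @` (cdom phi `&` cdom psi)) (cmap psi \o cinv phi)].

Definition coord_map (T T' : Type) m n (phi : chart R T m) (psi : chart R T' n)
  (f : T -> T') : 'rV[R]_m -> 'rV[R]_n := cmap psi \o f \o cinv phi.

Definition smooth_map (T T' : topologicalType) m n (A : set (chart R T m))
    (B : set (chart R T' n)) (f : T -> T') : Prop :=
  forall p : T, exists phi psi (O : set T),
    [/\ A phi, B psi, open O /\ O p,
        O `<=` cdom phi /\ f @` O `<=` cdom psi &
        smooth_on (cmap phi @` O) (coord_map phi psi f)].

Definition submersion (T T' : topologicalType) m n (A : set (chart R T m))
    (B : set (chart R T' n)) (f : T -> T') : Prop :=
  smooth_map A B f /\
  forall p : T, exists phi psi,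
    [/\ A phi, B psi, cdom phi p, cdom psi (f p) &
        forall w, exists v, 'd (coord_map phi psi f) (cmap phi p) v = w].

Definition diffeomorphism (T T' : topologicalType) m n (A : set (chart R T m))
    (B : set (chart R T' n)) (f : T -> T') : Prop :=
  exists g : T' -> T,
    [/\ cancel f g, cancel g f, smooth_map A B f & smooth_map B A g].

Definition prod_chart (T T' : Type) m n (phi : chart R T m) (psi : chart R T' n) :
    chart R (T * T') (m + n) := {|
  cdom := cdom phi `*` cdom psi;
  cmap := fun p => row_mx (cmap phi p.1) (cmap psi p.2);
  cinv := fun y => (cinv phi (lsubmx y), cinv psi (rsubmx y)) |}.

Definition prod_atlas (T T' : Type) m n (A : set (chart R T m))
    (B : set (chart R T' n)) : set (chart R (T * T') (m + n)) :=
  [set prod_chart p.1 p.2 | p in A `*` B].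

(* The maximal atlas of the [n]-dimensional embedded submanifold [X], with the
   subspace topology, of the linear space [E], where [c] is a linear
   identification of [E] with a normed space: the charts are the homeomorphisms
   between open subsets of [X] and of [R^n] that are diffeomorphisms, i.e. that
   locally extend to smooth maps on the ambient space, and have a smooth
   inverse. *)
Definition submanifold_atlas (E : topologicalType) (V : normedModType R)
    (c : E -> V) (X : set E) n : set (chart R (set_type X) n) :=
  [set phi | [/\ is_chart phi,
     smooth_on (cimg phi) (fun y => c (set_val (cinv phi y))) &
     forall p, cdom phi p -> exists O (g : V -> 'rV[R]_n),
       [/\ open O, O (c (set_val p)), smooth_on O g &
           forall q, cdom phi q -> O (c (set_val q)) ->
             cmap phi q = g (c (set_val q))]]].

(* [A] and [B] being smooth structures on [P] and on its quotient, the latter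
   with the quotient topology. *)
Definition quotient_structure (P Q : topologicalType) m n
    (A : set (chart R P m)) (B : set (chart R Q n)) (pi : P -> Q) : Prop :=
  smooth_manifold B /\ submersion A B pi.

Definition proper_map (T T' : topologicalType) (f : T -> T') : Prop :=
  continuous f /\ forall K : set T', compact K -> compact (f @^-1` K).

End SmoothManifolds.

Section Cosets.
Context {R : realType}.
Local Open Scope quotient_scope.

Definition mat_coords (A : 'M[quat R]_2) : 'M[R]_(2 * 2, 4) :=
  \matrix_(i, j) (mxvec A 0 i : 'rV[R]_4) 0 j.

Let Sp : Type := set_type (@Sp11 R).

Lemma SpP (A : Sp) : Sp11 (set_val A).
Proof. exact: set_mem (valP A). Qed.

Definition mkSp (A : 'M[quat R]_2) (hA : Sp11 A) : Sp := exist _ A (mem_set hA).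

Definition coset_rel (A B : Sp) : bool :=
  `[< exists2 h, Sp1I2 h & set_val B = set_val A *m h >].

Lemma coset_rel_refl : reflexive coset_rel.
Proof.
by move=> A; apply/asboolP; exists 1%:M; [exact: Sp1I2_1|rewrite mulmx1].
Qed.

Lemma coset_rel_sym : symmetric coset_rel.
Proof.
suff H A B : coset_rel A B -> coset_rel B A by move=> A B; apply/idP/idP; apply: H.
move=> /asboolP[h Hh eB]; apply/asboolP.
by have [k Hk hk] := Sp1I2_inv Hh; exists k; rewrite // eB -mulmxA hk mulmx1.
Qed.

Lemma coset_rel_trans : transitive coset_rel.
Proof.
move=> B A C /asboolP[h Hh eB] /asboolP[k Hk eC]; apply/asboolP.
by exists (h *m k); [exact: Sp1I2_mul|rewrite eC eB mulmxA].
Qed.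

Canonical coset_equiv :=
  EquivRel coset_rel coset_rel_refl coset_rel_sym coset_rel_trans.

Definition coset_space : Type := quotient_topology {eq_quot coset_equiv}.
HB.instance Definition _ := Topological.on coset_space.
HB.instance Definition _ := Quotient.on coset_space.

Definition coset_proj (A : Sp) : coset_space := \pi_coset_space A.

Lemma coset_projP (A B : Sp) :
  coset_proj A = coset_proj B <-> exists2 h, Sp1I2 h & set_val B = set_val A *m h.
Proof.
split=> [/(@eqmodP _ coset_equiv)|h]; first exact: asboolW.
by apply/(@eqmodP _ coset_equiv); apply/asboolP.
Qed.

Definition dcoset_rel (A B : Sp) : bool :=
  `[< exists g h, [/\ Sp1x1 g, Sp1I2 h & set_val B = g *m set_val A *m h] >].

Lemma dcoset_rel_refl : reflexive dcoset_rel.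
Proof.
move=> A; apply/asboolP; exists 1%:M, 1%:M; rewrite mulmx1 mul1mx.
by split; [exact: Sp1x1_1|exact: Sp1I2_1|].
Qed.

Lemma dcoset_rel_sym : symmetric dcoset_rel.
Proof.
suff H A B : dcoset_rel A B -> dcoset_rel B A.
  by move=> A B; apply/idP/idP; apply: H.
move=> /asboolP[g [h [Hg Hh eB]]]; apply/asboolP.
have [k Hk hk] := Sp1I2_inv Hh; have [f Hf fg] := Sp1x1_inv Hg.
by exists f, k; split; rewrite // eB -!mulmxA hk mulmx1 mulmxA fg mul1mx.
Qed.

Lemma dcoset_rel_trans : transitive dcoset_rel.
Proof.
move=> B A C /asboolP[g [h [Hg Hh eB]]] /asboolP[f [k [Hf Hk eC]]].
apply/asboolP; exists (f *m g), (h *m k); split;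
  [exact: Sp1x1_mul|exact: Sp1I2_mul|by rewrite eC eB !mulmxA].
Qed.

Canonical dcoset_equiv :=
  EquivRel dcoset_rel dcoset_rel_refl dcoset_rel_sym dcoset_rel_trans.

Definition dcoset_space : Type := quotient_topology {eq_quot dcoset_equiv}.
HB.instance Definition _ := Topological.on dcoset_space.
HB.instance Definition _ := Quotient.on dcoset_space.

Definition dcoset_proj (A : Sp) : dcoset_space := \pi_dcoset_space A.

Lemma dcoset_projP (A B : Sp) : dcoset_proj A = dcoset_proj B <->
  exists g h, [/\ Sp1x1 g, Sp1I2 h & set_val B = g *m set_val A *m h].
Proof.
split=> [/(@eqmodP _ dcoset_equiv)|h]; first exact: asboolW.
by apply/(@eqmodP _ dcoset_equiv); apply/asboolP.
Qed.

(* [A Sp(1)I_2 |-> (g A) Sp(1)I_2]. *)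
Definition coset_act (g : set_type (@Sp1x1 R)) (x : coset_space) : coset_space :=
  coset_proj (mkSp (Sp11_mul (Sp1x1_sub (set_mem (valP g))) (SpP (repr x)))).

Lemma coset_actE g (A : Sp) : coset_act g (coset_proj A) =
  coset_proj (mkSp (Sp11_mul (Sp1x1_sub (set_mem (valP g))) (SpP A))).
Proof.
have [h Hh e] := (coset_projP _ _).1 (reprK (coset_proj A) : coset_proj _ = _).
by apply/coset_projP; exists h; rewrite // -mulmxA -e.
Qed.

Lemma coset_act1 g (x : coset_space) : set_val g = 1%:M -> coset_act g x = x.
Proof.
move=> g1; rewrite -(reprK x) -/(coset_proj _) coset_actE.
apply/coset_projP; exists 1%:M; first exact: Sp1I2_1.
change (set_val (repr x) = set_val g *m set_val (repr x) *m 1%:M).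
by rewrite mulmx1 g1 mul1mx.
Qed.

Lemma coset_actM g h k (x : coset_space) :
  set_val k = set_val g *m set_val h ->
  coset_act k x = coset_act g (coset_act h x).
Proof.
move=> e; rewrite -(reprK x) -/(coset_proj _) !coset_actE.
apply/coset_projP; exists 1%:M; first exact: Sp1I2_1.
change (set_val g *m (set_val h *m set_val (repr x)) =
  set_val k *m set_val (repr x) *m 1%:M).
by rewrite mulmx1 e mulmxA.
Qed.

(* [A Sp(1)I_2 |-> (Sp(1) x {1}) A Sp(1)I_2]. *)
Definition orbit_proj (x : coset_space) : dcoset_space := dcoset_proj (repr x).

Lemma orbit_projE (A : Sp) : orbit_proj (coset_proj A) = dcoset_proj A.
Proof.
have [h Hh e] := (coset_projP _ _).1 (reprK (coset_proj A) : coset_proj _ = _).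
apply/dcoset_projP; exists 1%:M, h.
by split; rewrite ?mul1mx//; exact: Sp1x1_1.
Qed.

Lemma orbit_projP (x y : coset_space) :
  orbit_proj x = orbit_proj y <-> exists g, coset_act g x = y.
Proof.
rewrite -(reprK x) -(reprK y) -/(coset_proj _) -/(coset_proj (repr y)).
rewrite !orbit_projE; split=> [/dcoset_projP [g [h [Hg Hh e]]]|[g]].
  exists (exist _ g (mem_set Hg)); rewrite coset_actE.
  by apply/coset_projP; exists h.
rewrite coset_actE => /coset_projP[h Hh e]; apply/dcoset_projP.
by exists (set_val g), h; split=> //; exact: set_mem (valP g).
Qed.

End Cosets.

Arguments coset_space : clear implicits.
Arguments dcoset_space : clear implicits.

(* Main.v *)
Require Import Defs.
From HB Require Import structures.
From mathcomp Require Import all_boot all_order all_algebra.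
From mathcomp Require Import all_classical all_reals all_analysis.
From mathcomp Require Import perm ring lra.
Import Order.TTheory GRing.Theory Num.Theory.
Import numFieldNormedType.Exports.
Set Implicit Arguments.
Unset Strict Implicit.
Unset Printing Implicit Defensive.
Local Open Scope classical_set_scope.
Local Open Scope ring_scope.

(** Write a matrix of Sp(1,1) as [[a, c], [b, d]] and put q = b d^-1,
    u = a d^-1, v = d / |d|.  The defining relations give |d|^2 = 1 + |b|^2,
    |a| = |d| and a conj(b) = c conj(d), so that q lies in the open ball, u and v
    are unit quaternions, and the matrix is recovered as
      (1 - |q|^2)^(-1/2) [[u v, u conj(q) v], [q v, v]]     (lemma [spmxK]).
    Thus Sp(1,1) is the product of the ball B and two spheres S^3.  Right
    multiplication by w I_2 only replaces v by v w, and left multiplication by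
    diag(w, 1) only replaces u by w u ([qcoord_act]).  The coset space is
    therefore B x S^3 with coordinates (q, u), the group Sp(1) x {1} acts on it by
    translating u, and the double coset space is B with coordinate q.  Smoothness
    and freeness of the action are visible in these coordinates; it is proper
    because the group is compact.

    The value of the map of the statement is this same q = b d^-1.  Let X be the
    value at q of the *-reciprocal of q c + d.  Then X d + q X c = 1
    ([star_inv_affine]), and comparing power series gives F_A(q) = X b + q X a
    ([mobiusE]); in other words the row (q X, X) times A is (F_A(q), 1).  Replacing
    A by the inverse of M, F is zero at q if and only if (q X, X) = (0, 1) M, i.e.
    X = d and q X = b for the entries b and d of M.  So b d^-1 is the only zero
    ([mobius_invSp_eq0]), and the map is the coordinate q.

    To turn the coordinates into manifold structures, each space T is presented
    by an embedding E : T -> V into a finite-dimensional space together with a map S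
    from an open subset of V back to T such that S E = id and E S is smooth
    ([retract]).  A map f between such spaces is smooth as soon as E' f S is
    ([smooth_rep_map]), and the charts of T compatible with E form an atlas.
    This gives the existence of the quotient structures, the submersions being
    recognized by their smooth sections through every point
    ([split_submersion_submersion]).

    The statement also quantifies over all quotient structures, so each of them
    must be shown to agree with the one constructed ([smooth_structure_unique]).
    For a chart psi of another structure, the change of coordinates f from
    a chart of the constructed structure to psi is smooth because the projection
    has smooth sections for the constructed structure; its derivative is onto
    because the projection is a submersion for the other structure, hence
    invertible as the dimensions agree; and f is a homeomorphism.  The inverse of
    a smooth homeomorphism with invertible derivative is smooth
    ([smooth_inverse]). *)

(** * Maps of class C^k between finite-dimensional spaces *)

Section Calculus.
Context {R : realType}.
Implicit Types V W Z : normedModType R.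

(** The differential can be certified by an explicit candidate and an estimate in
    the norm; this is how the derivative of an inverse map is found below. *)
Lemma diff_approx V W (f : V -> W) (L : {linear V -> W}) x :
  continuous L ->
  (forall e, 0 < e -> \forall h \near 0, `|f (h + x) - f x - L h| <= e * `|h|) ->
  differentiable f x /\ 'd f x = L :> (V -> W).
Proof.
move=> cL fL.
have fo : f \o shift x = cst (f x) + L +o_ 0 id.
  apply/eqaddoP => e e0; near=> h; rewrite /= opprD addrA.
  by near: h; exact: fL.
have dE := diff_unique cL fo.
by split=> //; apply/diff_locallyP; rewrite dE.
Unshelve. all: by end_near. Qed.

Lemma near_differentiable V W (f g : V -> W) x :
  (\forall y \near x, f y = g y) -> differentiable f x -> differentiable g x.
Proof.
move=> fg df.
suff H : forall e, 0 < e ->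
    \forall h \near 0, `|g (h + x) - g x - 'd f x h| <= e * `|h|.
  by have [] := diff_approx (diff_continuous df) H.
move=> e e0; have /diff_locally/eqaddoP/(_ _ e0) := df.
have : \forall h \near (0 : V), f (h + x) = g (h + x).
  by have := fg; rewrite (near_shift 0)/= => H; apply: filterS H => h /=; rewrite subr0.
have fgx := nbhs_singleton fg.
apply: filterS2 => h; rewrite /= opprD addrA -fgx => <-; exact.
Qed.

(** Finite-dimensional normed spaces, given by a basis [e] and continuous dual
    coordinates [c].  They are needed for the intermediate space of a composition: the
    derivative of [g \o f] along [v] is written as the sum of the products of
    [c i ('D_v f)] with [('D_(e i) g) \o f], an expression to which an induction on the
    order of differentiability applies.  It is a class so that the
    coordinates of matrix spaces and of their products are inferred. *)
Class findim (W : normedModType R) : Prop := Findim {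
  findimP : exists (I : finType) (e : I -> W) (c : I -> {linear W -> R}),
    (forall i, continuous (c i)) /\ forall w, w = \sum_i c i w *: e i }.

Lemma CkS V W k (O : set V) (f : V -> W) : Ck k.+1 O f -> Ck k O f.
Proof.
elim: k f => [|k IH] f [df Df]; first by move=> x Ox; apply/differentiable_continuous/df.
by split=> // v; exact/IH/Df.
Qed.

Lemma Ck_sub V W k (O U : set V) (f : V -> W) : O `<=` U -> Ck k U f -> Ck k O f.
Proof.
move=> OU; elim: k f => [|k IH] f /=; first by move=> H x /OU/H.
by move=> [df Df]; split=> [x /OU/df//|v]; exact/IH/Df.
Qed.

Lemma Ck_local V W k (O : set V) (f : V -> W) :
  (forall x, O x -> exists2 U, U x & Ck k U f) -> Ck k O f.
Proof.
elim: k f => [|k IH] f H /=; first by move=> x /H[U Ux]; apply.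
split=> [x /H[U Ux [df _]]|v]; first exact: df.
by apply: IH => x /H[U Ux [_ Df]]; exists U; last exact: Df.
Qed.

Lemma open_near V (O : set V) x (P : V -> Prop) : open O -> O x ->
  (forall y, O y -> P y) -> \forall y \near x, P y.
Proof. by move=> oO Ox H; apply: filterS (open_nbhs_nbhs (conj oO Ox)). Qed.

Lemma Ck_ext V W k (O : set V) (f g : V -> W) : open O ->
  (forall x, O x -> f x = g x) -> Ck k O f -> Ck k O g.
Proof.
move=> oO; elim: k f g => [|k IH] f g fg /=.
  move=> cf x Ox; rewrite /prop_for /continuous_at -(fg x Ox).
  apply: cvg_trans (cf x Ox); apply: near_eq_cvg.
  by apply: (open_near oO Ox) => y /fg ->.
move=> [df Df]; split=> [x Ox|v].
  by apply: near_differentiable (df x Ox); apply: (open_near oO Ox) => y /fg ->.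
apply: (IH ('D_v f)) => // x Ox.
by apply: near_eq_derive; apply: (open_near oO Ox) => y /fg ->.
Qed.

(** The form in which all closure properties are proved: exhibit the directional
    derivatives by a formula that is already known to be C^k. *)
Lemma CkS_intro V W k (O : set V) (f : V -> W) : open O ->
  (forall x, O x -> differentiable f x) ->
  (forall v, exists2 h, Ck k O h & forall x, O x -> h x = 'D_v f x) ->
  Ck k.+1 O f.
Proof.
by move=> oO df H; split=> // v; have [h Ch hE] := H v; exact: Ck_ext hE Ch.
Qed.

Lemma Ck_cst V W k (O : set V) (a : W) : open O -> Ck k O (fun=> a).
Proof.
move=> oO; elim: k a => [|k IH] a; first by move=> x _; exact: cvg_cst.
apply: CkS_intro => // v; exists (fun=> 0) => // x _; exact/esym/derive_cst.
Qed.

Lemma Ck_add V W k (O : set V) (f g : V -> W) : open O -> Ck k O f -> Ck k O g ->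
  Ck k O (fun x => f x + g x).
Proof.
move=> oO; elim: k f g => [|k IH] f g.
  by move=> cf cg x Ox; exact: (continuousD (cf x Ox) (cg x Ox)).
move=> [df Df] [dg Dg]; apply: CkS_intro => //.
  by move=> x Ox; exact: (differentiableD (df x Ox) (dg x Ox)).
move=> v; exists (fun x => 'D_v f x + 'D_v g x); first exact: (IH ('D_v f) ('D_v g) (Df v) (Dg v)).
by move=> x Ox; rewrite -deriveD//; apply: diff_derivable; [exact: (df x Ox)|exact: (dg x Ox)].
Qed.

Lemma Ck_sum V W k (O : set V) (I : finType) (f : I -> V -> W) : open O ->
  (forall i, Ck k O (f i)) -> Ck k O (fun x => \sum_i f i x).
Proof.
move=> oO Cf; elim: (index_enum I) => [|i r IH].
  by apply: Ck_ext (Ck_cst k 0 oO) => // x _; rewrite big_nil.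
by apply: Ck_ext (Ck_add oO (Cf i) IH) => // x _; rewrite big_cons.
Qed.

Lemma Ck_comp_linear V W Z k (O : set V) (L : {linear W -> Z}) (f : V -> W) :
  open O -> continuous L -> Ck k O f -> Ck k O (fun x => L (f x)).
Proof.
move=> oO cL; elim: k f => [|k IH] f.
  by move=> cf x Ox; exact: (continuous_comp (cf x Ox) (cL _)).
move=> [df Df]; have dL y : differentiable L y by exact: linear_differentiable.
have dLf x : O x -> differentiable (L \o f) x.
  by move=> Ox; apply: differentiable_comp => //; exact: df.
apply: CkS_intro => // v; exists (fun x => L ('D_v f x)); first exact: (IH ('D_v f) (Df v)).
move=> x Ox; rewrite [RHS](deriveE v (dLf x Ox)) (deriveE v (df x Ox)).
by rewrite (diff_comp (df x Ox) (dL _)) /= diff_lin.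
Qed.

Lemma Ck_linear V W k (O : set V) (L : {linear V -> W}) : open O ->
  continuous L -> Ck k O L.
Proof.
move=> oO cL; case: k => [|k]; first by move=> x _; exact: cL.
apply: CkS_intro => [//|x _|v]; first exact: linear_differentiable.
exists (fun=> L v); first exact: Ck_cst.
by move=> x _; rewrite deriveE ?diff_lin//; exact: linear_differentiable.
Qed.

Lemma Ck_id V k (O : set V) : open O -> Ck k O id.
Proof. by move=> oO; apply: (@Ck_linear _ _ k O idfun) => // x; exact: cvg_id. Qed.

Lemma Ck_opp V W k (O : set V) (f : V -> W) : open O -> Ck k O f ->
  Ck k O (fun x => - f x).
Proof.
move=> oO Cf; apply: (@Ck_comp_linear _ _ _ k O (-%R)) => //.
exact: opp_continuous.
Qed.

Lemma Ck_mul V k (O : set V) (f g : V -> R) : open O -> Ck k O f -> Ck k O g ->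
  Ck k O (fun x => f x * g x).
Proof.
move=> oO; elim: k f g => [|k IH] f g.
  by move=> cf cg x Ox; exact: (continuousM (cf x Ox) (cg x Ox)).
move=> Cf Cg; have [df Df] := Cf; have [dg Dg] := Cg; apply: CkS_intro => //.
  by move=> x Ox; exact: (differentiableM (df x Ox) (dg x Ox)).
move=> v; exists (fun x => f x * 'D_v g x + g x * 'D_v f x).
  exact: (Ck_add oO (IH _ _ (CkS Cf) (Dg v)) (IH _ _ (CkS Cg) (Df v))).
move=> x Ox.
by symmetry; exact: (deriveM (diff_derivable (df x Ox)) (diff_derivable (dg x Ox))).
Qed.

Lemma Ck_scalel V W k (O : set V) (f : V -> R) (w : W) : open O -> Ck k O f ->
  Ck k O (fun x => f x *: w).
Proof.
move=> oO Cf.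
have lin : linear (fun a : R => a *: w : W).
  by move=> a b c; rewrite scalerDl scalerA.
pose M := GRing.isLinear.Build _ _ _ _ _ lin.
pose L : {linear _ -> _} := HB.pack (fun a : R => a *: w : W) M.
apply: (@Ck_comp_linear _ _ _ k O L f) => //.
exact: scalel_continuous.
Qed.

Lemma Ck_coord V W k (O : set V) (f : V -> W) (I : finType) (e : I -> W)
    (c : I -> {linear W -> R}) : open O ->
  (forall w, w = \sum_i c i w *: e i) ->
  (forall i, Ck k O (fun x => c i (f x))) -> Ck k O f.
Proof.
move=> oO cE Cf.
apply: (@Ck_ext _ _ k O (fun x => \sum_i c i (f x) *: e i)) => //.
apply: (Ck_sum (f := fun i x => c i (f x) *: e i)) => // i.
exact: Ck_scalel (Cf i).
Qed.

(** The chain rule, by induction on [k]; the induction varies [g] over its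
    directional derivatives while [f] stays fixed. *)
Lemma Ck_comp_real V W k (O : set V) (U : set W) (g : W -> R) (f : V -> W) :
  findim W -> open O -> (forall x, O x -> U (f x)) ->
  Ck k U g -> Ck k O f -> Ck k O (fun x => g (f x)).
Proof.
move=> [[n [e [c [cc cE]]]]] oO fU; elim: k g => [|k IH] g.
  by move=> cg cf x Ox; exact: (continuous_comp (cf x Ox) (cg _ (fU x Ox))).
move=> [dg Dg] Cf; have [df Df] := Cf.
have dgf x : O x -> differentiable (g \o f) x.
  by move=> Ox; apply: differentiable_comp; [exact: df|exact/dg/fU].
apply: CkS_intro => // v.
exists (fun x => \sum_i c i ('D_v f x) * 'D_(e i) g (f x)).
  apply: Ck_sum => // i; apply: Ck_mul => //; first exact: (Ck_comp_linear oO (cc i) (Df v)).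
  exact: (IH ('D_(e i) g) (Dg _) (CkS Cf)).
move=> x Ox; rewrite [RHS](deriveE v (dgf _ Ox)).
rewrite (diff_comp (df x Ox) (dg _ (fU x Ox))) /= -(deriveE v (df x Ox)).
rewrite [in RHS](cE ('D_v f x)) linear_sum.
by apply: eq_bigr => i _; rewrite linearZ (deriveE _ (dg _ (fU x Ox))).
Qed.

(** Reduced to real-valued [g] by the coordinates of [Z]. *)
Lemma Ck_comp V W Z k (O : set V) (U : set W) (g : W -> Z) (f : V -> W) :
  findim W -> findim Z -> open O -> open U -> (forall x, O x -> U (f x)) ->
  Ck k U g -> Ck k O f -> Ck k O (fun x => g (f x)).
Proof.
move=> fW [[n [e [c [cc cE]]]]] oO oU fU Cg Cf; apply: (Ck_coord (c := c)) => // i.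
exact: (Ck_comp_real fW oO fU (Ck_comp_linear oU (cc i) Cg) Cf).
Qed.

Lemma Ck_inv V k (O : set V) (f : V -> R) : open O ->
  (forall x, O x -> f x != 0) -> Ck k O f -> Ck k O (fun x => (f x)^-1).
Proof.
move=> oO f0; elim: k => [|k IH].
  by move=> cf x Ox; exact: (cvgV (f0 x Ox) (cf x Ox)).
move=> Cf; have [df Df] := Cf; apply: CkS_intro => //.
  by move=> x Ox; exact: (differentiableV (df x Ox) (f0 x Ox)).
move=> v; exists (fun x => - ((f x)^-1 * (f x)^-1 * 'D_v f x)).
  have Ci := IH (CkS Cf).
  exact: (Ck_opp oO (Ck_mul oO (Ck_mul oO Ci Ci) (Df v))).
move=> x Ox; rewrite deriveV; [|exact: f0|exact/diff_derivable/df].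
by rewrite -exprVn expr2 scaleNr.
Qed.

Lemma Ck_sqrt V k (O : set V) (f : V -> R) : open O ->
  (forall x, O x -> 0 < f x) -> Ck k O f -> Ck k O (fun x => Num.sqrt (f x)).
Proof.
move=> oO f0; elim: k => [|k IH].
  by move=> cf x Ox; exact: (continuous_comp (cf x Ox) (@sqrt_continuous R _)).
move=> Cf; have [df Df] := Cf.
have ds x : O x -> differentiable (@Num.sqrt R) (f x).
  by move=> Ox; apply/derivable1_diffP; have [] := is_derive1_sqrt (f0 _ Ox).
have dsf x : O x -> differentiable (@Num.sqrt R \o f) x.
  by move=> Ox; apply: differentiable_comp; [exact: df|exact: ds].
apply: CkS_intro => // v.
exists (fun x => (2 * Num.sqrt (f x))^-1 * 'D_v f x).
  have C2 := Ck_mul oO (Ck_cst (W := R) k (2 : R) oO) (IH (CkS Cf)).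
  apply: (Ck_mul oO _ (Df v)); apply: (Ck_inv oO _ C2).
  by move=> x Ox; rewrite mulf_neq0// gt_eqF// sqrtr_gt0 f0.
move=> x Ox; rewrite [RHS](deriveE v (dsf _ Ox)).
rewrite (diff_comp (df x Ox) (ds x Ox)) /= -(deriveE v (df x Ox)).
rewrite -[in RHS](mulr1 ('D_v f x)) [RHS]linearZ -(deriveE (V := R) (1 : R) (ds x Ox)).
by rewrite derive_sqrt ?f0// mulrC.
Qed.


Definition as_linear V W (f : V -> W) (lf : linear f) : {linear V -> W} :=
  HB.pack f (GRing.isLinear.Build _ _ _ _ _ lf).

Lemma entry_linear m n i j : linear (fun M : 'M[R]_(m, n) => M i j).
Proof. by move=> a A B; rewrite !mxE. Qed.

#[export] Instance findim_mx m n : findim 'M[R]_(m, n).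
Proof.
constructor; exists ('I_m * 'I_n)%type, (fun p => delta_mx p.1 p.2),
  (fun p => as_linear (entry_linear p.1 p.2)); split=> [p|A].
  exact: coord_continuous.
by rewrite {1}[A]matrix_sum_delta pair_big.
Qed.

Lemma fst_linear V W : linear (fst : V * W -> V). Proof. by []. Qed.
Lemma snd_linear V W : linear (snd : V * W -> W). Proof. by []. Qed.
Lemma linear_comp V W Z (f : V -> W) (g : W -> Z) :
  linear f -> linear g -> linear (fun x => g (f x)).
Proof. by move=> lf lg a x y; rewrite lf lg. Qed.
Lemma pair_linear V W Z (f : Z -> V) (g : Z -> W) :
  linear f -> linear g -> linear (fun x => (f x, g x)).
Proof. by move=> lf lg a x y; rewrite lf lg. Qed.
Lemma linear_fun0 V W : linear ((fun=> 0) : V -> W).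
Proof. by move=> a x y; rewrite scaler0 addr0. Qed.

#[export] Instance findim_prod V W : findim V -> findim W -> findim (V * W)%type.
Proof.
move=> [[I [e [c [cc cE]]]]] [[J [e' [c' [cc' cE']]]]]; constructor.
exists (I + J)%type,
  (fun s => match s with inl i => (e i, 0) | inr j => (0, e' j) end),
  (fun s => match s with
    | inl i => as_linear (linear_comp (@fst_linear V W) (linearP (c i)))
    | inr j => as_linear (linear_comp (@snd_linear V W) (linearP (c' j))) end).
split=> [[i|j] x|[v w]].
- by apply: continuous_comp; [exact: cvg_fst|exact: cc].
- by apply: continuous_comp; [exact: cvg_snd|exact: cc'].
- have li : linear (fun v : V => (v, 0) : V * W).
    by apply: pair_linear => [a x y //|]; exact: linear_fun0.
  have lj : linear (fun w : W => (0, w) : V * W).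
    by apply: pair_linear => [|a x y //]; exact: linear_fun0.
  rewrite big_sumType /=.
  have -> : (v, w) = as_linear li v + as_linear lj w.
    by congr (_, _); rewrite /= ?addr0 ?add0r.
  rewrite {1}[v]cE {1}[w]cE' !linear_sum.
  by congr (_ + _); apply: eq_bigr => i _; rewrite linearZ.
Qed.

Lemma Ck_mx V k (O : set V) m n (f : V -> 'M[R]_(m, n)) : open O ->
  (forall i j, Ck k O (fun x => f x i j)) -> Ck k O f.
Proof.
move=> oO Cf; apply: (@Ck_coord _ _ k O f ('I_m * 'I_n)%type
  (fun p => delta_mx p.1 p.2) (fun p => as_linear (entry_linear p.1 p.2))) => //.
  by move=> w; rewrite {1}[w]matrix_sum_delta pair_big.
by move=> p; exact: Cf.
Qed.

Lemma Ck_entry V k (O : set V) m n (f : V -> 'M[R]_(m, n)) i j : open O ->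
  Ck k O f -> Ck k O (fun x => f x i j).
Proof.
move=> oO; apply: (@Ck_comp_linear _ _ _ k O (as_linear (entry_linear i j))) => //.
exact: coord_continuous.
Qed.

Lemma Ck_fst V W Z k (O : set V) (f : V -> W * Z) : open O -> Ck k O f ->
  Ck k O (fun x => (f x).1).
Proof.
move=> oO; apply: (@Ck_comp_linear _ _ _ k O (as_linear (@fst_linear _ _))) => //.
by move=> p; exact: cvg_fst.
Qed.

Lemma Ck_snd V W Z k (O : set V) (f : V -> W * Z) : open O -> Ck k O f ->
  Ck k O (fun x => (f x).2).
Proof.
move=> oO; apply: (@Ck_comp_linear _ _ _ k O (as_linear (@snd_linear _ _))) => //.
by move=> p; exact: cvg_snd.
Qed.

Lemma Ck_pair V W Z k (O : set V) (f : V -> W) (g : V -> Z) : open O ->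
  Ck k O f -> Ck k O g -> Ck k O (fun x => (f x, g x)).
Proof.
move=> oO Cf Cg.
have li : linear (fun v : W => (v, 0) : W * Z).
  by apply: pair_linear => [a x y //|]; exact: linear_fun0.
have lj : linear (fun w : Z => (0, w) : W * Z).
  by apply: pair_linear => [|a x y //]; exact: linear_fun0.
apply: (@Ck_ext _ _ k O (fun x => as_linear li (f x) + as_linear lj (g x))) => //.
  by move=> x _; congr (_, _); rewrite /= ?addr0 ?add0r.
apply: Ck_add => //; apply: Ck_comp_linear => //= x;
  by apply: cvg_pair; [exact: cvg_id || exact: cvg_cst..].
Qed.

(** * Inverting a smooth homeomorphism *)

(** Jacobian in terms of directional derivatives, so that its entries inherit the
    class C^k; vectors are rows and act on the left. *)
Definition jac n (f : 'rV[R]_n -> 'rV[R]_n) x : 'M[R]_n :=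
  \matrix_(i, j) 'D_(delta_mx 0 i) f x 0 j.

Lemma jacE n (f : 'rV[R]_n -> 'rV[R]_n) x v : differentiable f x ->
  'd f x v = v *m jac f x.
Proof.
move=> df; rewrite {1}[v]row_sum_delta linear_sum mulmx_sum_row.
apply: eq_bigr => i _; rewrite linearZ; congr (_ *: _).
by apply/rowP => j; rewrite !mxE deriveE.
Qed.

Lemma Ck_prod V k (O : set V) (I : finType) (f : I -> V -> R) : open O ->
  (forall i, Ck k O (f i)) -> Ck k O (fun x => \prod_i f i x).
Proof.
move=> oO Cf; elim: (index_enum I) => [|i r IH].
  apply: Ck_ext (Ck_cst (W := R) k (1 : R) oO) => // x _; by rewrite big_nil.
by apply: Ck_ext (Ck_mul oO (Cf i) IH) => // x _; rewrite big_cons.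
Qed.

Lemma Ck_det V k (O : set V) n (A : V -> 'M[R]_n) : open O ->
  Ck k O A -> Ck k O (fun x => \det (A x)).
Proof.
move=> oO CA.
apply: (Ck_sum (f := fun (s : 'S_n) x => (-1) ^+ s * \prod_i A x i (s i))) => // s.
apply: (Ck_mul oO (Ck_cst _ _ oO)).
by apply: (Ck_prod (f := fun i x => A x i (s i))) => // i; exact: Ck_entry.
Qed.

(** Cramer's rule: the entries of the inverse are cofactors divided by the
    determinant. *)
Lemma Ck_invmx V k (O : set V) n (A : V -> 'M[R]_n) : open O ->
  (forall x, O x -> A x \in unitmx) -> Ck k O A -> Ck k O (fun x => invmx (A x)).
Proof.
move=> oO uA CA; apply: Ck_mx => // i j.
apply: (@Ck_ext V R k O (fun x => (\det (A x))^-1 * \adj (A x) i j)) => //.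
  by move=> x /uA uAx; rewrite /invmx uAx !mxE.
apply: Ck_mul => //.
  by apply: Ck_inv => //; [move=> x /uA; rewrite unitmxE unitfE|exact: Ck_det].
apply: (@Ck_ext V R k O (fun x => (-1) ^+ (j + i) * \det (row' j (col' i (A x))))) => //.
  by move=> x _; rewrite !mxE.
apply: Ck_mul => //; first exact: Ck_cst.
apply: Ck_det => //; apply: Ck_mx => // a b.
apply: (@Ck_ext V R k O (fun x => A x (lift j a) (lift i b))) => //.
  by move=> x _; rewrite !mxE.
exact: Ck_entry.
Qed.

Lemma Ck_mulmx V k (O : set V) m n p (A : V -> 'M[R]_(m, n)) (B : V -> 'M[R]_(n, p)) :
  open O -> Ck k O A -> Ck k O B -> Ck k O (fun x => A x *m B x).
Proof.
move=> oO CA CB; apply: Ck_mx => // i j.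
apply: (@Ck_ext V R k O (fun x => \sum_l A x i l * B x l j)) => //.
  by move=> x _; rewrite mxE.
by apply: Ck_sum => // l; apply: Ck_mul => //; exact: Ck_entry.
Qed.

Lemma mulmxr_linear m n p (B : 'M[R]_(n, p)) : linear (fun A : 'M[R]_(m, n) => A *m B).
Proof. by move=> a A A'; rewrite mulmxDl scalemxAl. Qed.

Lemma mulmxr_continuous m n p (B : 'M[R]_(n, p)) :
  continuous (fun A : 'M[R]_(m, n) => A *m B).
Proof.
have C := @Ck_mulmx _ 0 setT m n p id (fun=> B) openT (Ck_id 0 openT)
  (Ck_cst 0 B openT).
by move=> A; exact: C.
Qed.

Lemma cvg_shift V (y : V) : (fun k => k + y) @ (0 : V) --> y.
Proof.
have := Ck_add openT (Ck_id 0 openT) (Ck_cst 0 y openT) 0 I.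
by rewrite /prop_for /continuous_at add0r.
Qed.

Lemma cvg_increment V W (g : V -> W) y : {for y, continuous g} ->
  (fun k => g (k + y) - g y) @ (0 : V) --> (0 : W).
Proof.
by move=> cg; apply/subr_cvg0; exact: cvg_comp (@cvg_shift V y) cg.
Qed.

Section Inverse.
Variables (n : nat) (U W : set 'rV[R]_n) (f g : 'rV[R]_n -> 'rV[R]_n).
Hypotheses (oU : open U) (oW : open W) (gU : forall y, W y -> U (g y))
  (gK : forall y, W y -> f (g y) = y) (cg : forall y, W y -> {for y, continuous g})
  (sf : smooth_on U f) (uJ : forall x, U x -> jac f x \in unitmx).

(** With k = f (x + h) - f x one has h - k N = - (k - h J) N where N inverts the
    Jacobian J, so that h - k N is o(h); absorbing this term gives |h| <= 2 C |k|, and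
    h - k N is then also o(k). *)
Lemma diff_inverse y : W y -> differentiable g y /\
  forall v, 'd g y v = v *m invmx (jac f (g y)).
Proof.
move=> Wy; set x := g y; have Ux : U x by exact: gU.
have df : differentiable f x by have [+ _] := sf 1; exact.
set N := invmx _; pose L := as_linear (@mulmxr_linear 1 _ _ N).
have cL : continuous L by exact: mulmxr_continuous.
suff /(diff_approx cL)[dg dgE] : forall e, 0 < e ->
    \forall h \near (0 : 'rV[R]_n), `|g (h + y) - g y - L h| <= e * `|h|.
  by split=> // v; rewrite dgE.
move=> e e0; have [C C0 LC] := linear_lipschitz cL.
(* The first bound lets C e' |h| be absorbed in |h|, the second one gives the estimate. *)
pose e' := Num.min (1 / (2 * C)) (e / (2 * C * C)).
have e'0 : 0 < e' by rewrite lt_min !divr_gt0 ?mulr_gt0.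
have /diff_locally/eqaddoP/(_ _ e'0) := df; rewrite /= => fx.
have h0 := cvg_increment (cg Wy).
have := h0 _ fx; rewrite /= !nbhs_simpl /= => {}fx.
have Wk : \forall k \near (0 : 'rV[R]_n), W (k + y).
  exact: (cvg_shift (open_nbhs_nbhs (conj oW Wy))).
apply: filterS2 fx Wk => k; rewrite /= -/x opprD addrA => kh Wk.
have {kh} : `|f (g (k + y) - x + x) - f x - 'd f x (g (k + y) - x)| <=
    e' * `|g (k + y) - x| := kh.
rewrite subrK !gK// addrK; set h := g (k + y) - x => kh.
have hE : h - L k = - L (k - 'd f x h).
  by rewrite linearB opprB /= jacE// mulmxK ?uJ.
have e1 : C * e' <= 1 / 2.
  apply: (@le_trans _ _ (C * (1 / (2 * C)))).
    by rewrite ler_pM2l// ge_min lexx.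
  by rewrite le_eqVlt; apply/orP; left; apply/eqP; field; rewrite gt_eqF.
have e2 : C * e' * (2 * C) <= e.
  apply: (@le_trans _ _ (C * (e / (2 * C * C)) * (2 * C))).
    by rewrite ler_pM2r ?mulr_gt0// ler_pM2l// ge_min lexx orbT.
  by rewrite le_eqVlt; apply/orP; left; apply/eqP; field; rewrite gt_eqF.
have hk : `|h - L k| <= C * e' * `|h|.
  by rewrite hE normrN (le_trans (LC _))// -mulrA ler_pM2l.
have h2 : `|h| <= 2 * C * `|k|.
  have h3 : `|h| <= `|h - L k| + `|L k| by rewrite -{1}(subrK (L k) h) ler_normD.
  have := LC k; have : C * e' * `|h| <= 1 / 2 * `|h| by rewrite ler_wpM2r.
  by move: hk h3; move: `|h - _| `|L k| => a b; lra.
apply: (le_trans hk); apply: (le_trans (y := C * e' * (2 * C * `|k|))).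
  by rewrite ler_pM2l ?mulr_gt0.
by rewrite [X in X <= _]mulrA ler_wpM2r.
Qed.

(** The Jacobian of [g] is the inverse of the Jacobian of [f] taken at [g]; when [g]
    is C^k, so is this formula, hence [g] is C^(k+1). *)
Lemma smooth_inverse : smooth_on W g.
Proof.
elim=> [|k IH]; first exact: cg.
apply: CkS_intro => // [y Wy|v]; first by have [] := diff_inverse Wy.
exists (fun y => v *m invmx (jac f (g y))); last first.
  by move=> y Wy; have [dg <-] := diff_inverse Wy; rewrite deriveE.
apply: Ck_mulmx => //; first exact: Ck_cst.
apply: Ck_invmx => //; first by move=> y Wy; exact/uJ/gU.
apply: Ck_mx => // i j.
apply: (@Ck_ext _ R k W (fun y => 'D_(delta_mx 0 i) f (g y) 0 j)) => //.
  by move=> y _; rewrite mxE.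
apply: Ck_entry => //.
apply: (@Ck_comp _ _ _ k W U ('D_(delta_mx 0 i) f) g) => //.
by have [_ Df] := sf k.+1; exact: (Df (delta_mx 0 i)).
Qed.

End Inverse.

End Calculus.

(** * Charts and smooth maps *)

Lemma open_setI_preimage (X Y : topologicalType) (O : set X) (f : X -> Y) (U : set Y) :
  open O -> (forall x, O x -> {for x, continuous f}) -> open U ->
  open (O `&` f @^-1` U).
Proof.
rewrite !openE => oO cf oU x [Ox Ufx]; apply: filterI; first exact: oO.
exact: (cf x Ox _ (oU _ Ufx)).
Qed.

Section Manifolds.
Context {R : realType}.
Implicit Types V W Z : normedModType R.

Lemma smooth_sub V W (O U : set V) (f : V -> W) :
  O `<=` U -> smooth_on U f -> smooth_on O f.
Proof. by move=> OU Cf k; exact: Ck_sub (Cf k). Qed.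

Lemma smooth_ext V W (O : set V) (f g : V -> W) : open O ->
  (forall x, O x -> f x = g x) -> smooth_on O f -> smooth_on O g.
Proof. by move=> oO fg Cf k; exact: Ck_ext (Cf k). Qed.

Lemma smooth_local V W (O : set V) (f : V -> W) :
  (forall x, O x -> exists2 U, U x & smooth_on U f) -> smooth_on O f.
Proof.
by move=> H k; apply: Ck_local => x /H[U Ux sf]; exists U => //; exact: sf.
Qed.

Lemma smooth_comp V W Z {fW : findim W} {fZ : findim Z} (O : set V) (U : set W) (g : W -> Z) (f : V -> W) :
  open O -> open U -> (forall x, O x -> U (f x)) ->
  smooth_on U g -> smooth_on O f -> smooth_on O (fun x => g (f x)).
Proof. by move=> oO oU fU sg sf k; exact: (Ck_comp fW fZ oO oU fU (sg k) (sf k)). Qed.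

Lemma smooth_differentiable V W (O : set V) (f : V -> W) x :
  smooth_on O f -> O x -> differentiable f x.
Proof. by move=> /(_ 1)[df _]; exact: df. Qed.

Lemma smooth_continuous V W (O : set V) (f : V -> W) x :
  smooth_on O f -> O x -> {for x, continuous f}.
Proof. by move=> /(_ 0); exact. Qed.

Section Charts.
Variables (T : topologicalType) (n : nat).
Implicit Types phi psi : chart R T n.

Lemma chart_img phi U : is_chart phi -> U `<=` cdom phi ->
  cmap phi @` U = cimg phi `&` cinv phi @^-1` U.
Proof.
move=> [_ _ cK _ _] Ud; apply/seteqP; split=> [_ [p Up <-]|_ [[p dp <-]] /=].
  split; first by exists p => //; exact: Ud.
  by rewrite /= cK//; exact: Ud.
by rewrite cK// => Up; exists p.
Qed.

(** The image is the preimage under the continuous inverse chart, within the open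
    image of the chart. *)
Lemma open_chart_img phi U : is_chart phi -> open U -> U `<=` cdom phi ->
  open (cmap phi @` U).
Proof.
move=> cphi oU Ud; rewrite chart_img//; have [_ oi _ _ ci] := cphi.
exact: open_setI_preimage.
Qed.

Definition compatible (A : set (chart R T n)) :=
  (forall phi, A phi -> is_chart phi) /\
  forall phi psi, A phi -> A psi ->
    smooth_on (cmap phi @` (cdom phi `&` cdom psi)) (cmap psi \o cinv phi).

Definition covers (A : set (chart R T n)) := forall p, exists2 phi, A phi & cdom phi p.

Lemma compatible_sub (A B : set (chart R T n)) : A `<=` B -> compatible B -> compatible A.
Proof. by move=> AB [cB tB]; split=> [phi /AB/cB//|phi psi /AB ? /AB ?]; exact: tB. Qed.

Lemma manifold_compatible (A : set (chart R T n)) : smooth_manifold A -> compatible A.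
Proof. by case. Qed.

End Charts.

(** Near any point the map is recovered from its continuous coordinate
    expression by composing with charts. *)
Lemma smooth_map_continuous (T T' : topologicalType) m n (A : set (chart R T m))
    (B : set (chart R T' n)) (f : T -> T') :
  compatible A -> compatible B -> smooth_map A B f -> continuous f.
Proof.
move=> [cA _] [cB _] sf p.
have [phi [psi [ O [Aphi Bpsi [oO Op] [Od fOd] sc]]]] := sf p.
have [_ _ cK cm _] := cA _ Aphi; have [_ _ cK' _ ci'] := cB _ Bpsi.
have fO q : O q -> cdom psi (f q) by move=> Oq; apply: fOd; exists q.
have c1 := cm _ (Od _ Op).
have Oy : (cmap phi @` O) (cmap phi p) by exists p.
have c2 := smooth_continuous sc Oy.
have fE q : O q -> f q = cinv psi (coord_map phi psi f (cmap phi q)).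
  by move=> Oq; rewrite /coord_map /= cK ?cK' //; [exact: fO|exact: Od].
have c3 : {for coord_map phi psi f (cmap phi p), continuous (cinv psi)}.
  rewrite /coord_map /= cK; last exact: Od.
  by apply: ci'; exists (f p) => //; exact: fO.
have c := continuous_comp (continuous_comp c1 c2) c3.
rewrite /continuous_at (fE p Op).
apply: cvg_trans c; apply: near_eq_cvg.
by apply: filterS (open_nbhs_nbhs (conj oO Op)) => q Oq; rewrite /= -fE.
Qed.

(** Smoothness is witnessed by one pair of charts at each point; compatibility
    transfers it to every pair of charts. *)
Lemma coord_map_smooth (T T' : topologicalType) m n (A : set (chart R T m))
    (B : set (chart R T' n)) (f : T -> T') phi psi :
  compatible A -> compatible B -> smooth_map A B f -> A phi -> B psi ->
  smooth_on (cmap phi @` (cdom phi `&` f @^-1` cdom psi)) (coord_map phi psi f).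
Proof.
move=> cA cB sf Aphi Bpsi; apply: smooth_local => _ [p [dp dfp] <-].
have cf := smooth_map_continuous cA cB sf.
have [phi' [psi' [ O [Aphi' Bpsi' [oO Op] [Od fOd] sc]]]] := sf p.
have [chA tA] := cA; have [chB tB] := cB.
have [od _ cK _ _] := chA _ Aphi; have [od' _ cK' _ _] := chB _ Bpsi.
have [odp' _ cKp' _ _] := chA _ Aphi'; have [ods' _ cKs' _ _] := chB _ Bpsi'.
have fO q : O q -> cdom psi' (f q) by move=> Oq; apply: fOd; exists q.
pose U := cdom phi `&` f @^-1` cdom psi `&` O.
have oU : open U.
  by apply: openI => //; apply: openI => //; exact: open_comp.
have Ud : U `<=` cdom phi by move=> q [[]].
have oI : open (cmap phi @` U) by apply: open_chart_img => //; exact: chA.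
exists (cmap phi @` U); first by exists p.
apply: (@smooth_ext _ _ _ (fun y => (cmap psi \o cinv psi')
   (coord_map phi' psi' f ((cmap phi' \o cinv phi) y)))) => //.
  move=> _ [q [[dq dfq] Oq] <-]; rewrite /coord_map /= cK// cKp'; last exact: Od.
  by rewrite cKs'//; exact: fO.
have o1 : open (cmap phi' @` O) by apply: open_chart_img => //; exact: chA.
have o2 : open (cmap psi' @` (cdom psi' `&` cdom psi)).
  by apply: open_chart_img; [exact: chB|exact: openI|move=> ? []].
have s1 : smooth_on (cmap phi @` U) (cmap phi' \o cinv phi).
  apply: smooth_sub (tA _ _ Aphi Aphi') => _ [q [[dq dfq] Oq] <-].
  by exists q => //; split=> //; exact: Od.
have s2 : smooth_on (cmap phi @` U)
    (fun y => coord_map phi' psi' f ((cmap phi' \o cinv phi) y)).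
  apply: (smooth_comp oI o1 _ sc s1) => _ [q [[dq dfq] Oq] <-].
  by exists q => //=; rewrite cK.
apply: (smooth_comp oI o2 _ (tB _ _ Bpsi' Bpsi) s2) => _ [q [[dq dfq] Oq] <-].
exists (f q) => //; first by split=> //; exact: fO.
by rewrite /coord_map /= cK// cKp'//; exact: Od.
Qed.

(** In Jacobians, a square matrix is a left factor of a matrix of full rank. *)
Lemma jac_unit n (f t : 'rV[R]_n -> 'rV[R]_n) x y :
  differentiable f x -> differentiable t y ->
  (forall w, exists v, 'd t y ('d f x v) = w) -> jac f x \in unitmx.
Proof.
move=> df dt surj; have unitl (A B : 'M[R]_n) : A *m B \in unitmx -> A \in unitmx.
  by rewrite unitmx_mul => /andP[].
apply: (unitl _ (jac t y)); rewrite -row_full_unit -sub1mx; apply/row_subP => i.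
have [v vw] := surj (row i 1%:M).
have e1 := jacE v df; have e2 := jacE ('d f x v) dt.
have e3 := etrans e2 (etrans (congr1 (mulmx^~ (jac t y)) e1) (esym (mulmxA _ _ _))).
by rewrite (etrans (esym vw) e3) submxMl.
Qed.

(** * Smooth neighbourhood retracts *)

(** The charts that are diffeomorphisms for the smooth structure that [E] induces on
    [T] when it is an embedding.  For [E] the inclusion of a subset of a linear space
    this is, by conversion, [submanifold_atlas]; the generalization covers the
    quotient spaces, which are not given as subsets. *)
Definition induced_atlas (T : topologicalType) V (E : T -> V) n : set (chart R T n) :=
  [set phi | [/\ is_chart phi,
     smooth_on (cimg phi) (fun y => E (cinv phi y)) &
     forall p, cdom phi p -> exists O (g : V -> 'rV[R]_n),
       [/\ open O, O (E p), smooth_on O g &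
           forall q, cdom phi q -> O (E q) -> cmap phi q = g (E q)]]].

End Manifolds.

(** A space embedded as a smooth neighbourhood retract.  Having a retraction [rret] that
    is defined on an open set replaces every statement about functions on a subset by
    one about functions on an open set. *)
Record retract (R : realType) (T : topologicalType) := Retract {
  rspace : normedModType R;
  rspace_findim : findim rspace;
  remb : T -> rspace;
  rdom : set rspace;
  rret : rspace -> T;
  rdom_open : open rdom;
  remb_continuous : continuous remb;
  remb_dom : forall t, rdom (remb t);
  rembK : forall t, rret (remb t) = t;
  rret_continuous : forall x, rdom x -> {for x, continuous rret};
  rret_smooth : smooth_on rdom (fun x => remb (rret x)) }.

Arguments rret {R T} r x.
Arguments rdom {R T} r _.
Arguments remb {R T} r t.
#[export] Existing Instance rspace_findim.

Section RetractAtlas.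
Context {R : realType}.
Implicit Types V W Z : normedModType R.

Definition atlas_of (T : topologicalType) (X : retract R T) n :=
  @induced_atlas R T (rspace X) (remb X) n.
End RetractAtlas.
Arguments atlas_of {R T} X n phi : rename.

Section RetractTopology.
Context {R : realType}.
Implicit Types V W Z : normedModType R.

Section OneRetract.
Variables (T : topologicalType) (X : retract R T) (n : nat).
Implicit Types phi : chart R T n.

Lemma open_rret U : open U -> open (rdom X `&` rret X @^-1` U).
Proof. by apply: open_setI_preimage; [exact: rdom_open|exact: rret_continuous]. Qed.

(** The local ambient extension of a chart may be taken to be the chart composed with
    the retraction. *)
Lemma atlas_ofP phi : atlas_of X n phi <-> [/\ is_chart phi,
  smooth_on (cimg phi) (fun y => remb X (cinv phi y)) &
  smooth_on (rdom X `&` rret X @^-1` cdom phi) (fun x => cmap phi (rret X x))].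
Proof.
split=> [[cphi si sg]|[cphi si sc]]; split=> //.
  apply: smooth_local => x [Dx dx]; have [ O [g [oO Ox sOg gE]]] := sg _ dx.
  have [od _ _ _ _] := cphi.
  pose U := rdom X `&` rret X @^-1` (cdom phi `&` remb X @^-1` O).
  have oU : open U.
    by apply: open_rret; apply: openI => //; apply: open_comp => // ? _; exact: remb_continuous.
  exists U => //.
  apply: (@smooth_ext _ _ _ _ (fun x => g (remb X (rret X x)))) => //.
    by move=> y [Dy [dy Oy]]; rewrite -gE.
  apply: (smooth_comp oU oO _ sOg) => //; first by move=> y [_ []].
  by apply: smooth_sub (@rret_smooth _ _ X) => y [].
move=> p dp; exists (rdom X `&` rret X @^-1` cdom phi), (fun x => cmap phi (rret X x)).
have [od _ _ _ _] := cphi.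
split=> //; [exact: open_rret|by split; [exact: remb_dom|rewrite /= rembK]|].
by move=> q _ _; rewrite rembK.
Qed.

Lemma retract_hausdorff : hausdorff_space T.
Proof.
move=> p q pq; rewrite -(rembK X p) -(rembK X q); congr rret.
apply: (@norm_hausdorff _ (rspace X)) => U W Up Wq.
have [t [Ut Wt]] := pq _ _ (remb_continuous Up) (remb_continuous Wq).
by exists (remb X t).
Qed.

(** The traces on [T] of a countable basis of the ambient space. *)
Lemma retract_second_countable :
  @second_countable (rspace X) -> @second_countable T.
Proof.
move=> [B cB [oB bB]]; exists [set remb X @^-1` U | U in B].
  exact: sub_countable (card_image_le _ B) cB.
split=> [_ [U BU <-]|p Wp nW].
  by apply: open_comp => [? _|]; [exact: remb_continuous|exact: oB].
have nS : nbhs (remb X p) (rret X @^-1` Wp).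
  by apply: (rret_continuous (remb_dom X p)); rewrite rembK.
have [U [BU Up] US] := bB _ _ nS.
exists (remb X @^-1` U); first by split=> //; exists U.
by move=> q /US /=; rewrite rembK.
Qed.

End OneRetract.

End RetractTopology.
Arguments open_rret {R T} X [U].

Section RetractManifolds.
Context {R : realType}.
Implicit Types V W Z : normedModType R.

(** Smoothness of a map, read in the ambient spaces through the retractions. *)
Definition smooth_rep (T T' : topologicalType) (X : retract R T) (Y : retract R T')
    (f : T -> T') : Prop :=
  smooth_on (rdom X) (fun x => remb Y (f (rret X x))).

Section SmoothRep.
Variables (T T' : topologicalType) (X : retract R T) (Y : retract R T') (f : T -> T').
Hypothesis sf : smooth_rep X Y f.

(** [f] is the composite of the embedding, the ambient representative and the
    retraction. *)
Lemma smooth_rep_continuous : continuous f.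
Proof.
move=> p; have c1 := @remb_continuous _ _ X p.
have c2 := smooth_continuous sf (remb_dom X p).
have c3 : {for remb Y (f (rret X (remb X p))), continuous (rret Y)}.
  by apply: rret_continuous; exact: remb_dom.
have := continuous_comp (continuous_comp c1 c2) c3.
suff -> : rret Y \o ((fun x => remb Y (f (rret X x))) \o remb X) = f by [].
by apply/funext => q /=; rewrite !rembK.
Qed.

Variables (m n : nat) (phi : chart R T m) (psi : chart R T' n).
Hypotheses (aphi : atlas_of X m phi) (apsi : atlas_of Y n psi).

Lemma open_coord_dom : open (cdom phi `&` f @^-1` cdom psi).
Proof.
have [[[od _ _ _ _] _ _] [[od' _ _ _ _] _ _]] := (aphi, apsi).
by apply: openI => //; apply: open_comp => // ? _; exact: smooth_rep_continuous.
Qed.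

Lemma open_coord_img : open (cmap phi @` (cdom phi `&` f @^-1` cdom psi)).
Proof.
have [ch _ _] := aphi.
by apply: open_chart_img => //; exact: open_coord_dom.
Qed.

(** The coordinate expression is the composite of the representative with the
    smooth extension of one chart and the smooth inverse of the other. *)
Lemma smooth_rep_coord :
  smooth_on (cmap phi @` (cdom phi `&` f @^-1` cdom psi)) (coord_map phi psi f).
Proof.
have [[_ _ cK _ _] si _] := (atlas_ofP _ _).1 aphi.
have [[od' _ _ _ _] _ sc'] := (atlas_ofP _ _).1 apsi.
have oD := open_coord_img.
apply: (@smooth_ext _ _ _ _ (fun y => cmap psi (rret Y
   (remb Y (f (rret X (remb X (cinv phi y)))))))) => //.
  by move=> y _; rewrite !rembK.
have s1 : smooth_on (cmap phi @` (cdom phi `&` f @^-1` cdom psi))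
    (fun y => remb X (cinv phi y)).
  by apply: smooth_sub si => _ [p [dp _] <-]; exists p.
have s2 := smooth_comp oD (rdom_open X) _ sf s1.
apply: (smooth_comp oD (open_rret Y od') _ sc' (s2 _ _ _)).
  move=> _ [p [dp dfp] <-]; split; first exact: remb_dom.
  by rewrite /= !rembK cK.
by move=> y _; exact: remb_dom.
Qed.

End SmoothRep.

Lemma atlas_of_compatible (T : topologicalType) (X : retract R T) n :
  compatible (atlas_of X n).
Proof.
split=> [phi []//|phi psi aphi apsi].
exact: (@smooth_rep_coord T T X X idfun (@rret_smooth _ _ X) n n phi psi aphi apsi).
Qed.

Lemma smooth_rep_map (T T' : topologicalType) (X : retract R T) (Y : retract R T') m n
    (A : set (chart R T m)) (B : set (chart R T' n)) (f : T -> T') :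
  A `<=` atlas_of X m -> covers A -> B `<=` atlas_of Y n -> covers B ->
  smooth_rep X Y f -> smooth_map A B f.
Proof.
move=> AX cA BY cB sf p; have [phi Aphi dp] := cA p.
have [psi Bpsi dfp] := cB (f p).
exists phi, psi, (cdom phi `&` f @^-1` cdom psi); split=> //.
- split=> //; exact: (open_coord_dom sf (AX _ Aphi) (BY _ Bpsi)).
- by split=> [q []//|_ [q [_ dq] <-]].
- exact: (smooth_rep_coord sf (AX _ Aphi) (BY _ Bpsi)).
Qed.

Lemma smooth_rep_manifold (T : topologicalType) (X : retract R T) n
    (A : set (chart R T n)) :
  @second_countable (rspace X) ->
  A `<=` atlas_of X n -> covers A -> smooth_manifold A.
Proof.
move=> sX AX cA; have [chA tA] := compatible_sub AX (@atlas_of_compatible _ X n).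
split=> //; split; first exact: (retract_hausdorff X).
exact: retract_second_countable sX.
Qed.

(** * Quotients by maps with smooth sections *)

(** A submersion has smooth local sections; here the sections through the points are
    global, as for the projections of a product. *)
Definition split_submersion (T T' : topologicalType) (X : retract R T) (Y : retract R T')
    (pi : T -> T') : Prop :=
  [/\ smooth_rep X Y pi, forall x, exists p, pi p = x &
   forall p, exists s, [/\ smooth_rep Y X s, cancel s pi & s (pi p) = p]].

Section Quotient.
Variables (P Q : topologicalType) (X : retract R P) (Y : retract R Q) (pi : P -> Q).
Hypothesis spi : split_submersion X Y pi.
Variables (m n : nat) (A : set (chart R P m)).
Hypotheses (AX : A `<=` atlas_of X m) (cA : covers A).

(** Differentiating [pi \o s = id] exhibits a preimage of every tangent vector. *)
Lemma split_submersion_submersion (B : set (chart R Q n)) :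
  B `<=` atlas_of Y n -> covers B -> submersion A B pi.
Proof.
move=> BY cB; have [sp _ sec] := spi; split; first exact: (smooth_rep_map AX cA BY cB).
move=> p; have [phi Aphi dp] := cA p; have [psi Bpsi dq] := cB (pi p).
exists phi, psi; split=> // w.
have [s [ss sK sp1]] := sec p.
have aphi := AX Aphi; have apsi := BY _ Bpsi.
have [[_ _ cK _ _] _ _] := aphi; have [[_ _ cK' _ _] _ _] := apsi.
set y := cmap phi p; set z := cmap psi (pi p).
have dc : differentiable (coord_map phi psi pi) y.
  by apply: (smooth_differentiable (smooth_rep_coord sp aphi apsi)); exists p.
have Dz : (cmap psi @` (cdom psi `&` s @^-1` cdom phi)) z.
  by exists (pi p) => //; split=> //=; rewrite sp1.
have ds : differentiable (coord_map psi phi s) z.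
  exact: (smooth_differentiable (smooth_rep_coord ss apsi aphi) Dz).
have sz : coord_map psi phi s z = y by rewrite /coord_map /= cK'// sp1.
have dc' : differentiable (coord_map phi psi pi) (coord_map psi phi s z).
  by rewrite sz.
have csK : \forall u \near z, u = (coord_map phi psi pi \o coord_map psi phi s) u.
  apply: filterS (open_nbhs_nbhs (conj (open_coord_img ss apsi aphi) Dz)).
  by move=> _ [q [dq' dsq] <-]; rewrite /coord_map /= cK'// cK// sK.
exists ('d (coord_map psi phi s) z w).
have := diff_comp ds dc'; rewrite sz => dE.
rewrite -[LHS]/(('d (coord_map phi psi pi) y \o 'd (coord_map psi phi s) z) w) -dE.
have dcs : differentiable (coord_map phi psi pi \o coord_map psi phi s) z.
  exact: differentiable_comp.
rewrite -deriveE// -(near_eq_derive w csK).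
exact: derive_id.
Qed.

(** Any structure making [pi] a submersion consists of charts of the retract [Y].
    Smoothness of such a chart [psi] on the ambient side is read through a section of
    [pi].  In the other direction, the change of coordinates [f] from a chart of [Y] to
    [psi] is smooth, and its Jacobian is invertible since [f] is the middle factor of the
    coordinate expression of [pi], whose differential is onto; [smooth_inverse] applies. *)
Lemma smooth_structure_unique (B : set (chart R Q n)) :
  covers (atlas_of Y n) -> quotient_structure A B pi -> B `<=` atlas_of Y n.
Proof.
move=> cY [mB [sAB subm]] psi Bpsi.
have [sp psurj sec] := spi.
have cmA := compatible_sub AX (@atlas_of_compatible _ X m).
have cmB := manifold_compatible mB.
have [chB tB] := cmB; have cpsi := chB _ Bpsi.
have [od oi cK _ ci] := cpsi.
have spsi : smooth_on (rdom Y `&` rret Y @^-1` cdom psi) (fun x => cmap psi (rret Y x)).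
  apply: smooth_local => z [Dz dz].
  have [p pz] := psurj (rret Y z); have [s [ss sK sp1]] := sec p.
  have [phi Aphi dp] := cA p; have aphi := AX Aphi.
  have [[odp _ cKp _ _] _ sphi] := (atlas_ofP _ _).1 aphi.
  have c := coord_map_smooth cmA cmB sAB Aphi Bpsi.
  pose U := rdom Y `&` rret Y @^-1` (cdom psi `&` s @^-1` cdom phi).
  have oU : open U.
    apply: open_rret; apply: openI => //; apply: open_comp => // ? _.
    exact: (smooth_rep_continuous ss).
  exists U; first by split=> //; split=> //=; rewrite -pz sp1.
  apply: (@smooth_ext _ _ _ _ (fun x => coord_map phi psi pi
      (cmap phi (rret X (remb X (s (rret Y x))))))) => //.
    by move=> x [Dx [dx dsx]]; rewrite /coord_map /= rembK cKp// sK.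
  have o1 := open_rret X odp.
  have s1 : smooth_on U (fun x => cmap phi (rret X (remb X (s (rret Y x))))).
    apply: (smooth_comp oU o1 _ sphi).
      by move=> x [Dx [dx dsx]]; split=> /=; [exact: remb_dom|rewrite rembK].
    by apply: smooth_sub ss => x [].
  have o2 : open (cmap phi @` (cdom phi `&` pi @^-1` cdom psi)).
    apply: open_chart_img => //; first by case: aphi.
    by apply: openI => //; apply: open_comp => // ? _; exact: (smooth_rep_continuous sp).
  apply: (smooth_comp oU o2 _ c s1) => x [Dx [dx dsx]].
  by exists (s (rret Y x)); rewrite /= ?rembK//; split=> //=; rewrite sK.
suff sci : smooth_on (cimg psi) (fun y => remb Y (cinv psi y)) by apply/atlas_ofP.
apply: smooth_local => _ [x dx <-].
have [chi achi dchi] := cY x.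
have [[odc oic cKc cmc cic] sic sc] := (atlas_ofP _ _).1 achi.
pose D := cdom psi `&` cdom chi.
have oD : open D by exact: openI.
have oU : open (cmap chi @` D).
  by apply: (open_chart_img _ oD) => [|? []//]; case: achi.
have oW : open (cmap psi @` D) by apply: (open_chart_img _ oD) => [|? []].
pose f := cmap psi \o cinv chi; pose g := cmap chi \o cinv psi.
have sf : smooth_on (cmap chi @` D) f.
  apply: (@smooth_ext _ _ _ _ (fun y => cmap psi (rret Y (remb Y (cinv chi y))))) => //.
    by move=> y _; rewrite rembK.
  have s1 : smooth_on (cmap chi @` D) (fun y => remb Y (cinv chi y)).
    by apply: smooth_sub sic => _ [q [_ dq] <-]; exists q.
  apply: (smooth_comp oU (open_rret Y od) _ spsi s1) => _ [q [dq dq'] <-].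
  by split=> /=; [exact: remb_dom|rewrite rembK cKc].
have gU y : (cmap psi @` D) y -> (cmap chi @` D) (g y).
  by move=> [q [dq dq'] <-]; exists q => //; rewrite /g /= cK.
have gK y : (cmap psi @` D) y -> f (g y) = y.
  by move=> [q [dq dq'] <-]; rewrite /f /g /= cK// cKc.
have cg y : (cmap psi @` D) y -> {for y, continuous g}.
  move=> [q [dq dq'] <-].
  have c1 : {for cmap psi q, continuous (cinv psi)} by apply: ci; exists q.
  have c2 : {for cinv psi (cmap psi q), continuous (cmap chi)}.
    by apply: cmc; rewrite cK.
  exact: continuous_comp c1 c2.
exists (cmap psi @` D); first by exists x.
(* Near the point considered, the coordinate expression of [pi] is [t \o f \o h]. *)
have uJ u : (cmap chi @` D) u -> jac f u \in unitmx.
  move=> [x' [dx1 dx2] <-]; set u' := cmap chi x'.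
  have [p px] := psurj x'.
  have [phi [psi' [Aphi Bpsi' dp dq surj]]] := subm p.
  have aphi := AX Aphi; have [odp _ cKp _ _] : is_chart phi by case: aphi.
  have [odq oiq cKq _ _] := chB _ Bpsi'.
  set y := cmap phi p in surj.
  pose h := coord_map phi chi pi; pose t := cmap psi' \o cinv psi.
  have hy : h y = u' by rewrite /h /coord_map /= cKp// px.
  have fy : f u' = cmap psi x' by rewrite /f /= cKc.
  have Dy : (cmap phi @` (cdom phi `&` pi @^-1` cdom chi)) y.
    by exists p => //; split=> //=; rewrite px.
  have dh : differentiable h y.
    exact: (smooth_differentiable (smooth_rep_coord sp aphi achi) Dy).
  have df : differentiable f (h y).
    by rewrite hy; apply: (smooth_differentiable sf); exists x'.
  have dt : differentiable t (f (h y)).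
    rewrite hy fy; apply: (smooth_differentiable (tB _ _ Bpsi Bpsi')).
    by exists x' => //; split=> //; rewrite -px.
  have oN : open (cdom phi `&` pi @^-1` (cdom psi' `&` D)).
    apply: openI => //; apply: open_comp => [? _|]; last exact: openI.
    exact: (smooth_rep_continuous sp).
  have oiN : open (cmap phi @` (cdom phi `&` pi @^-1` (cdom psi' `&` D))).
    by apply: (open_chart_img _ oN) => [|? []//]; case: aphi.
  have dE v : 'd (coord_map phi psi' pi) y v = 'd t (f u') ('d f u' ('d h y v)).
    have dfh : differentiable (f \o h) y by exact: differentiable_comp.
    have dtfh : differentiable (t \o (f \o h)) y by exact: differentiable_comp.
    have e : \forall v \near y, (t \o (f \o h)) v = coord_map phi psi' pi v.
      have Ny : (cmap phi @` (cdom phi `&` pi @^-1` (cdom psi' `&` D))) y.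
        by exists p => //; split=> //=; rewrite px; split=> //; rewrite -px.
      apply: filterS (open_nbhs_nbhs (conj oiN Ny)).
      move=> _ [q [dq0 [dq1 [dq2 dq3]]] <-].
      by rewrite /t /f /h /coord_map /= cKp// cKc// cK.
    have e1 := diff_comp dh df; rewrite hy in e1.
    have fhy : (f \o h) y = f u' by rewrite /= hy.
    have e2 := diff_comp dfh dt; rewrite fhy in e2.
    have e1v : 'd (f \o h) y v = 'd f u' ('d h y v) := congr1 (@^~ v) e1.
    have e2v : 'd (t \o (f \o h)) y v = 'd t (f u') ('d (f \o h) y v) := congr1 (@^~ v) e2.
    apply: etrans (etrans e2v (congr1 ('d t (f u')) e1v)).
    have d1 := deriveE v dtfh.
    have d2 := deriveE v (near_differentiable e dtfh).
    exact: etrans (esym d2) (etrans (esym (near_eq_derive v e)) d1).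
  have df' : differentiable f u' by rewrite -hy.
  have dt' : differentiable t (f u') by rewrite -hy.
  apply: (jac_unit df' dt') => w; have [v vw] := surj w.
  by exists ('d h y v); exact: etrans (esym (dE v)) vw.
have sg := smooth_inverse oU oW gU gK cg sf uJ.
apply: (@smooth_ext _ _ _ _ (fun y => remb Y (cinv chi (g y)))) => //.
  by move=> _ [q [dq dq'] <-]; rewrite /g /= cK// cKc.
apply: (smooth_comp oW oic _ sic sg) => _ [q [dq dq'] <-].
by exists q => //; rewrite /g /= cK.
Qed.

End Quotient.

End RetractManifolds.

(** * Second countability, changes of embedding, products *)

Lemma openX (X Y : topologicalType) (A : set X) (B : set Y) :
  open A -> open B -> open (A `*` B).
Proof.
rewrite !openE => oA oB [x y] [/= Ax By]; exists (A, B) => //=.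
by split; [exact: oA|exact: oB].
Qed.

Lemma second_countable_prod (X Y : topologicalType) :
  @second_countable X -> @second_countable Y -> @second_countable (X * Y)%type.
Proof.
move=> [B cB [oB bB]] [C cC [oC bC]].
exists [set U.1 `*` U.2 | U in B `*` C].
  exact: sub_countable (card_image_le _ _) (countableX cB cC).
split=> [_ [[U W] [/= BU CW] <-]|[x y] N [[P Q] [/= xP yQ] PQN]].
  by apply: openX; [exact: oB|exact: oC].
have [U [BU Ux] UP] := bB _ _ xP; have [W [CW Wy] WQ] := bC _ _ yQ.
exists (U `*` W); first by split=> //; exists (U, W).
by move=> [u w] [/= /UP Pu /WQ Qw]; apply: PQN.
Qed.

(** Balls with rational centres and radii 1 / n. *)
Lemma second_countable_mx (R : realType) m n : @second_countable 'M[R]_(m, n).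
Proof.
pose f (p : 'M[rat]_(m, n) * nat) : set 'M[R]_(m, n) :=
  (ball (map_mx ratr p.1 : 'M[R]_(m, n)) p.2.+1%:R^-1).
exists (range f).
  exact: sub_countable (card_image_le _ _) (countableP _).
split=> [_ [p _ <-]|x N]; first exact: ball_open.
move=> /nbhs_ballP[e /= e0 eN].
have [N0] := ltr_add_invr (divr_gt0 e0 (ltr0n R 2)); rewrite add0r => dele.
have r0 : 0 < (N0.+1%:R^-1 : R) by rewrite invr_gt0.
have q i j : {r : rat | `|x i j - ratr r| < N0.+1%:R^-1}.
  apply: cid; have /rat_in_itvoo[r] : x i j < x i j + N0.+1%:R^-1 by rewrite ltrDl.
  rewrite in_itv /= => /andP[r1 r2]; exists r.
  by rewrite distrC gtr0_norm ?subr_gt0// ltrBlDl.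
pose p := (\matrix_(i, j) sval (q i j), N0).
have px : ball (map_mx ratr p.1 : 'M[R]_(m, n)) p.2.+1%:R^-1 x.
  split=> // i j; rewrite /ball /= !mxE distrC; exact: svalP (q i j).
exists (f p); first by split=> //; exists p.
move=> z pz; apply: eN; rewrite [e]splitr.
apply: (@ball_triangle R 'M[R]_(m, n) (map_mx ratr p.1)).
  exact/ball_sym/(le_ball (ltW dele) px).
exact: le_ball (ltW dele) _ pz.
Qed.

Section Transport.
Context {R : realType}.
Implicit Types V W Z : normedModType R.

Lemma induced_atlas_sub (T : topologicalType) V W {fV : findim V} {fW : findim W} n
    (E : T -> V) (E' : T -> W) (O : set V) (O' : set W) (F : V -> W) (G : W -> V) :
  open O -> open O' -> (forall t, O (E t)) -> (forall t, O' (E' t)) ->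
  smooth_on O F -> smooth_on O' G ->
  (forall t, F (E t) = E' t) -> (forall t, G (E' t) = E t) ->
  induced_atlas E (n := n) `<=` induced_atlas E' (n := n).
Proof.
move=> oO oO' EO EO' sF sG FE GE phi [cphi si sc]; split=> // [|p dp].
  have [_ oi _ _ _] := cphi.
  apply: (@smooth_ext _ _ _ _ (fun y => F (E (cinv phi y)))) => //.
  exact: (smooth_comp oi oO _ sF si).
have [U [g [oU Up sg gE]]] := sc p dp.
have cG x : O' x -> {for x, continuous G} by exact: smooth_continuous sG.
have oU' : open (O' `&` G @^-1` U) by exact: open_setI_preimage.
exists (O' `&` G @^-1` U), (fun x => g (G x)); split=> //.
- by split=> //=; rewrite GE.
- apply: (smooth_comp oU' oU _ sg) => [x []//|]; by apply: smooth_sub sG => x [].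
- by move=> q dq [_ /=]; rewrite GE; exact: gE.
Qed.

(** The induced atlas does not change when the embedding is composed with ambient
    maps that are smooth in both directions; this gives the freedom to describe a matrix
    group by better coordinates than its entries. *)
Lemma induced_atlas_eq (T : topologicalType) V W {fV : findim V} {fW : findim W} n
    (E : T -> V) (E' : T -> W) (O : set V) (O' : set W) (F : V -> W) (G : W -> V) :
  open O -> open O' -> (forall t, O (E t)) -> (forall t, O' (E' t)) ->
  smooth_on O F -> smooth_on O' G ->
  (forall t, F (E t) = E' t) -> (forall t, G (E' t) = E t) ->
  induced_atlas E (n := n) = induced_atlas E' (n := n).
Proof.
move=> oO oO' EO EO' sF sG FE GE; apply/seteqP; split.
  exact: (induced_atlas_sub oO oO' EO EO' sF sG FE GE).
exact: (induced_atlas_sub oO' oO EO' EO sG sF GE FE).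
Qed.

Lemma smooth_fst V W Z (O : set V) (f : V -> W * Z) : open O -> smooth_on O f ->
  smooth_on O (fun x => (f x).1).
Proof. by move=> oO sf k; exact: Ck_fst (sf k). Qed.

Lemma smooth_snd V W Z (O : set V) (f : V -> W * Z) : open O -> smooth_on O f ->
  smooth_on O (fun x => (f x).2).
Proof. by move=> oO sf k; exact: Ck_snd (sf k). Qed.

Lemma smooth_pair V W Z (O : set V) (f : V -> W) (g : V -> Z) : open O ->
  smooth_on O f -> smooth_on O g -> smooth_on O (fun x => (f x, g x)).
Proof. by move=> oO sf sg k; exact: Ck_pair (sf k) (sg k). Qed.

Lemma smooth_id V (O : set V) : open O -> smooth_on O id.
Proof. by move=> oO k; exact: Ck_id. Qed.

Lemma smooth_cst V W (O : set V) (w : W) : open O -> smooth_on O (fun=> w).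
Proof. by move=> oO k; exact: Ck_cst. Qed.

Lemma smooth_mx V (O : set V) m n (f : V -> 'M[R]_(m, n)) : open O ->
  (forall i j, smooth_on O (fun x => f x i j)) -> smooth_on O f.
Proof. by move=> oO sf k; apply: Ck_mx => // i j; exact: sf. Qed.

Lemma smooth_entry V (O : set V) m n (f : V -> 'M[R]_(m, n)) i j : open O ->
  smooth_on O f -> smooth_on O (fun x => f x i j).
Proof. by move=> oO sf k; exact: Ck_entry (sf k). Qed.

Lemma smooth_lsubmx V (O : set V) m n p (f : V -> 'M[R]_(m, n + p)) : open O ->
  smooth_on O f -> smooth_on O (fun x => lsubmx (f x)).
Proof.
move=> oO sf; apply: smooth_mx => // i j.
apply: (@smooth_ext _ _ _ _ (fun x => f x i (lshift p j))) => //.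
  by move=> x _; rewrite mxE.
exact: smooth_entry.
Qed.

Lemma smooth_rsubmx V (O : set V) m n p (f : V -> 'M[R]_(m, n + p)) : open O ->
  smooth_on O f -> smooth_on O (fun x => rsubmx (f x)).
Proof.
move=> oO sf; apply: smooth_mx => // i j.
apply: (@smooth_ext _ _ _ _ (fun x => f x i (rshift n j))) => //.
  by move=> x _; rewrite mxE.
exact: smooth_entry.
Qed.

Lemma smooth_row_mx V (O : set V) m n p (f : V -> 'M[R]_(m, n))
    (g : V -> 'M[R]_(m, p)) : open O ->
  smooth_on O f -> smooth_on O g -> smooth_on O (fun x => row_mx (f x) (g x)).
Proof.
move=> oO sf sg; apply: smooth_mx => // i j; case: (split_ordP j) => k ->.
  apply: (@smooth_ext _ _ _ _ (fun x => f x i k)) => //.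
    by move=> x _; rewrite row_mxEl.
  exact: smooth_entry.
apply: (@smooth_ext _ _ _ _ (fun x => g x i k)) => //.
  by move=> x _; rewrite row_mxEr.
exact: smooth_entry.
Qed.

Lemma lsubmx_continuous m n p : continuous (lsubmx : 'M[R]_(m, n + p) -> 'M[R]_(m, n)).
Proof.
move=> x; apply: (smooth_continuous (O := setT)) => //.
exact: (smooth_lsubmx openT (smooth_id openT)).
Qed.

Lemma rsubmx_continuous m n p : continuous (rsubmx : 'M[R]_(m, n + p) -> 'M[R]_(m, p)).
Proof.
move=> x; apply: (smooth_continuous (O := setT)) => //.
exact: (smooth_rsubmx openT (smooth_id openT)).
Qed.

Lemma row_mx_continuous m n p :
  continuous (fun x : 'M[R]_(m, n) * 'M[R]_(m, p) => row_mx x.1 x.2).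
Proof.
move=> x; apply: (smooth_continuous (O := setT)) => //.
by apply: smooth_row_mx; [exact: openT|exact: smooth_fst openT (smooth_id openT)
  |exact: smooth_snd openT (smooth_id openT)].
Qed.

Lemma smooth_prod_map V W V' W' {fV : findim V} {fW : findim W} {fV' : findim V'}
    {fW' : findim W'} (O : set V) (U : set W) (f : V -> V') (g : W -> W') :
  open O -> open U -> smooth_on O f -> smooth_on U g ->
  smooth_on (O `*` U) (fun x => (f x.1, g x.2)).
Proof.
move=> oO oU sf sg.
have oOU : open (O `*` U) by exact: openX.
have s1 : smooth_on (O `*` U) (fun x : V * W => x.1).
  exact: smooth_fst oOU (smooth_id oOU).
have s2 : smooth_on (O `*` U) (fun x : V * W => x.2).
  exact: smooth_snd oOU (smooth_id oOU).
apply: smooth_pair => //.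
  by apply: (smooth_comp oOU oO _ sf s1) => x [].
by apply: (smooth_comp oOU oU _ sg s2) => x [].
Qed.

Section Product.
Variables (T T' : topologicalType) (X : retract R T) (Y : retract R T').

Lemma continuous_prod_map (A B C D : topologicalType) (f : A -> C) (g : B -> D) x y :
  {for x, continuous f} -> {for y, continuous g} ->
  {for (x, y), continuous (fun p => (f p.1, g p.2))}.
Proof.
move=> cf cg; apply: cvg_pair.
  exact: (cvg_comp _ _ (@cvg_fst _ _ (nbhs x) (nbhs y) _) cf).
exact: (cvg_comp _ _ (@cvg_snd _ _ (nbhs x) (nbhs y) _) cg).
Qed.

Let Z : normedModType R := (rspace X * rspace Y)%type.
Let E (p : T * T') : Z := (remb X p.1, remb Y p.2).
Let S (x : Z) : T * T' := (rret X x.1, rret Y x.2).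
Let D : set Z := rdom X `*` rdom Y.

Let oD : open D. Proof. by apply: openX; exact: rdom_open. Qed.

Let cE : continuous E.
Proof.
move=> [p q]; apply: (@continuous_prod_map _ _ _ _ (remb X) (remb Y));
  exact: remb_continuous.
Qed.

Let ED t : D (E t). Proof. by split; exact: remb_dom. Qed.

Let EK t : S (E t) = t. Proof. by case: t => p q; rewrite /S /E /= !rembK. Qed.

Let cS x : D x -> {for x, continuous S}.
Proof.
case: x => x y [Dx Dy]; apply: (@continuous_prod_map _ _ _ _ (rret X) (rret Y));
  exact: rret_continuous.
Qed.

Let sS : smooth_on D (fun x => E (S x)).
Proof.
apply: (smooth_prod_map (f := fun x => remb X (rret X x))
  (g := fun x => remb Y (rret Y x))); by [exact: rdom_open|exact: rret_smooth].
Qed.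

Definition retract_prod : retract R (T * T')%type :=
  Retract (findim_prod (rspace_findim X) (rspace_findim Y)) oD cE ED EK cS sS.

(** The product charts used for the smoothness of the action belong to the atlas of
    the product retract, so that an action is treated like any other map. *)
Lemma prod_atlas_sub m n (A : set (chart R T m)) (B : set (chart R T' n)) :
  A `<=` atlas_of X m -> B `<=` atlas_of Y n ->
  prod_atlas A B `<=` atlas_of retract_prod (m + n).
Proof.
move=> AX BY _ [[phi psi] [/= Aphi Bpsi] <-].
have [cphi si sc] := (atlas_ofP _ _).1 (AX _ Aphi).
have [cpsi si' sc'] := (atlas_ofP _ _).1 (BY _ Bpsi).
have [od oi cK cm ci] := cphi; have [od' oi' cK' cm' ci'] := cpsi.
have imgE : cimg (prod_chart phi psi) =
    lsubmx @^-1` cimg phi `&` rsubmx @^-1` cimg psi.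
  apply/seteqP; split=> [_ [[p q] [dp dq] <-]|y [[p dp py] [q dq qy]]].
    by rewrite /= row_mxKl row_mxKr; split; [exists p|exists q].
  by exists (p, q) => //=; rewrite py qy hsubmxK.
have oI : open (cimg (prod_chart phi psi)).
  rewrite imgE; apply: openI; apply: open_comp => // ? _;
    [exact: lsubmx_continuous|exact: rsubmx_continuous].
have cpp : is_chart (prod_chart phi psi).
  split=> [||||].
  - exact: openX.
  - exact: oI.
  - by move=> [p q] [/= dp dq]; rewrite row_mxKl row_mxKr cK// cK'.
  - move=> [p q] [/= dp dq].
    have c := continuous_prod_map (cm _ dp) (cm' _ dq).
    exact: continuous_comp c (@row_mx_continuous _ _ _ _).
  - rewrite imgE => y [iy iy'].
    have c1 : {for y, continuous (cinv phi \o lsubmx)}.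
      exact: (continuous_comp (@lsubmx_continuous _ _ _ y) (ci _ iy)).
    have c2 : {for y, continuous (cinv psi \o rsubmx)}.
      exact: (continuous_comp (@rsubmx_continuous _ _ _ y) (ci' _ iy')).
    exact: cvg_pair c1 c2.
apply/atlas_ofP; split=> //=.
  have sl := smooth_lsubmx oI (smooth_id oI).
  have sr := smooth_rsubmx oI (smooth_id oI).
  apply: smooth_pair => //.
    by apply: (smooth_comp oI oi _ si sl); rewrite imgE => y [].
  by apply: (smooth_comp oI oi' _ si' sr); rewrite imgE => y [].
have oU := open_rret X od; have oV := open_rret Y od'.
have oUV := openX oU oV.
have s : smooth_on ((rdom X `&` rret X @^-1` cdom phi) `*`
    (rdom Y `&` rret Y @^-1` cdom psi))
    (fun x : rspace X * rspace Y => (cmap phi (rret X x.1), cmap psi (rret Y x.2))).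
  exact: (smooth_prod_map oU oV sc sc').
have sl := smooth_fst oUV s; have sr := smooth_snd oUV s.
apply: smooth_sub (smooth_row_mx (f := fun x => cmap phi (rret X x.1))
  (g := fun x => cmap psi (rret Y x.2)) oUV sl sr).
by move=> [x y] [[/= Dx Dy] [/= dx dy]].
Qed.

End Product.

End Transport.

(** * The ball and the three-sphere *)

Section LocalCoordinates.
Context {R : realType}.
Implicit Types V W : normedModType R.

(** Local parametrizations in the ambient space; the dimensions of the ball and of the
    sphere enter in this form, which is stable under products. *)
Definition has_coords V (M : set V) n := forall m, M m ->
  exists (D : set V) (k : V -> 'rV[R]_n) (U : set 'rV[R]_n) (l : 'rV[R]_n -> V),
    [/\ [/\ open D, D m & open U], smooth_on D k, smooth_on U l,
        forall x, M x -> D x -> U (k x) /\ l (k x) = x &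
        forall y, U y -> [/\ M (l y), D (l y) & k (l y) = y]].

(** A parametrization of the image of [T] in the ambient space is a chart of [T],
    thanks to the retraction. *)
Lemma has_coords_covers (T : topologicalType) (X : retract R T) (M : set (rspace X)) n :
  (forall t, M (remb X t)) ->
  (forall x, M x -> rdom X x /\ remb X (rret X x) = x) ->
  has_coords M n -> covers (atlas_of X n).
Proof.
move=> EM MK cM p; have [D [k [U [l [[oD Dp oU] sk sl kU lM]]]]] := cM _ (EM p).
pose phi := Chart (remb X @^-1` D) (fun t => k (remb X t)) (fun y => rret X (l y)).
have imgE : cimg phi = U.
  apply/seteqP; split=> [_ [t Dt <-]|y Uy]; first by have [] := kU _ (EM t) Dt.
  have [My Dy ky] := lM _ Uy; have [_ Ey] := MK _ My.
  by exists (rret X (l y)); rewrite /= Ey.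
exists phi => //; split.
- split.
  + by apply: open_comp => // t _; exact: remb_continuous.
  + by rewrite imgE.
  + by move=> t Dt /=; have [_ ->] := kU _ (EM t) Dt; exact: rembK.
  + move=> t Dt; have c := smooth_continuous sk Dt.
    exact: continuous_comp (@remb_continuous _ _ X t) c.
  + rewrite imgE => y Uy; have [My Dy ky] := lM _ Uy; have [Dly _] := MK _ My.
    exact: continuous_comp (smooth_continuous sl Uy) (rret_continuous Dly).
- rewrite imgE; apply: (smooth_ext oU _ sl) => y Uy /=.
  by have [My _ _] := lM _ Uy; have [_ ->] := MK _ My.
- by move=> t Dt; exists D, k.
Qed.

Lemma has_coordsX V W {fV : findim V} {fW : findim W} (M : set V) (N : set W) m n :
  has_coords M m -> has_coords N n -> has_coords (M `*` N) (m + n).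
Proof.
move=> cM cN [x y] [/= Mx Ny].
have [D [k [U [l [[oD Dx oU] sk sl kU lM]]]]] := cM _ Mx.
have [D' [k' [U' [l' [[oD' Dy oU'] sk' sl' kU' lM']]]]] := cN _ Ny.
have oDD : open (D `*` D') by exact: openX.
pose UU : set 'rV[R]_(m + n) := lsubmx @^-1` U `&` rsubmx @^-1` U'.
have oUU : open UU.
  by apply: openI; apply: open_comp => // ? _;
    [exact: lsubmx_continuous|exact: rsubmx_continuous].
exists (D `*` D'), (fun p => row_mx (k p.1) (k' p.2)), UU,
  (fun z => (l (lsubmx z), l' (rsubmx z))); split=> //.
- have s1 : smooth_on (D `*` D') (fun p : V * W => k p.1).
    by apply: (smooth_comp oDD oD _ sk (smooth_fst oDD (smooth_id oDD))) => p [].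
  have s2 : smooth_on (D `*` D') (fun p : V * W => k' p.2).
    by apply: (smooth_comp oDD oD' _ sk' (smooth_snd oDD (smooth_id oDD))) => p [].
  exact: smooth_row_mx.
- apply: smooth_pair => //.
    by apply: (smooth_comp oUU oU _ sl (smooth_lsubmx oUU (smooth_id oUU))) => z [].
  by apply: (smooth_comp oUU oU' _ sl' (smooth_rsubmx oUU (smooth_id oUU))) => z [].
- move=> [a b] [/= Ma Nb] [/= Da Db]; have [Ua la] := kU _ Ma Da.
  have [Ub lb] := kU' _ Nb Db.
  by rewrite /UU /= row_mxKl row_mxKr la lb.
- move=> z [/= Uz Uz']; have [Ml Dl kl] := lM _ Uz; have [Ml' Dl' kl'] := lM' _ Uz'.
  by split=> //; rewrite kl kl' hsubmxK.
Qed.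

End LocalCoordinates.

Section SmoothQuat.
Context {R : realType} {V : normedModType R} {O : set V}.
Hypothesis oO : open O.
Implicit Types (f g : V -> quat R) (s t : V -> R).

Lemma smooth_addR s t : smooth_on O s -> smooth_on O t -> smooth_on O (fun x => s x + t x).
Proof. by move=> hs ht k; exact: (Ck_add oO (hs k) (ht k)). Qed.

Lemma smooth_oppR s : smooth_on O s -> smooth_on O (fun x => - s x).
Proof. by move=> hs k; exact: (Ck_opp oO (hs k)). Qed.

Lemma smooth_mulR s t : smooth_on O s -> smooth_on O t -> smooth_on O (fun x => s x * t x).
Proof. by move=> hs ht k; exact: (Ck_mul oO (hs k) (ht k)). Qed.

Lemma smooth_invR s : (forall x, O x -> s x != 0) -> smooth_on O s ->
  smooth_on O (fun x => (s x)^-1).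
Proof. by move=> s0 hs k; exact: (Ck_inv oO s0 (hs k)). Qed.

Lemma smooth_sqrtR s : (forall x, O x -> 0 < s x) -> smooth_on O s ->
  smooth_on O (fun x => Num.sqrt (s x)).
Proof. by move=> s0 hs k; exact: (Ck_sqrt oO s0 (hs k)). Qed.

Lemma smooth_cstR (c : R) : smooth_on O (fun=> c).
Proof. exact: smooth_cst. Qed.

Lemma smooth_re f : smooth_on O f -> smooth_on O (fun x => re (f x)).
Proof. exact: (smooth_entry (f := f : V -> 'rV[R]_4)). Qed.
Lemma smooth_im1 f : smooth_on O f -> smooth_on O (fun x => im1 (f x)).
Proof. exact: (smooth_entry (f := f : V -> 'rV[R]_4)). Qed.
Lemma smooth_im2 f : smooth_on O f -> smooth_on O (fun x => im2 (f x)).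
Proof. exact: (smooth_entry (f := f : V -> 'rV[R]_4)). Qed.
Lemma smooth_im3 f : smooth_on O f -> smooth_on O (fun x => im3 (f x)).
Proof. exact: (smooth_entry (f := f : V -> 'rV[R]_4)). Qed.

Lemma smooth_mkq s0 s1 s2 s3 : smooth_on O s0 -> smooth_on O s1 -> smooth_on O s2 ->
  smooth_on O s3 -> smooth_on O (fun x => mkq (s0 x) (s1 x) (s2 x) (s3 x)).
Proof.
move=> h0 h1 h2 h3.
apply: (smooth_mx (f := fun x => mkq (s0 x) (s1 x) (s2 x) (s3 x) : 'rV[R]_4)) => // i j.
apply: (@smooth_ext _ _ _ _ (fun x => nth 0 [:: s0 x; s1 x; s2 x; s3 x] j)) => //.
  by move=> x _; rewrite /mkq mxE.
by case: j => -[|[|[|[|]]]].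
Qed.

#[local] Ltac sm := repeat first [ apply: smooth_addR | apply: smooth_mulR |
  apply: smooth_oppR | apply: smooth_re | apply: smooth_im1 | apply: smooth_im2 |
  apply: smooth_im3 | assumption | exact: smooth_cstR ].

Lemma smooth_qmul f g : smooth_on O f -> smooth_on O g -> smooth_on O (fun x => f x * g x).
Proof. by move=> hf hg; apply: smooth_mkq; sm. Qed.

Lemma smooth_qconj f : smooth_on O f -> smooth_on O (fun x => qconj (f x)).
Proof. by move=> hf; apply: smooth_mkq; sm. Qed.

Lemma smooth_qscale s f : smooth_on O s -> smooth_on O f -> smooth_on O (fun x => s x *: f x).
Proof.
move=> hs hf.
apply: (@smooth_ext _ _ _ _ (fun x => mkq (s x * re (f x)) (s x * im1 (f x))
  (s x * im2 (f x)) (s x * im3 (f x)))) => //.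
  by move=> x _; apply: quatP; rewrite mkqE qscaleE.
by apply: smooth_mkq; sm.
Qed.

Lemma smooth_qabs2 f : smooth_on O f -> smooth_on O (fun x => qabs2 (f x)).
Proof.
move=> hf; apply: (@smooth_ext _ _ _ _ (fun x => re (f x) * re (f x) +
  im1 (f x) * im1 (f x) + im2 (f x) * im2 (f x) + im3 (f x) * im3 (f x))) => //.
by sm.
Qed.

Lemma smooth_qinv f : (forall x, O x -> f x != 0) -> smooth_on O f ->
  smooth_on O (fun x => (f x)^-1).
Proof.
move=> f0 hf; apply: smooth_qscale; last exact: smooth_qconj.
apply: smooth_invR; last exact: smooth_qabs2.
by move=> x Ox; rewrite qabs2_eq0 f0.
Qed.

Lemma smooth_qabs f : (forall x, O x -> f x != 0) -> smooth_on O f ->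
  smooth_on O (fun x => qabs (f x)).
Proof.
move=> f0 hf; apply: smooth_sqrtR; last exact: smooth_qabs2.
by move=> x Ox; rewrite lt_neqAle qabs2_ge0 eq_sym qabs2_eq0 f0.
Qed.

End SmoothQuat.

Section BallSphere.
Context {R : realType}.
Implicit Types (q u w : quat R).

Lemma qunitE q : (q \is a GRing.unit) = (q != 0). Proof. by []. Qed.

Lemma qabs2_gt0 q : (0 < qabs2 q) = (q != 0).
Proof. by rewrite lt_neqAle qabs2_ge0 andbT eq_sym qabs2_eq0. Qed.

Lemma qballE q : qball q = (qabs2 q < 1) :> Prop.
Proof.
by rewrite /qball /= /qabs -[X in _ < X]sqrtr1 ltr_sqrt.
Qed.

Lemma qabs2Z (s : R) q : qabs2 (s *: q) = s ^+ 2 * qabs2 q.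
Proof. by rewrite /qabs2 !qscaleE; ring. Qed.

Lemma qabs2V q : qabs2 q^-1 = (qabs2 q)^-1.
Proof.
have [->|q0] := eqVneq q 0; first by rewrite invr0 /qabs2 !q0E expr0n /= !addr0 invr0.
rewrite -[LHS](mulfK (x := qabs2 q)) ?qabs2_eq0// -qabs2M mulVr//.
by rewrite /qabs2 !q1E expr0n expr1n /= !addr0 mul1r.
Qed.

Lemma sqr_qabs q : qabs q ^+ 2 = qabs2 q.
Proof. by rewrite sqr_sqrtr ?qabs2_ge0. Qed.

Lemma qabs_ge0 q : 0 <= qabs q. Proof. exact: sqrtr_ge0. Qed.

Lemma qabs_eq0 q : (qabs q == 0) = (q == 0).
Proof. by rewrite -sqrf_eq0 sqr_qabs qabs2_eq0. Qed.

Lemma qabs2_1 : qabs2 (1 : quat R) = 1.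
Proof. by rewrite -sqr_qabs qabs1 expr1n. Qed.

Definition sphere : set (quat R) := [set u | qabs2 u = 1].

Lemma qabs_sphere u : sphere u -> qabs u = 1.
Proof. by rewrite /sphere /= /qabs => ->; exact: sqrtr1. Qed.

Lemma sphere_neq0 u : sphere u -> u != 0.
Proof. by rewrite /sphere /= -qabs2_gt0 => ->; exact: ltr01. Qed.

Lemma sphereM u w : sphere u -> sphere w -> sphere (u * w).
Proof. by rewrite /sphere /= qabs2M => -> ->; rewrite mulr1. Qed.

(** Radial retraction of the nonzero quaternions onto the unit sphere. *)
Definition qsgn u : quat R := (qabs u)^-1 *: u.

Lemma qsgn_sphere u : u != 0 -> sphere (qsgn u).
Proof.
by move=> u0; rewrite /sphere /= qabs2Z exprVn sqr_qabs mulVf// qabs2_eq0.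
Qed.

Lemma qsgn_id u : sphere u -> qsgn u = u.
Proof. by move=> /qabs_sphere u1; rewrite /qsgn u1 invr1 scale1r. Qed.

Lemma qsgnZ (s : R) u : 0 < s -> sphere u -> qsgn (s *: u) = u.
Proof.
move=> s0 u1; rewrite /qsgn /qabs qabs2Z u1 mulr1 sqrtr_sqr gtr0_norm//.
by rewrite scalerA mulVf ?scale1r// gt_eqF.
Qed.

Definition qnz : set (quat R) := [set u | u != 0].

Lemma open_qnz : open qnz.
Proof.
rewrite (_ : qnz = setT `&` (fun u => qabs2 u) @^-1` [set x | 0 < x]).
  apply: open_setI_preimage => [|x _|]; [exact: openT| |exact: open_gt].
  by apply: (smooth_continuous (O := setT)) => //;
    exact: (smooth_qabs2 openT (smooth_id openT)).
by apply/seteqP; split=> u /=; rewrite qabs2_gt0//; case.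
Qed.

Lemma open_qball : open (@qball R).
Proof.
rewrite (_ : @qball R = setT `&` (fun u => qabs2 u) @^-1` [set x | x < 1]).
  apply: open_setI_preimage => [|x _|]; [exact: openT| |exact: open_lt].
  by apply: (smooth_continuous (O := setT)) => //;
    exact: (smooth_qabs2 openT (smooth_id openT)).
by apply/seteqP; split=> u /=; rewrite qballE//; case.
Qed.

Lemma smooth_qsgn (V : normedModType R) (O : set V) (f : V -> quat R) : open O ->
  (forall x, O x -> f x != 0) -> smooth_on O f -> smooth_on O (fun x => qsgn (f x)).
Proof.
move=> oO f0 sf; apply: (smooth_qscale oO) => //.
apply: (smooth_invR oO); last exact: smooth_qabs.
by move=> x Ox; rewrite qabs_eq0 f0.
Qed.

Lemma has_coords_ball : has_coords (@qball R) 4.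
Proof.
move=> q Bq; exists (@qball R), id, (@qball R), id; split=> //.
- by split=> //; exact: open_qball.
- exact: smooth_id open_qball.
- exact: (smooth_id open_qball).
Qed.

(** Stereographic projection from -1; every unit quaternion [w] is brought to 1, away
    from the pole, by multiplication by its conjugate. *)
Definition stereo w : 'rV[R]_3 :=
  \row_(i < 3) ((1 + re w)^-1 * nth 0 [:: im1 w; im2 w; im3 w] i).

Definition stereo_inv (x : 'rV[R]_3) : quat R :=
  let x0 := x 0 (inord 0) in let x1 := x 0 (inord 1) in let x2 := x 0 (inord 2) in
  let s := x0 ^+ 2 + x1 ^+ 2 + x2 ^+ 2 in
  (1 + s)^-1 *: mkq (1 - s) (2 * x0) (2 * x1) (2 * x2).

Lemma stereoE w : ((stereo w 0 (inord 0) = ((1 + re w)^-1 * im1 w)%R) *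
  (stereo w 0 (inord 1) = ((1 + re w)^-1 * im2 w)%R) *
  (stereo w 0 (inord 2) = ((1 + re w)^-1 * im3 w)%R))%type.
Proof. by rewrite !mxE !inordK. Qed.

Lemma rV3P (x y : 'rV[R]_3) : x 0 (inord 0) = y 0 (inord 0) ->
  x 0 (inord 1) = y 0 (inord 1) -> x 0 (inord 2) = y 0 (inord 2) -> x = y.
Proof.
move=> e0 e1 e2; apply/rowP => i; rewrite -[i]inord_val.
by case: i => -[|[|[|//]]] ?.
Qed.

Lemma stereoK w : sphere w -> 1 + re w != 0 -> stereo_inv (stereo w) = w.
Proof.
rewrite /sphere /= /qabs2 => w1 w0; rewrite /stereo_inv !stereoE.
have s1 : 1 + (((1 + re w)^-1 * im1 w) ^+ 2 + ((1 + re w)^-1 * im2 w) ^+ 2 +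
    ((1 + re w)^-1 * im3 w) ^+ 2) = 2 / (1 + re w).
  have -> : 2 / (1 + re w) = ((1 + re w) ^+ 2 + (1 - re w ^+ 2)) / (1 + re w) ^+ 2.
    by field.
  by rewrite -[X in X - re w ^+ 2]w1; field.
have s2 : 1 - (((1 + re w)^-1 * im1 w) ^+ 2 + ((1 + re w)^-1 * im2 w) ^+ 2 +
    ((1 + re w)^-1 * im3 w) ^+ 2) = 2 * re w / (1 + re w).
  have -> : 2 * re w / (1 + re w) = 2 - 2 / (1 + re w) by field.
  by rewrite -s1; ring.
rewrite s1 s2 invf_div.
by apply: quatP; rewrite qscaleE mkqE; field.
Qed.

Lemma stereo_inv_sphere x : [/\ sphere (stereo_inv x), 1 + re (stereo_inv x) != 0 &
  stereo (stereo_inv x) = x].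
Proof.
have s0 : 1 + (x 0 (inord 0) ^+ 2 + x 0 (inord 1) ^+ 2 + x 0 (inord 2) ^+ 2) != 0.
  by rewrite gt_eqF// ltr_pwDl// !addr_ge0 ?sqr_ge0.
have e : 1 + re (stereo_inv x) =
    2 / (1 + (x 0 (inord 0) ^+ 2 + x 0 (inord 1) ^+ 2 + x 0 (inord 2) ^+ 2)).
  by rewrite /stereo_inv qscaleE mkqE; field.
have e0 : 1 + re (stereo_inv x) != 0 by rewrite e mulf_neq0 ?invr_eq0.
split=> //.
  by rewrite /sphere /= /stereo_inv qabs2Z /qabs2 !mkqE; field.
by apply: rV3P; rewrite stereoE e /stereo_inv qscaleE mkqE; field.
Qed.

Lemma has_coords_sphere : has_coords sphere 3.
Proof.
move=> w Sw.
pose D := setT `&` (fun u => re (qconj w * u)) @^-1` [set x | -1 < x].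
have smT (f : quat R -> R) : smooth_on setT f -> forall x, {for x, continuous f}.
  by move=> sf x; exact: (smooth_continuous sf).
have sre : smooth_on setT (fun u : quat R => re (qconj w * u)).
  apply: smooth_re; first exact: openT.
  by apply: smooth_qmul; [exact: openT|exact: smooth_cst openT|exact: smooth_id openT].
have oD : open D.
  apply: open_setI_preimage => [|x _|]; [exact: openT|exact: smT|exact: open_gt].
have re0 u : D u -> 1 + re (qconj w * u) != 0.
  by move=> [_ /= h]; rewrite gt_eqF// -ltrBlDl sub0r.
have wK u : w * (qconj w * u) = u.
  by rewrite mulrA qmul_conj Sw mkq1 mul1r.
have Kw u : qconj w * (w * u) = u.
  by rewrite mulrA qconj_mul Sw mkq1 mul1r.
have Sw' : sphere (qconj w) by rewrite /sphere /= qabs2_conj.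
exists D, (fun u => stereo (qconj w * u)), setT, (fun x => w * stereo_inv x).
split=> //.
- split=> //; last exact: openT.
  by split=> //=; rewrite qconj_mul Sw mkqE; lra.
- have sD : smooth_on D (fun u => qconj w * u).
    by apply: smooth_qmul => //; [exact: smooth_cst|exact: smooth_id].
  apply: (smooth_mx (f := fun u => stereo (qconj w * u) : 'rV[R]_3)) => // i j.
  apply: (@smooth_ext _ _ _ _ (fun u => (1 + re (qconj w * u))^-1 *
     nth 0 [:: im1 (qconj w * u); im2 (qconj w * u); im3 (qconj w * u)] j)) => //.
    by move=> u _; rewrite !mxE.
  apply: smooth_mulR => //.
    apply: smooth_invR => //; apply: smooth_addR => //; first exact: smooth_cst.
    exact: smooth_re.
  case: j => -[|[|[|//]]] ? /=; [exact: smooth_im1|exact: smooth_im2|exact: smooth_im3].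
- have sx i : smooth_on setT (fun x : 'rV[R]_3 => x 0 i).
    by apply: smooth_entry; [exact: openT|exact: smooth_id openT].
  have oT : open [set: 'rV[R]_3] by exact: openT.
  have c (a : R) : smooth_on setT (fun _ : 'rV[R]_3 => a) by exact: smooth_cst.
  apply: smooth_qmul => //; first exact: smooth_cst.
  have ss : smooth_on setT (fun x : 'rV[R]_3 =>
      x 0 (inord 0) ^+ 2 + x 0 (inord 1) ^+ 2 + x 0 (inord 2) ^+ 2).
    have sq i : smooth_on setT (fun x : 'rV[R]_3 => x 0 i ^+ 2).
      exact: (smooth_mulR oT (sx i) (sx i)).
    by apply: smooth_addR => //; apply: smooth_addR.
  apply: (smooth_qscale oT).
    apply: (smooth_invR oT); last exact: smooth_addR.
    by move=> x _; rewrite gt_eqF// ltr_pwDl// !addr_ge0 ?sqr_ge0.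
  apply: (smooth_mkq oT); try exact: smooth_mulR.
  by apply: smooth_addR => //; exact: smooth_oppR.
- move=> u Su Du; split=> //; rewrite stereoK ?wK//; last exact: re0.
  exact: sphereM.
- move=> x _; have [Sx x0 xK] := stereo_inv_sphere x.
  rewrite /D /= Kw xK; split=> //; first exact: sphereM.
  split=> //=; move: x0 (Sx); rewrite /sphere /qabs2 /= => x0 S1.
  have := sqr_ge0 (im1 (stereo_inv x)); have := sqr_ge0 (im2 (stereo_inv x)).
  have := sqr_ge0 (im3 (stereo_inv x)); move: x0 S1.
  move: (re _) (im1 _) (im2 _) (im3 _) => a b c d a0 S1 d2 c2 b2.
  rewrite lt_neqAle; apply/andP; split; last by nra.
  by apply: contra a0 => /eqP <-; rewrite subrr.
Qed.

End BallSphere.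

(** * Coordinates on Sp(1,1) *)

Section Sp11Algebra.
Context {R : realType}.
Implicit Types (p q u v w : quat R) (A B : 'M[quat R]_2).

Lemma ord2P (P : 'I_2 -> Prop) : P 0 -> P 1 -> forall i, P i.
Proof.
move=> P0 P1; case=> -[|[|//]] ?; [move: P0|move: P1];
  by congr P; exact: val_inj.
Qed.

Lemma mulmx2E (A B : 'M[quat R]_2) i j : (A *m B) i j = A i 0 * B 0 j + A i 1 * B 1 j.
Proof.
rewrite !mxE !big_ord_recl big_ord0 addr0; congr (_ + _ * _);
  by congr (_ _ _); exact: val_inj.
Qed.

Lemma I11E : (((I11 : 'M[quat R]_2) 0 0 = 1) * ((I11 : 'M[quat R]_2) 0 1 = 0)
  * ((I11 : 'M[quat R]_2) 1 0 = 0) * ((I11 : 'M[quat R]_2) 1 1 = - 1))%type.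
Proof. by rewrite !mxE. Qed.

Lemma adjmxE A i j : adjmx A i j = qconj (A j i).
Proof. by rewrite !mxE. Qed.

Lemma Sp11E A : Sp11 A <-> forall i j,
  qconj (A 0 i) * A 0 j - qconj (A 1 i) * A 1 j = (I11 : 'M[quat R]_2) i j.
Proof.
have E i j : (adjmx A *m I11 *m A) i j = qconj (A 0 i) * A 0 j - qconj (A 1 i) * A 1 j.
  by rewrite !mulmx2E !I11E !adjmxE !mulr0 !mulr1 !addr0 add0r mulrN1 mulNr.
by split=> [hA i j|hA]; [rewrite -E hA|apply/matrixP => i j; rewrite E hA].
Qed.

Lemma invSpE A : ((invSp A 0 0 = qconj (A 0 0)) * (invSp A 0 1 = - qconj (A 1 0)) *
  (invSp A 1 0 = - qconj (A 0 1)) * (invSp A 1 1 = qconj (A 1 1)))%type.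
Proof.
rewrite /invSp !mulmx2E !I11E !adjmxE.
by rewrite !(mul0r, mulr0, mul1r, mulr1, addr0, add0r, mulN1r, mulrN1, opprK).
Qed.

(** The relations between rows, obtained from A A^-1 = 1, and the relation
    |a|^2 - |b|^2 = 1 between columns. *)
Lemma Sp11_rows A : Sp11 A ->
  [/\ qabs2 (A 1 1) = 1 + qabs2 (A 1 0), qabs2 (A 0 0) = qabs2 (A 1 1),
      qabs2 (A 0 1) = qabs2 (A 1 0) &
      A 0 0 * qconj (A 1 0) = A 0 1 * qconj (A 1 1)].
Proof.
move=> hA; have H i j : A i 0 * invSp A 0 j + A i 1 * invSp A 1 j = (i == j)%:R.
  by rewrite -mulmx2E mul_invSp// mxE.
have := H 0 0; rewrite !invSpE mulrN !qmul_conj mkq_realB => /(congr1 re).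
rewrite mkqE q1E => ac.
have := H 1 1; rewrite !invSpE mulrN !qmul_conj addrC mkq_realB => /(congr1 re).
rewrite mkqE q1E => db.
have := H 0 1; rewrite !invSpE mulrN addrC => /subr0_eq e01.
have /Sp11E/(_ 0 0) := hA; rewrite !qconj_mul mkq_realB I11E => /(congr1 re).
rewrite mkqE q1E => ab; split=> //; lra.
Qed.

Definition quad_mx (a c b d : quat R) : 'M[quat R]_2 :=
  \matrix_(i, j) (if i == 0 then (if j == 0 then a else c) else (if j == 0 then b else d)).

Lemma quad_mxE a c b d : ((quad_mx a c b d 0 0 = a) * (quad_mx a c b d 0 1 = c) *
  (quad_mx a c b d 1 0 = b) * (quad_mx a c b d 1 1 = d))%type.
Proof. by rewrite !mxE. Qed.

Definition qcoord A : quat R := A 1 0 * (A 1 1)^-1.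
Definition ucoord A : quat R := A 0 0 * (A 1 1)^-1.
Definition vcoord A : quat R := qsgn (A 1 1).

(** The matrix of Sp(1,1) with coordinates [q], [u] and [v]. *)
Definition spmx q u v : 'M[quat R]_2 := let s := (Num.sqrt (1 - qabs2 q))^-1 in
  quad_mx (s *: (u * v)) (s *: (u * qconj q * v)) (s *: (q * v)) (s *: v).

Lemma qconjZ (s : R) q : qconj (s *: q) = s *: qconj q.
Proof. by apply: quatP; rewrite !mkqE !qscaleE !mkqE ?mulrN. Qed.

Lemma qscaleAl (s : R) p q : s *: p * q = s *: (p * q).
Proof. by apply: quatP; rewrite qscaleE !qmulE /qmul !mkqE !qscaleE; ring. Qed.

Lemma qscaleAr (s : R) p q : p * (s *: q) = s *: (p * q).
Proof. by apply: quatP; rewrite qscaleE !qmulE /qmul !mkqE !qscaleE; ring. Qed.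

Lemma qrealE (s : R) : mkq s 0 0 0 = s *: (1 : quat R).
Proof. by apply: quatP; rewrite qscaleE mkqE q1E ?mulr0 ?mulr1. Qed.

Lemma qconj_mulE q : qconj q * q = qabs2 q *: (1 : quat R).
Proof. by rewrite qconj_mul qrealE. Qed.

Lemma qmul_conjE q : q * qconj q = qabs2 q *: (1 : quat R).
Proof. by rewrite qmul_conj qrealE. Qed.

Lemma spmx_scale q : @qball R q -> let s := (Num.sqrt (1 - qabs2 q))^-1 in
  0 < s /\ s ^+ 2 * (1 - qabs2 q) = 1.
Proof.
rewrite qballE => q1 /=; have d0 : 0 < 1 - qabs2 q by rewrite subr_gt0.
split; first by rewrite invr_gt0 sqrtr_gt0.
by rewrite exprVn sqr_sqrtr ?ltW// mulVf// gt_eqF.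
Qed.

Lemma spmx_Sp11 q u v : @qball R q -> sphere u -> sphere v -> Sp11 (spmx q u v).
Proof.
move=> Bq Su Sv; have := spmx_scale Bq; rewrite /spmx; set s := _^-1.
move=> [s0 s2]; apply/Sp11E.
have K x y : qconj (s *: x) * (s *: y) = s ^+ 2 *: (qconj x * y).
  by rewrite qconjZ qscaleAl qscaleAr scalerA.
have UU x y : qconj (u * x) * (u * y) = qconj x * y.
  by rewrite qconjM mulrA -(mulrA (qconj x)) qconj_mulE Su scale1r mulr1.
have VV x y : qconj (x * v) * (y * v) = qconj v * (qconj x * y) * v.
  by rewrite qconjM !mulrA.
have V1 (r : R) : qconj v * (r *: (1 : quat R)) * v = r *: (1 : quat R).
  by rewrite qscaleAr mulr1 qscaleAl qconj_mulE Sv scale1r.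
apply: (ord2P); apply: (ord2P); rewrite !quad_mxE !I11E !K -?(mulrA u) ?UU -?scalerBr.
- rewrite qconj_mulE Sv VV qconj_mulE V1 -scalerBl scalerA s2 scale1r//.
- have -> : qconj v * (qconj q * v) - qconj (q * v) * v = 0.
    by rewrite qconjM mulrA subrr.
  by rewrite scaler0.
- have -> : qconj (qconj q * v) * v - qconj v * (q * v) = 0.
    by rewrite qconjM qconjK mulrA subrr.
  by rewrite scaler0.
- rewrite VV qconjK qmul_conjE V1 qconj_mulE Sv -scalerBl scalerA.
  by rewrite -opprB mulrN s2 scaleN1r.
Qed.

Lemma spmx_coords q u v : @qball R q -> sphere u -> sphere v ->
  [/\ qcoord (spmx q u v) = q, ucoord (spmx q u v) = u & vcoord (spmx q u v) = v].
Proof.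
move=> Bq Su Sv; have := spmx_scale Bq; rewrite /qcoord /ucoord /vcoord /spmx !quad_mxE.
set s := _^-1 => -[s0 s2].
have sv0 : s *: v \is a GRing.unit.
  by rewrite qunitE scaler_eq0 negb_or gt_eqF// sphere_neq0.
by rewrite -!qscaleAr !mulrK// qsgnZ.
Qed.

Lemma Sp11_d_neq0 A : Sp11 A -> A 1 1 != 0.
Proof.
move=> /Sp11_rows[dE _ _ _]; rewrite -qabs2_gt0 dE.
by have := qabs2_ge0 (A 1 0); lra.
Qed.

Lemma qcoord_ball A : Sp11 A -> @qball R (qcoord A).
Proof.
move=> hA; have d0 := Sp11_d_neq0 hA; have [dE _ _ _] := Sp11_rows hA.
rewrite qballE /qcoord qabs2M qabs2V ltr_pdivrMr ?qabs2_gt0// mul1r dE.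
lra.
Qed.

Lemma ucoord_sphere A : Sp11 A -> sphere (ucoord A).
Proof.
move=> hA; have d0 := Sp11_d_neq0 hA; have [_ aE _ _] := Sp11_rows hA.
by rewrite /sphere /= /ucoord qabs2M qabs2V aE divff// qabs2_eq0.
Qed.

Lemma vcoord_sphere A : Sp11 A -> sphere (vcoord A).
Proof. by move=> /Sp11_d_neq0; exact: qsgn_sphere. Qed.

(** The factor (1 - |q|^2)^(-1/2) is |d|, because 1 - |b|^2 / |d|^2 = 1 / |d|^2; the
    upper right entry is determined by a conj(b) = c conj(d). *)
Lemma spmxK A : Sp11 A -> spmx (qcoord A) (ucoord A) (vcoord A) = A.
Proof.
move=> hA; have d0 := Sp11_d_neq0 hA; have [dE aE cE e] := Sp11_rows hA.
have du : A 1 1 \is a GRing.unit by rewrite qunitE.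
have s1 : (Num.sqrt (1 - qabs2 (qcoord A)))^-1 = qabs (A 1 1).
  have d2 : qabs2 (A 1 1) != 0 by rewrite qabs2_eq0.
  have -> : 1 - qabs2 (qcoord A) = (qabs2 (A 1 1))^-1.
    rewrite /qcoord qabs2M qabs2V -[X in X - _](mulfV d2) -mulrBl.
    by rewrite {1}dE addrK mul1r.
  by rewrite sqrtrV ?qabs2_ge0// invrK.
have sv : qabs (A 1 1) *: vcoord A = A 1 1.
  by rewrite /vcoord /qsgn scalerA mulfV ?scale1r// qabs_eq0.
rewrite /spmx s1 -!qscaleAr sv; apply/matrixP.
apply: (ord2P); apply: (ord2P); rewrite quad_mxE //; try by rewrite divrK.
have cu : qconj (A 1 1) \is a GRing.unit by rewrite qunitE -qabs2_eq0 qabs2_conj qabs2_eq0.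
apply: (mulIr cu); rewrite -[RHS]e /ucoord /qcoord qconjM.
have -> : qconj (A 1 1)^-1 = (qabs2 (A 1 1))^-1 *: A 1 1.
  by rewrite -[RHS]qconjK; congr qconj; rewrite qconjZ.
rewrite -(mulrA _ (A 1 1)) qmul_conjE qscaleAr mulr1 qscaleAl qscaleAr scalerA.
by rewrite mulfV ?qabs2_eq0// scale1r mulrA divrK.
Qed.

(** Both the ratio b d^-1 and the ratio a d^-1 absorb a right factor [w], and only the
    first row sees a left factor diag(u, 1). *)
Lemma qcoord_act A B u w : u != 0 -> w != 0 -> A = diag2 u 1 *m B *m w%:M ->
  qcoord A = qcoord B /\ ucoord A = u * ucoord B.
Proof.
move=> u0 w0 ->; rewrite Sp1I2_diag.
have E i j : (diag2 u 1 *m B *m diag2 w w) i j =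
    (if i == 0 then u else 1) * B i j * w.
  move: i j; apply: (ord2P); apply: (ord2P); rewrite !mulmx2E !mxE /=;
  by rewrite !(mulr1n, mulr0n, mul0r, mulr0, add0r, addr0).
rewrite /qcoord /ucoord !E /= !mul1r.
have [->|d0] := eqVneq (B 1 1) 0; first by rewrite mul0r invr0 !mulr0.
have wu : w \is a GRing.unit by [].
have du : B 1 1 \is a GRing.unit by [].
by rewrite invrM// !mulrA !mulrK.
Qed.

End Sp11Algebra.

(** * Sp(1,1) as a retract *)

Lemma continuous_mx_at (X T : topologicalType) m n (f : X -> 'M[T]_(m, n)) x :
  (forall i j, {for x, continuous (fun y => f y i j)}) -> {for x, continuous f}.
Proof.
move=> cf N [B BN NB]; apply: (@filterS _ _ _ (fun y => forall i j, B i j (f y i j))).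
  by move=> y By; apply: NB.
apply: filter_forall => i; apply: filter_forall => j.
exact: cf (BN i j).
Qed.

Lemma mx_entry_continuous (T : topologicalType) m n i j :
  continuous (fun A : 'M[T]_(m, n) => A i j).
Proof.
move=> A N AN.
exists (fun i' j' => [set t | i' = i -> j' = j -> N t]).
  move=> i' j'; apply: (@filterS _ _ _ (if (i' == i) && (j' == j) then N else setT)).
    by move=> t + ? ?; subst; rewrite !eqxx.
  by case: ifP => [/andP[/eqP -> /eqP ->]//|_]; exact: filterT.
by move=> B /(_ i j) /= h; exact: h.
Qed.

(** Maps into a subtype are given by maps into the ambient space that take values in
    the subset near the point considered. *)
Lemma continuous_insubd_at (X E : topologicalType) (A : set E) (a0 : set_type A)
    (f : X -> E) (O : set X) x : open O -> O x -> (forall y, O y -> A (f y)) ->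
  {for x, continuous f} -> {for x, continuous (fun y => insubd a0 (f y) : set_type A)}.
Proof.
move=> oO Ox AO cf N [_ [[W oW <-] Wx] WN].
have vE y : O y -> set_val (insubd a0 (f y)) = f y.
  by move=> Oy; apply: insubdK; exact/mem_set/AO.
have : \forall y \near x, O y /\ W (f y).
  apply: filterI; first exact: open_nbhs_nbhs.
  by apply: cf; apply: open_nbhs_nbhs; split=> //; rewrite -vE.
by apply: filterS => y [Oy Wy]; apply: WN; rewrite /= vE.
Qed.

Section SubRetract.
Context {R : realType}.
Variables (E0 : topologicalType) (A : set E0) (a0 : set_type A).
Variables (V : normedModType R) (fV : findim V) (e : E0 -> V) (D : set V) (f : V -> E0).
Hypotheses (oD : open D) (ce : continuous (fun a : set_type A => e (set_val a)))
  (eD : forall a, A a -> D (e a)) (eK : forall a, A a -> f (e a) = a)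
  (fA : forall x, D x -> A (f x)) (cf : forall x, D x -> {for x, continuous f})
  (sf : smooth_on D (fun x => e (f x))).

Let S x : set_type A := insubd a0 (f x).

Let valS x : D x -> set_val (S x) = f x.
Proof. by move=> Dx; apply: insubdK; exact/mem_set/fA. Qed.

Let Aval (a : set_type A) : A (set_val a). Proof. exact: set_mem (valP a). Qed.

Let ED (a : set_type A) : D (e (set_val a)). Proof. exact/eD/Aval. Qed.

Let EK (a : set_type A) : S (e (set_val a)) = a.
Proof. by apply: val_inj; apply: etrans (valS (ED a)) _; rewrite eK. Qed.

Let cS x : D x -> {for x, continuous S}.
Proof. by move=> Dx; have := @continuous_insubd_at _ _ A a0 f D x oD Dx fA (cf Dx); exact. Qed.

Let sS : smooth_on D (fun x => e (set_val (S x))).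
Proof. by apply: (smooth_ext oD _ sf) => x Dx; rewrite valS. Qed.

(** The case of a subset [A]: an ambient map [f] with values in [A] provides the
    retraction. *)
Definition sub_retract : retract R (set_type A) := Retract fV oD ce ED EK cS sS.

Lemma sub_retract_val x : D x -> set_val (rret sub_retract x) = f x.
Proof. exact: valS. Qed.

End SubRetract.

Section Sp11Model.
Context {R : realType}.

Let V2 : normedModType R := (quat R * quat R)%type.
Let V3 : normedModType R := (quat R * (quat R * quat R))%type.

Definition coords (A : 'M[quat R]_2) : V3 := (qcoord A, (ucoord A, vcoord A)).
Definition ball_nz_nz : set V3 := @qball R `*` (@qnz R `*` @qnz R).
(** An open neighbourhood of the product of the ball and the sphere, on which the
    retraction normalizes the second component. *)
Definition ball_nz : set V2 := @qball R `*` @qnz R.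
Definition sp_of (x : V3) : 'M[quat R]_2 := spmx x.1 (qsgn x.2.1) (qsgn x.2.2).

Lemma open_ball_nz : open ball_nz.
Proof. by apply: openX; [exact: open_qball|exact: open_qnz]. Qed.

Lemma open_ball_nz_nz : open ball_nz_nz.
Proof. by apply: openX; [exact: open_qball|apply: openX; exact: open_qnz]. Qed.

Lemma smooth_proj1 (V W : normedModType R) (O : set (V * W)%type) : open O ->
  smooth_on O (fun x : V * W => x.1).
Proof. by move=> oO; exact: smooth_fst oO (smooth_id oO). Qed.

Lemma smooth_proj2 (V W : normedModType R) (O : set (V * W)%type) : open O ->
  smooth_on O (fun x : V * W => x.2).
Proof. by move=> oO; exact: smooth_snd oO (smooth_id oO). Qed.

Definition mat_entry i j (m : 'M[R]_(2 * 2, 4)) : quat R := row (mxvec_index i j) m.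

Lemma mat_coordsE (A : 'M[quat R]_2) i j l :
  mat_coords A (mxvec_index i j) l = (A i j : 'rV[R]_4) 0 l.
Proof. by rewrite mxE mxvecE. Qed.

Lemma mat_entryE (A : 'M[quat R]_2) i j : mat_entry i j (mat_coords A) = A i j.
Proof. by apply/rowP => k; rewrite mxE mat_coordsE. Qed.

Definition nz_corner : set 'M[R]_(2 * 2, 4) := [set m | mat_entry 1 1 m != 0].

(** The coordinates (q, u, v) as functions of the real entries; they are defined and
    smooth as soon as the lower right entry is nonzero. *)
Definition coordsM (m : 'M[R]_(2 * 2, 4)) : V3 :=
  (mat_entry 1 0 m * (mat_entry 1 1 m)^-1, (mat_entry 0 0 m * (mat_entry 1 1 m)^-1, qsgn (mat_entry 1 1 m))).

Lemma coordsME A : coordsM (mat_coords A) = coords A.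
Proof. by rewrite /coordsM !mat_entryE. Qed.

Lemma smooth_mat_entry i j (O : set 'M[R]_(2 * 2, 4)) : open O -> smooth_on O (mat_entry i j).
Proof.
move=> oO; apply: (smooth_mx (f := mat_entry i j : _ -> 'rV[R]_4)) => // k l.
apply: (@smooth_ext _ _ _ _ (fun m : 'M[R]_(2 * 2, 4) => m (mxvec_index i j) l)) => //.
  by move=> m _; rewrite mxE.
by apply: smooth_entry => //; exact: smooth_id.
Qed.

Lemma open_nz_corner : open nz_corner.
Proof.
rewrite (_ : nz_corner = setT `&` mat_entry 1 1 @^-1` @qnz R); last first.
  by apply/seteqP; split=> m // [].
apply: open_setI_preimage => [|x _|]; [exact: openT| |exact: open_qnz].
by apply: (smooth_continuous (O := setT)) => //; exact: smooth_mat_entry openT.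
Qed.

Lemma smooth_coordsM : smooth_on nz_corner coordsM.
Proof.
have oM := open_nz_corner; have s := smooth_mat_entry _ _ oM.
have sd : smooth_on nz_corner (fun m => (mat_entry 1 1 m)^-1) by exact: smooth_qinv.
by apply: smooth_pair => //; [exact: smooth_qmul|apply: smooth_pair => //;
  [exact: smooth_qmul|exact: smooth_qsgn]].
Qed.

Lemma mat_coords_continuous : continuous (@mat_coords R).
Proof.
move=> A; apply: continuous_mx_at => k l; case/mxvec_indexP: k => i j.
rewrite (_ : (fun y => _) = (fun B : 'M[quat R]_2 => (B i j : 'rV[R]_4) 0 l)); last first.
  by apply/funext => B; rewrite mat_coordsE.
have c1 := @mx_entry_continuous (quat R) 2 2 i j A.
exact: continuous_comp c1 (@coord_continuous R 1 4 0 l _).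
Qed.

Lemma coords_continuous :
  continuous (fun A : set_type (@Sp11 R) => coords (set_val A)).
Proof.
move=> A.
rewrite (_ : (fun A => _) = coordsM \o (@mat_coords R \o set_val)); last first.
  by apply/funext => B; rewrite /= coordsME.
have c1 : {for A, continuous (set_val : set_type (@Sp11 R) -> _)}.
  exact: initial_continuous.
have c2 := continuous_comp c1 (@mat_coords_continuous _).
apply: continuous_comp c2 _; apply: (smooth_continuous smooth_coordsM).
by rewrite /nz_corner /= mat_entryE; apply: Sp11_d_neq0; exact: SpP.
Qed.

Lemma coords_dom A : Sp11 A -> ball_nz_nz (coords A).
Proof.
move=> hA; split; first exact: qcoord_ball.
by split; apply: sphere_neq0; [exact: ucoord_sphere|exact: vcoord_sphere].
Qed.

Lemma coordsK A : Sp11 A -> sp_of (coords A) = A.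
Proof.
move=> hA; rewrite /sp_of /= !qsgn_id ?spmxK//; [exact: vcoord_sphere|exact: ucoord_sphere].
Qed.

Lemma sp_of_Sp11 x : ball_nz_nz x -> Sp11 (sp_of x).
Proof. by move=> [Bq [u0 v0]]; apply: spmx_Sp11 => //; exact: qsgn_sphere. Qed.

Lemma coords_sp_of x : ball_nz_nz x -> coords (sp_of x) = (x.1, (qsgn x.2.1, qsgn x.2.2)).
Proof.
move=> [Bq [u0 v0]]; rewrite /coords /sp_of.
by have [-> -> ->] := spmx_coords Bq (qsgn_sphere u0) (qsgn_sphere v0).
Qed.

Lemma smooth_spmx_entry (V : normedModType R) (O : set V) (q u v : V -> quat R) i j :
  open O -> (forall x, O x -> @qball R (q x)) ->
  smooth_on O q -> smooth_on O u -> smooth_on O v ->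
  smooth_on O (fun x => spmx (q x) (u x) (v x) i j).
Proof.
move=> oO Bq sq su sv.
have ss : smooth_on O (fun x => (Num.sqrt (1 - qabs2 (q x)))^-1).
  apply: smooth_invR => //.
    move=> x /Bq; rewrite qballE => q1.
    by rewrite gt_eqF// sqrtr_gt0 subr_gt0.
  apply: smooth_sqrtR => //.
    by move=> x /Bq; rewrite qballE subr_gt0.
  apply: smooth_addR => //; first exact: smooth_cst.
  by apply: smooth_oppR => //; exact: smooth_qabs2.
move: i j; apply: (ord2P); apply: (ord2P);
  [pose F (q u v : quat R) := u * v|pose F (q u v : quat R) := u * qconj q * v
  |pose F (q u v : quat R) := q * v|pose F (q u v : quat R) := v];
  apply: (@smooth_ext _ _ _ _ (fun x => (Num.sqrt (1 - qabs2 (q x)))^-1 *: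
    F (q x) (u x) (v x))) => //; try (by move=> x _; rewrite quad_mxE);
  apply: smooth_qscale => //; rewrite /F; do ?apply: smooth_qmul => //.
exact: smooth_qconj.
Qed.

Lemma smooth_ball_nz_nz_retraction : [/\ smooth_on ball_nz_nz (fun x : V3 => x.1),
  smooth_on ball_nz_nz (fun x : V3 => qsgn x.2.1) & smooth_on ball_nz_nz (fun x : V3 => qsgn x.2.2)].
Proof.
have o := open_ball_nz_nz; split; first exact: smooth_proj1.
  apply: smooth_qsgn => //; first by move=> x [_ []].
  by apply: smooth_fst => //; exact: smooth_proj2.
apply: smooth_qsgn => //; first by move=> x [_ []].
by apply: smooth_snd => //; exact: smooth_proj2.
Qed.

Lemma smooth_sp_of_entry i j : smooth_on ball_nz_nz (fun x => sp_of x i j).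
Proof.
have [s1 s2 s3] := smooth_ball_nz_nz_retraction; apply: smooth_spmx_entry => //.
  exact: open_ball_nz_nz.
by move=> x [].
Qed.

Lemma sp_of_continuous x : ball_nz_nz x -> {for x, continuous sp_of}.
Proof.
move=> Dx; apply: continuous_mx_at => i j.
exact: smooth_continuous (smooth_sp_of_entry i j) Dx.
Qed.

Lemma smooth_coords_sp_of : smooth_on ball_nz_nz (fun x => coords (sp_of x)).
Proof.
have [s1 s2 s3] := smooth_ball_nz_nz_retraction; have o := open_ball_nz_nz.
apply: (@smooth_ext _ _ _ _ (fun x : V3 => (x.1, (qsgn x.2.1, qsgn x.2.2)))) => //.
  by move=> x Dx; rewrite coords_sp_of.
by do 2?apply: smooth_pair => //.
Qed.

Lemma Sp11_1 : @Sp11 R 1%:M.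
Proof. by apply: Sp1I2_sub; exact: Sp1I2_1. Qed.

Definition Sp_retract : retract R (set_type (@Sp11 R)) :=
  sub_retract (mkSp Sp11_1) _ open_ball_nz_nz coords_continuous coords_dom coordsK
    sp_of_Sp11 sp_of_continuous smooth_coords_sp_of.

End Sp11Model.

(** * Coordinates on the coset spaces *)

Section CosetModels.
Context {R : realType}.

Let V2 : normedModType R := (quat R * quat R)%type.
Let V3 : normedModType R := (quat R * (quat R * quat R))%type.
Let Sp : Type := set_type (@Sp11 R).

(** The entries and the coordinates (q, u, v) are smooth functions of each other. *)
Lemma atlas_Sp : submanifold_atlas mat_coords (X := @Sp11 R) (n := 10) =
  atlas_of (@Sp_retract R) 10.
Proof.
apply: (@induced_atlas_eq R (set_type (@Sp11 R)) 'M[R]_(2 * 2, 4) V3 _ _ 10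
  (fun A => mat_coords (set_val A)) (fun A => coords (set_val A))
  (@nz_corner R) (@ball_nz_nz R) (@coordsM R) (fun x : V3 => mat_coords (sp_of x))).
- exact: open_nz_corner.
- exact: open_ball_nz_nz.
- by move=> t; rewrite /nz_corner /= mat_entryE; apply: Sp11_d_neq0; exact: SpP.
- by move=> t; apply: coords_dom; exact: SpP.
- exact: smooth_coordsM.
- apply: smooth_mx; first exact: open_ball_nz_nz.
  move=> k l; case/mxvec_indexP: k => i j.
  apply: (@smooth_ext _ _ _ _ (fun x : V3 => (sp_of x i j : 'rV[R]_4) 0 l)).
  + exact: open_ball_nz_nz.
  + by move=> x _; rewrite mat_coordsE.
  + exact: (smooth_entry (f := fun x : V3 => sp_of x i j : 'rV[R]_4) 0 l
      (open_ball_nz_nz (R := R)) (@smooth_sp_of_entry R i j)).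
- by move=> t; exact: coordsME.
- by move=> t; rewrite /= coordsK//; exact: SpP.
Qed.

Lemma diag2E (x y : quat R) : ((diag2 x y 0 0 = x) * (diag2 x y 0 1 = 0) *
  (diag2 x y 1 0 = 0) * (diag2 x y 1 1 = y))%type.
Proof. by rewrite !mxE /= !mulr1n !mulr0n. Qed.

Lemma sphereE (u : quat R) : sphere u <-> qabs u = 1.
Proof. by split; [exact: qabs_sphere|exact: qabs_eq1]. Qed.

Lemma Sp1x1E (A : 'M[quat R]_2) : Sp1x1 A -> sphere (A 0 0) /\ A = diag2 (A 0 0) 1.
Proof. by move=> [u /sphereE u1 ->]; rewrite diag2E. Qed.

Definition Sp1x1_unit : set_type (@Sp1x1 R) := exist _ 1%:M (mem_set (@Sp1x1_1 R)).

Lemma diag2_qsgn_continuous x : qnz x ->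
  {for x, continuous (fun u : quat R => diag2 (qsgn u) (1 : quat R))}.
Proof.
move=> x0; apply: continuous_mx_at.
have c (y : quat R) : {for x, continuous (fun _ : quat R => y)} by exact: cst_continuous.
have s : {for x, continuous (@qsgn R)}.
  apply: (smooth_continuous (O := @qnz R)) => //.
  by apply: smooth_qsgn; [exact: open_qnz| |exact: smooth_id open_qnz].
apply: (ord2P); apply: (ord2P).
- have -> : (fun y => diag2 (qsgn y) (1 : quat R) 0 0) = @qsgn R.
    by apply/funext => y; rewrite diag2E.
  exact: s.
- have -> : (fun y => diag2 (qsgn y) (1 : quat R) 0 1) = (fun=> 0).
    by apply/funext => y; rewrite diag2E.
  exact: c.
- have -> : (fun y => diag2 (qsgn y) (1 : quat R) 1 0) = (fun=> 0).
    by apply/funext => y; rewrite diag2E.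
  exact: c.
- have -> : (fun y => diag2 (qsgn y) (1 : quat R) 1 1) = (fun=> 1).
    by apply/funext => y; rewrite diag2E.
  exact: c.
Qed.

Lemma smooth_qsgn_qnz : smooth_on (@qnz R) (@qsgn R).
Proof. by apply: smooth_qsgn; [exact: open_qnz| |exact: smooth_id open_qnz]. Qed.

Lemma Sp1x1_entry_continuous :
  continuous (fun A : set_type (@Sp1x1 R) => (set_val A 0 0 : quat R)).
Proof.
move=> A; have c1 : {for A, continuous (set_val : set_type (@Sp1x1 R) -> _)}.
  exact: initial_continuous.
exact: continuous_comp c1 (@mx_entry_continuous (quat R) 2 2 0 0 _).
Qed.

Lemma Sp1x1_dom (A : 'M[quat R]_2) : Sp1x1 A -> qnz (A 0 0).
Proof. by move=> /Sp1x1E[/sphere_neq0]. Qed.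

Lemma Sp1x1_entryK (A : 'M[quat R]_2) : Sp1x1 A -> diag2 (qsgn (A 0 0)) 1 = A.
Proof. by move=> /Sp1x1E[s e]; rewrite qsgn_id. Qed.

Lemma diag2_qsgn_Sp1x1 (u : quat R) : qnz u -> Sp1x1 (diag2 (qsgn u) 1).
Proof. by move=> u0; exists (qsgn u) => //; apply/sphereE/qsgn_sphere. Qed.

Lemma smooth_diag2_qsgn : smooth_on (@qnz R) (fun u => diag2 (qsgn u) (1 : quat R) 0 0).
Proof.
by apply: (smooth_ext open_qnz _ smooth_qsgn_qnz) => u _; rewrite diag2E.
Qed.

Definition Sp1x1_retract : retract R (set_type (@Sp1x1 R)) :=
  @sub_retract R _ _ Sp1x1_unit (quat R) _ (fun A => A 0 0) _ _ open_qnz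
    Sp1x1_entry_continuous Sp1x1_dom Sp1x1_entryK
    diag2_qsgn_Sp1x1 diag2_qsgn_continuous smooth_diag2_qsgn.

Lemma atlas_Sp1x1 : submanifold_atlas mat_coords (X := @Sp1x1 R) (n := 3) =
  atlas_of Sp1x1_retract 3.
Proof.
apply: (@induced_atlas_eq R (set_type (@Sp1x1 R)) 'M[R]_(2 * 2, 4) (quat R) _ _ 3
  (fun A => mat_coords (set_val A)) (fun A => set_val A 0 0) setT setT (mat_entry 0 0)
  (fun u : quat R => mat_coords (diag2 u 1))) => //.
- exact: openT.
- exact: openT.
- exact: smooth_mat_entry openT.
- apply: smooth_mx; first exact: openT.
  move=> k l; case/mxvec_indexP: k => i j.
  have oT : open [set: quat R] by exact: openT.
  apply: (@smooth_ext _ _ _ _ (fun u : quat R => (diag2 u 1 i j : 'rV[R]_4) 0 l)) => //.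
    by move=> x _; rewrite mat_coordsE.
  suff s : smooth_on setT (fun u : quat R => diag2 u (1 : quat R) i j).
    exact: (smooth_entry (f := fun u : quat R => diag2 u (1 : quat R) i j : 'rV[R]_4) 0 l oT s).
  have id_ := smooth_id oT; have c (y : quat R) : smooth_on setT (fun _ : quat R => y).
    exact: smooth_cst.
  move: i j; apply: (ord2P); apply: (ord2P).
  + by apply: (smooth_ext oT _ id_) => u _; rewrite diag2E.
  + by apply: (smooth_ext oT _ (c 0)) => u _; rewrite diag2E.
  + by apply: (smooth_ext oT _ (c 0)) => u _; rewrite diag2E.
  + by apply: (smooth_ext oT _ (c 1)) => u _; rewrite diag2E.
- by move=> t; rewrite mat_entryE.
- by move=> t; have /Sp1x1E[_ <-] := set_mem (valP t).
Qed.

Lemma qball0 : @qball R 0.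
Proof. by rewrite qballE /qabs2 !q0E expr0n /= !addr0. Qed.

Definition ball_center : set_type (@qball R) := exist _ 0 (mem_set qball0).

Lemma ball_val_continuous : continuous (set_val : set_type (@qball R) -> quat R).
Proof. exact: initial_continuous. Qed.

Lemma id_continuous_at (x : quat R) : qball x -> {for x, continuous (@id (quat R))}.
Proof. by move=> _; exact: cvg_id. Qed.

Definition ball_retract : retract R (set_type (@qball R)) :=
  @sub_retract R _ _ ball_center (quat R) _ id (@qball R) id open_qball
    ball_val_continuous (fun _ h => h) (fun _ _ => erefl) (fun _ h => h)
    id_continuous_at (smooth_id open_qball).

Lemma coset_coordE (A B : Sp) : coset_proj A = coset_proj B ->
  qcoord (set_val A) = qcoord (set_val B) /\ ucoord (set_val A) = ucoord (set_val B).
Proof.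
move=> /esym /coset_projP[_ [w /qabs_eq1 w1 ->] e].
have := @qcoord_act R (set_val A) (set_val B) 1 w (oner_neq0 _) (sphere_neq0 w1).
by rewrite -Sp1I2_diag mul1mx mul1r; apply.
Qed.

Lemma dcoset_coordE (A B : Sp) : dcoset_proj A = dcoset_proj B ->
  qcoord (set_val A) = qcoord (set_val B).
Proof.
move=> /esym /dcoset_projP[_ [_ [[u /qabs_eq1 u1 ->] [w /qabs_eq1 w1 ->] e]]].
by have [] := qcoord_act (sphere_neq0 u1) (sphere_neq0 w1) e.
Qed.

Definition coset_coord (x : coset_space R) : V2 :=
  (qcoord (set_val (repr x)), ucoord (set_val (repr x))).

Definition dcoset_coord (x : dcoset_space R) : quat R := qcoord (set_val (repr x)).

Lemma coset_coord_proj A :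
  coset_coord (coset_proj A) = (qcoord (set_val A), ucoord (set_val A)).
Proof.
have e : coset_proj (repr (coset_proj A)) = coset_proj A by exact: reprK.
by rewrite /coset_coord; have [-> ->] := coset_coordE e.
Qed.

Lemma dcoset_coord_proj A : dcoset_coord (dcoset_proj A) = qcoord (set_val A).
Proof.
have e : dcoset_proj (repr (dcoset_proj A)) = dcoset_proj A by exact: reprK.
by rewrite /dcoset_coord; have -> := dcoset_coordE e.
Qed.

Definition coset_of (x : V2) : coset_space R :=
  coset_proj (rret Sp_retract (x.1, (x.2, 1))).

Definition dcoset_of (q : quat R) : dcoset_space R :=
  dcoset_proj (rret Sp_retract (q, (1, 1))).

Lemma coset_coord_continuous : continuous coset_coord.
Proof.
apply/quotient_continuous => A.
rewrite (_ : _ \o _ = (fun A => (qcoord (set_val A), ucoord (set_val A)))); last first.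
  by apply/funext => B; exact: coset_coord_proj.
have c := @coords_continuous R A.
have s : smooth_on setT (fun x : V3 => (x.1, x.2.1)).
  have oT : open [set: V3] by exact: openT.
  apply: smooth_pair => //; first exact: smooth_proj1.
  by apply: smooth_fst => //; exact: smooth_proj2.
exact: continuous_comp c (smooth_continuous s I).
Qed.

Lemma dcoset_coord_continuous : continuous dcoset_coord.
Proof.
apply/quotient_continuous => A.
rewrite (_ : _ \o _ = (fun A => qcoord (set_val A))); last first.
  by apply/funext => B; exact: dcoset_coord_proj.
have c := @coords_continuous R A.
have s : smooth_on setT (fun x : V3 => x.1) by exact: smooth_proj1 openT.
exact: continuous_comp c (smooth_continuous s I).
Qed.

Lemma ball_nz_pad (x : V2) : ball_nz x -> ball_nz_nz (x.1, (x.2, 1) : quat R * quat R).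
Proof. by move=> [Bq u0]; split=> //; split=> //=; exact: oner_neq0. Qed.

Lemma ball_pad2 (q : quat R) : qball q -> ball_nz_nz (q, (1, 1) : quat R * quat R).
Proof. by move=> Bq; apply: (ball_nz_pad (x := (q, 1))); split=> //; exact: oner_neq0. Qed.

Lemma Sp_rret x : ball_nz_nz x -> coords (set_val (rret (@Sp_retract R) x)) =
  (x.1, (qsgn x.2.1, qsgn x.2.2)).
Proof.
move=> Dx; rewrite -coords_sp_of//; congr coords.
exact: (@sub_retract_val R _ _ (mkSp (@Sp11_1 R)) _ _ _ _ _ open_ball_nz_nz coords_continuous
  coords_dom coordsK sp_of_Sp11 sp_of_continuous smooth_coords_sp_of).
Qed.

Lemma coset_coord_rret (x : V3) : ball_nz_nz x ->
  coset_coord (coset_proj (rret Sp_retract x)) = (x.1, qsgn x.2.1).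
Proof. by move=> /Sp_rret[]; rewrite coset_coord_proj => -> ->. Qed.

Lemma dcoset_coord_rret (x : V3) : ball_nz_nz x ->
  dcoset_coord (dcoset_proj (rret Sp_retract x)) = x.1.
Proof. by move=> /Sp_rret[]; rewrite dcoset_coord_proj => ->. Qed.

Lemma coset_ofK (x : V2) : ball_nz x -> coset_coord (coset_of x) = (x.1, qsgn x.2).
Proof. by move=> Dx; rewrite coset_coord_rret//; exact: ball_nz_pad. Qed.

Lemma dcoset_ofK (q : quat R) : qball q -> dcoset_coord (dcoset_of q) = q.
Proof. by move=> Bq; rewrite dcoset_coord_rret//; exact: ball_pad2. Qed.

Lemma coset_coord_dom x : ball_nz (coset_coord x).
Proof.
by split; [exact/qcoord_ball/SpP|apply/sphere_neq0/ucoord_sphere/SpP].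
Qed.

Lemma dcoset_coord_dom x : qball (dcoset_coord x).
Proof. exact/qcoord_ball/SpP. Qed.

Lemma coset_eq (A B : Sp) : qcoord (set_val A) = qcoord (set_val B) ->
  ucoord (set_val A) = ucoord (set_val B) -> coset_proj A = coset_proj B.
Proof.
move=> eq eu; apply/coset_projP.
have vA := vcoord_sphere (SpP A); have vB := vcoord_sphere (SpP B).
exists (qconj (vcoord (set_val A)) * vcoord (set_val B))%:M.
  exists (qconj (vcoord (set_val A)) * vcoord (set_val B)) => //.
  by apply/sphereE/sphereM => //; rewrite /sphere /= qabs2_conj.
rewrite -{1}(spmxK (SpP B)) -{1}(spmxK (SpP A)) -eq -eu.
move: (vcoord (set_val A)) (vcoord (set_val B)) vA vB => v w vA vB.
move: (qcoord _) (ucoord _) => q u.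
have vw : v * (qconj v * w) = w by rewrite mulrA qmul_conjE vA scale1r mul1r.
rewrite Sp1I2_diag; apply/matrixP; apply: (ord2P); apply: (ord2P);
  rewrite mulmx2E /spmx !quad_mxE !diag2E ?mulr0 ?addr0 ?add0r !qscaleAl;
  by rewrite -?mulrA ?vw.
Qed.

(** If q and u agree, then the two matrices differ by the right factor
    conj(v) v' I_2, where v and v' are their third coordinates. *)
Lemma coset_coord_inj : injective coset_coord.
Proof.
move=> x y; rewrite -(reprK x) -(reprK y) -/(coset_proj _) -/(coset_proj (repr y)).
by rewrite !coset_coord_proj => -[]; exact: coset_eq.
Qed.

Lemma coset_coordK x : coset_of (coset_coord x) = x.
Proof.
apply: coset_coord_inj; rewrite coset_ofK; last exact: coset_coord_dom.
by rewrite qsgn_id//; apply/ucoord_sphere/SpP.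
Qed.

Lemma coset_act_coord g x : coset_coord (coset_act g x) =
  ((coset_coord x).1, (set_val g 0 0 * (coset_coord x).2)%R).
Proof.
rewrite /coset_act coset_coord_proj.
have [/sphere_neq0 g0 gE] := Sp1x1E (set_mem (valP g)).
have e : set_val g *m set_val (repr x) =
    diag2 (set_val g 0 0) 1 *m set_val (repr x) *m (1 : quat R)%:M.
  by rewrite mulmx1 -gE.
by have [] := qcoord_act g0 (oner_neq0 _) e; rewrite /coset_coord /= => -> ->.
Qed.

Lemma orbit_coord x : dcoset_coord (orbit_proj x) = (coset_coord x).1.
Proof. by rewrite /orbit_proj dcoset_coord_proj. Qed.

(** If q agrees, then left multiplication by diag(u' conj(u), 1) carries one coset to
    the other. *)
Lemma dcoset_coord_inj : injective dcoset_coord.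
Proof.
move=> x y; rewrite -(reprK x) -(reprK y) -/(dcoset_proj _) -/(dcoset_proj (repr y)).
rewrite -!orbit_projE => e; apply/orbit_projP.
have {}e : (coset_coord (coset_proj (repr x))).1 = (coset_coord (coset_proj (repr y))).1.
  by rewrite -!orbit_coord.
set a := coset_proj _ in e *; set b := coset_proj _ in e *.
have ua : sphere (coset_coord a).2 by apply/ucoord_sphere/SpP.
have ub : sphere (coset_coord b).2 by apply/ucoord_sphere/SpP.
pose w := (coset_coord b).2 * qconj (coset_coord a).2.
have Sw : Sp1x1 (diag2 w 1).
  by exists w => //; apply/sphereE/sphereM => //; rewrite /sphere /= qabs2_conj.
pose g : set_type (@Sp1x1 R) := exist _ (diag2 w 1) (mem_set Sw).
have gw : set_val g 0 0 = w by rewrite -[RHS](diag2E w 1).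
exists g; apply: coset_coord_inj.
rewrite coset_act_coord e gw [RHS]surjective_pairing; congr (_, _).
by rewrite /w -mulrA qconj_mulE ua scale1r mulr1.
Qed.

Lemma dcoset_coordK x : dcoset_of (dcoset_coord x) = x.
Proof.
by apply: dcoset_coord_inj; rewrite dcoset_ofK//; exact: dcoset_coord_dom.
Qed.

End CosetModels.

(** * Manifold structures of the coset spaces *)

Section CosetManifolds.
Context {R : realType}.

Let V2 : normedModType R := (quat R * quat R)%type.
Let V3 : normedModType R := (quat R * (quat R * quat R))%type.
Let Sp : Type := set_type (@Sp11 R).

Lemma smooth_pad (c : quat R) (O : set V2) : open O ->
  smooth_on O (fun x : V2 => (x.1, (x.2, c)) : V3).
Proof.
move=> oO; apply: smooth_pair => //; first exact: smooth_proj1.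
by apply: smooth_pair => //; [exact: smooth_proj2|exact: smooth_cst].
Qed.

Lemma smooth_pad2 (c c' : quat R) (O : set (quat R)) : open O ->
  smooth_on O (fun x => (x, (c, c')) : V3).
Proof.
move=> oO; apply: smooth_pair => //; first exact: smooth_id.
by apply: smooth_pair => //; exact: smooth_cst.
Qed.

Lemma coset_of_continuous (x : V2) : ball_nz x -> {for x, continuous (@coset_of R)}.
Proof.
move=> Dx; have c1 := smooth_continuous (smooth_pad 1 (@openT V2)) (I : setT x).
have c2 := @rret_continuous R _ (@Sp_retract R) _ (ball_nz_pad Dx).
have c3 : continuous (@coset_proj R) by exact: pi_continuous.
exact: continuous_comp (continuous_comp c1 c2) (c3 _).
Qed.

Lemma dcoset_of_continuous (x : quat R) : qball x -> {for x, continuous (@dcoset_of R)}.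
Proof.
move=> Dx; have c1 := smooth_continuous (smooth_pad2 1 1 (@openT (quat R))) (I : setT x).
have c2 := @rret_continuous R _ (@Sp_retract R) _ (ball_pad2 Dx).
have c3 : continuous (@dcoset_proj R) by exact: pi_continuous.
exact: continuous_comp (continuous_comp c1 c2) (c3 _).
Qed.

Lemma smooth_ball_nz_retraction : smooth_on (@ball_nz R) (fun x : V2 => (x.1, qsgn x.2) : V2).
Proof.
have o := @open_ball_nz R; apply: smooth_pair => //; first exact: smooth_proj1.
by apply: smooth_qsgn => //; [move=> x []|exact: smooth_proj2].
Qed.

Lemma smooth_coset_of : smooth_on (@ball_nz R) (fun x : V2 => coset_coord (coset_of x)).
Proof.
by apply: (smooth_ext (@open_ball_nz R) _ smooth_ball_nz_retraction) => x Dx; rewrite coset_ofK.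
Qed.

Lemma smooth_dcoset_of : smooth_on (@qball R) (fun q => dcoset_coord (dcoset_of q)).
Proof.
by apply: (smooth_ext open_qball _ (smooth_id open_qball)) => x Dx; rewrite dcoset_ofK.
Qed.

Definition coset_retract : retract R (coset_space R) :=
  @Retract R _ V2 _ (@coset_coord R) (@ball_nz R) (@coset_of R) (@open_ball_nz R)
    (@coset_coord_continuous R) (@coset_coord_dom R) (@coset_coordK R)
    coset_of_continuous smooth_coset_of.

Definition dcoset_retract : retract R (dcoset_space R) :=
  @Retract R _ (quat R) _ (@dcoset_coord R) (@qball R) (@dcoset_of R) (@open_qball R)
    (@dcoset_coord_continuous R) (@dcoset_coord_dom R) (@dcoset_coordK R)
    dcoset_of_continuous smooth_dcoset_of.

Lemma covers_Sp : covers (atlas_of (@Sp_retract R) 10).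
Proof.
apply: (@has_coords_covers _ _ (@Sp_retract R) (@qball R `*` (@sphere R `*` @sphere R))).
- move=> A; split; first exact/qcoord_ball/SpP.
  by split; [exact/ucoord_sphere/SpP|exact/vcoord_sphere/SpP].
- move=> [q [u v]] [/= Bq [/= Su Sv]].
  have D : @ball_nz_nz R (q, (u, v)) by split=> //; split; exact: sphere_neq0.
  by split=> //; apply: etrans (Sp_rret D) _; rewrite /= !qsgn_id.
- apply: (@has_coordsX _ (quat R) V2 _ _ _ _ 4 6); first exact: has_coords_ball.
  by apply: (@has_coordsX _ (quat R) (quat R) _ _ _ _ 3 3); exact: has_coords_sphere.
Qed.

Lemma Sp1x1_rret (u : quat R) : qnz u ->
  set_val (rret (@Sp1x1_retract R) u) 0 0 = qsgn u.
Proof.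
move=> u0.
have e : set_val (rret (@Sp1x1_retract R) u) = diag2 (qsgn u) 1.
  exact: (@sub_retract_val R _ _ (@Sp1x1_unit R) (quat R) _ (fun A => A 0 0) _ _
    (@open_qnz R) (@Sp1x1_entry_continuous R) (@Sp1x1_dom R) (@Sp1x1_entryK R)
    (@diag2_qsgn_Sp1x1 R) (@diag2_qsgn_continuous R) (@smooth_diag2_qsgn R)).
by apply: etrans (congr1 (fun A : 'M[quat R]_2 => A 0 0) e) _; rewrite diag2E.
Qed.

Lemma ball_rret (q : quat R) : qball q -> set_val (rret (@ball_retract R) q) = q.
Proof.
by move=> Bq; apply: insubdK; exact: mem_set.
Qed.

Lemma covers_Sp1x1 : covers (atlas_of (@Sp1x1_retract R) 3).
Proof.
apply: (@has_coords_covers _ _ (@Sp1x1_retract R) (@sphere R)).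
- by move=> A; have [] := Sp1x1E (set_mem (valP A)).
- move=> u Su; have u0 := sphere_neq0 Su; split=> //.
  by apply: etrans (Sp1x1_rret u0) _; exact: qsgn_id.
- exact: has_coords_sphere.
Qed.

Lemma covers_ball : covers (atlas_of (@ball_retract R) 4).
Proof.
apply: (@has_coords_covers _ _ (@ball_retract R) (@qball R)).
- by move=> A; exact: set_mem (valP A).
- by move=> q Bq; split=> //; exact: ball_rret.
- exact: has_coords_ball.
Qed.

Lemma covers_coset : covers (atlas_of coset_retract 7).
Proof.
apply: (@has_coords_covers _ _ coset_retract (@qball R `*` @sphere R)).
- by move=> x; split; [exact/qcoord_ball/SpP|exact/ucoord_sphere/SpP].
- move=> [q u] [/= Bq Su]; have D : @ball_nz R (q, u) by split=> //; exact: sphere_neq0.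
  by split=> //; apply: etrans (coset_ofK D) _; rewrite /= qsgn_id.
- apply: (@has_coordsX _ (quat R) (quat R) _ _ _ _ 4 3); first exact: has_coords_ball.
  exact: has_coords_sphere.
Qed.

Lemma covers_dcoset : covers (atlas_of dcoset_retract 4).
Proof.
apply: (@has_coords_covers _ _ dcoset_retract (@qball R)).
- by move=> x; exact: dcoset_coord_dom.
- by move=> q Bq; split=> //; exact: dcoset_ofK.
- exact: has_coords_ball.
Qed.

(** The section through a matrix with coordinates (q, u, v) keeps v constant. *)
Lemma coset_proj_split : split_submersion (@Sp_retract R) coset_retract (@coset_proj R).
Proof.
have o3 := @open_ball_nz_nz R; have o2 := @open_ball_nz R.
split.
- apply: (smooth_ext o3 (f := fun x : V3 => (x.1, qsgn x.2.1) : V2)) => [x Dx|].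
    by rewrite /= coset_coord_rret.
  by have [s1 s2 _] := @smooth_ball_nz_nz_retraction R; exact: smooth_pair.
- by move=> x; exists (repr x); exact: reprK.
- move=> A; pose v := vcoord (set_val A); have Sv : sphere v by exact/vcoord_sphere/SpP.
  pose s (x : coset_space R) : Sp :=
    rret Sp_retract ((coset_coord x).1, ((coset_coord x).2, v)).
  have D (x : coset_space R) : @ball_nz_nz R ((coset_coord x).1, ((coset_coord x).2, v)).
    by have [? ?] := @coset_coord_dom R x; split=> //; split=> //; exact: sphere_neq0.
  have Su (x : coset_space R) : sphere (coset_coord x).2 by exact/ucoord_sphere/SpP.
  exists s; split.
  + have sm : smooth_on (@ball_nz R) (fun x : V2 => (x.1, (qsgn x.2, v)) : V3).
      apply: smooth_pair => //; first exact: smooth_proj1.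
      apply: smooth_pair => //; last exact: smooth_cst.
      by apply: smooth_qsgn => //; [move=> x []|exact: smooth_proj2].
    apply: (smooth_ext o2 _ sm) => x Dx.
    apply/esym; apply: etrans (Sp_rret (D _)) _.
    have e : coset_coord (rret coset_retract x) = (x.1, qsgn x.2) := coset_ofK Dx.
    by rewrite e /= (qsgn_id Sv) qsgn_id//; apply: qsgn_sphere; case: Dx.
  + move=> x; apply: coset_coord_inj; apply: etrans (coset_coord_rret (D x)) _.
    by rewrite [RHS]surjective_pairing /= (qsgn_id (Su x)).
  + by rewrite /s coset_coord_proj; exact: (@rembK R _ (@Sp_retract R) A).
Qed.

(** The section through a coset with coordinates (q, u) keeps u constant. *)
Lemma orbit_proj_split : split_submersion coset_retract dcoset_retract (@orbit_proj R).
Proof.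
have o2 := @open_ball_nz R; have oB := @open_qball R.
split.
- apply: (smooth_ext o2 (f := fun x : V2 => x.1)) => [x Dx|]; last exact: smooth_proj1.
  by rewrite /= orbit_coord coset_ofK.
- by move=> x; exists (coset_proj (repr x)); rewrite orbit_projE; exact: reprK.
- move=> x; pose u := (coset_coord x).2; have Su : sphere u by exact/ucoord_sphere/SpP.
  pose s (y : dcoset_space R) : coset_space R := coset_of (dcoset_coord y, u).
  have D y : @ball_nz R (dcoset_coord y, u).
    by split; [exact: dcoset_coord_dom|exact: sphere_neq0].
  exists s; split.
  + have sm : smooth_on (@qball R) (fun q => (q, u) : V2).
      by apply: smooth_pair => //; [exact: smooth_id|exact: smooth_cst].
    apply: (smooth_ext oB _ sm) => q Bq.
    by rewrite /= coset_ofK//= dcoset_ofK// qsgn_id.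
  + by move=> y; apply: dcoset_coord_inj; rewrite orbit_coord coset_ofK.
  + by rewrite /s orbit_coord -surjective_pairing coset_coordK.
Qed.

(** In coordinates the action is (w, (q, u)) |-> (q, w u). *)
Lemma act_smooth : smooth_rep (retract_prod (@Sp1x1_retract R) coset_retract) coset_retract
  (fun p => coset_act p.1 p.2).
Proof.
have oD : open (@qnz R `*` @ball_nz R) by apply: openX; [exact: open_qnz|exact: open_ball_nz].
have s1 : smooth_on (@qnz R `*` @ball_nz R) (fun x : quat R * V2 => x.1).
  exact: smooth_proj1.
have s2 : smooth_on (@qnz R `*` @ball_nz R) (fun x : quat R * V2 => x.2).
  exact: smooth_proj2.
apply: (@smooth_ext _ _ _ _ (fun x : quat R * V2 =>
  (x.2.1, (qsgn x.1 * qsgn x.2.2)%R) : V2)) => //.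
  move=> [w [q u]] [/= w0 Dx]; rewrite coset_act_coord coset_ofK//=.
  by congr (_, _ * _); rewrite Sp1x1_rret.
apply: smooth_pair => //; first exact: smooth_fst.
apply: smooth_qmul => //; apply: smooth_qsgn => //.
- by move=> x [].
- by move=> x [_ []].
- exact: smooth_snd.
Qed.

End CosetManifolds.

(** * Freeness and properness of the action *)

Section Action.
Context {R : realType}.

(** w u = u forces w = 1, as u is invertible. *)
Lemma act_free (g : set_type (@Sp1x1 R)) (x : coset_space R) :
  coset_act g x = x -> set_val g = 1%:M.
Proof.
move=> /(congr1 (@coset_coord R)); rewrite coset_act_coord.
have [Sg gE] := Sp1x1E (set_mem (valP g)).
have u0 : (coset_coord x).2 \is a GRing.unit.
  by rewrite qunitE; have [] := @coset_coord_dom R x.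
rewrite [RHS]surjective_pairing => -[] /(congr1 ( *%R^~ (coset_coord x).2^-1)).
rewrite mulrK// mulrV// => g1.
by apply: etrans gE _; rewrite [X in diag2 X _]g1 -Sp1I2_diag.
Qed.

Lemma sphere_compact : compact (@sphere R).
Proof.
have c : continuous (fun u : quat R => qabs2 u).
  move=> u; apply: (smooth_continuous (O := setT)) => //.
  exact: (smooth_qabs2 openT (smooth_id openT)).
apply: (@bounded_closed_compact R 4).
  exists 1; split=> // M M1 u Su.
  have u1 : `|u : 'rV[R]_4| <= 1; last exact: le_trans u1 (ltW M1).
  rewrite /Num.norm /= mx_normrE; apply: bigmax_le => // -[i j] _ /=.
  have {}Su : re u ^+ 2 + im1 u ^+ 2 + im2 u ^+ 2 + im3 u ^+ 2 = 1 := Su.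
  have [[[h0 h1] h2] h3] := (sqr_ge0 (re u), sqr_ge0 (im1 u), sqr_ge0 (im2 u),
    sqr_ge0 (im3 u)).
  have le1 (t : R) : t ^+ 2 <= 1 -> `|t| <= 1.
    by move=> t1; rewrite -(@ler_pXn2r _ 2) ?nnegrE// expr1n real_normK// num_real.
  rewrite ord1 -[j]inord_val; apply: le1.
  by case: j => -[|[|[|[|//]]]] ?;
    rewrite -?/(re u) -?/(im1 u) -?/(im2 u) -?/(im3 u); lra.
have /continuous_closedP cc := c.
exact: (cc [set x : R | x = 1] (@closed_eq R 1)).
Qed.

Lemma Sp1x1_compact : compact [set: set_type (@Sp1x1 R)].
Proof.
have -> : [set: set_type (@Sp1x1 R)] = rret Sp1x1_retract @` (@sphere R).
  apply/seteqP; split=> // g _; exists (set_val g 0 0).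
    by have [] := Sp1x1E (set_mem (valP g)).
  exact: (@rembK R _ (@Sp1x1_retract R)).
apply: continuous_compact sphere_compact.
apply: continuous_in_subspaceT => u /set_mem/sphere_neq0 u0.
exact: (@rret_continuous R _ (@Sp1x1_retract R)).
Qed.

Lemma act_continuous :
  continuous (fun p : set_type (@Sp1x1 R) * coset_space R => coset_act p.1 p.2).
Proof. exact: smooth_rep_continuous act_smooth. Qed.

(** The preimage of [K] is a closed subset of the product of the compact group with
    the compact projection of [K]. *)
Lemma act_proper : proper_map (fun p : set_type (@Sp1x1 R) * coset_space R =>
  (coset_act p.1 p.2, p.2)).
Proof.
have cp : continuous (fun p : set_type (@Sp1x1 R) * coset_space R =>
    (coset_act p.1 p.2, p.2)).
  have cs : continuous (snd : set_type (@Sp1x1 R) * coset_space R -> coset_space R).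
    by move=> [a b]; exact: cvg_snd.
  by move=> p; exact: cvg_pair (@act_continuous p) (cs p).
split=> // K cK.
have clK : closed K.
  by apply: compact_closed cK; exact: (retract_hausdorff (retract_prod coset_retract coset_retract)).
have cK2 : compact (snd @` K).
  by apply: continuous_compact cK; apply: continuous_subspaceT => -[a b]; exact: cvg_snd.
apply: (subclosed_compact _ (compact_setX Sp1x1_compact cK2)).
  by move/continuous_closedP: cp; exact.
by move=> [g x] /= Kx; split=> //=; exists (coset_act g x, x).
Qed.

End Action.

(** * Uniqueness of power series expansions *)

Section PowerSeries.
Context {R : realType} {V : normedModType R}.
Implicit Types (c : nat -> V).

Let vanishing c := forall t : R, 0 < t < 1 ->
  series (fun n => t ^+ n *: c n) @ \oo --> (0 : V).

Lemma geometric_sum_le2 (x : R) N : 0 <= x <= 1 / 2 -> \sum_(k < N) x ^+ k <= 2.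
Proof.
move=> /andP[x0 x1]; elim: N => [|N IH]; first by rewrite big_ord0.
rewrite big_ord_recl expr0.
under eq_bigr do rewrite lift0 exprS.
rewrite -mulr_sumr.
have : 0 <= \sum_(i < N) x ^+ i by apply: sumr_ge0 => i _; rewrite exprn_ge0.
by move: IH; move: (\sum_(i < N) _) => s s2 s0; nra.
Qed.

(** Since the terms at t = 1/2 are bounded, |c n| <= M 2^n; hence the tail of the
    series is at most 4 M t when t <= 1/4, and it tends to 0 with t. *)
Lemma vanishing_c0 c : vanishing c -> c 0%N = 0.
Proof.
move=> vc.
have h2 : 0 < (1 / 2 : R) < 1 by apply/andP; split; lra.
have [M M0 HM] : exists2 M : R, 0 < M & forall n, `|c n| <= M * 2 ^+ n.
  have /cvgP/cvg_series_cvg_0/cvgP/cvg_seq_bounded := vc _ h2.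
  move=> [M [_ HM]]; exists (Num.max (M + 1) 1); first by rewrite lt_max ltr01 orbT.
  move=> n; have := HM (M + 1) (ltr_pwDr ltr01 (lexx M)) n I; rewrite /= normrZ normrX ger0_norm; last by lra.
  rewrite expr_div_n expr1n div1r ler_pdivrMl ?exprn_gt0// => /le_trans; apply.
  by rewrite mulrC ler_pM2r ?exprn_gt0// le_max lexx.
apply/eqP; rewrite -normr_eq0 eq_le normr_ge0 andbT.
apply/ler_addgt0Pr => e e0; rewrite add0r.
(* t <= 1/4 makes the tail at most 4 M t, and the second bound makes this at most e/2. *)
pose t := Num.min (1 / 4) (e / (8 * M)).
have t0 : 0 < t by rewrite lt_min !divr_gt0 ?mulr_gt0.
have t4 : t <= 1 / 4 by rewrite ge_min lexx.
have t1 : 0 < t < 1 by rewrite t0 /=; lra.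
have tM : 4 * M * t <= e / 2.
  have : t <= e / (8 * M) by rewrite ge_min lexx orbT.
  rewrite ler_pdivlMr ?mulr_gt0// => h; lra.
have /cvgrPdist_le/(_ (e / 2)) := vc _ t1.
rewrite divr_gt0// => /(_ isT) [N _ /(_ N.+1)]/(_ (leqnSn N)) /=.
rewrite sub0r normrN seriesEord /= big_ord_recl expr0 scale1r => SN.
set S := \sum_(i < N) _ in SN.
have S2 : `|S| <= e / 2.
  apply: le_trans tM.
  apply: (@le_trans _ _ (\sum_(i < N) 2 * M * t * (2 * t) ^+ i)).
    apply: (le_trans (ler_norm_sum _ _ _)); apply: ler_sum => i _.
    rewrite normrZ normrX lift0 ger0_norm; last exact: ltW.
    apply: (@le_trans _ _ (t ^+ i.+1 * (M * 2 ^+ i.+1))).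
      by rewrite ler_wpM2l ?exprn_ge0// ltW.
    by rewrite !exprS exprMn le_eqVlt; apply/orP; left; apply/eqP; ring.
  rewrite -mulr_sumr.
  have g : \sum_(i < N) (2 * t) ^+ i <= 2 by apply: geometric_sum_le2; lra.
  have : 2 * M * t * \sum_(i < N) (2 * t) ^+ i <= 2 * M * t * 2.
    by rewrite ler_wpM2l// ltW// !mulr_gt0.
  by move=> /le_trans; apply; lra.
rewrite -(addrK S (c 0%N)) (le_trans (ler_normB _ _))// [e]splitr.
exact: lerD.
Qed.

(** Dividing the series by t removes the vanishing constant term. *)
Lemma vanishing_shift c : vanishing c -> vanishing (fun n => c n.+1).
Proof.
move=> vc t t01; have c0 := vanishing_c0 vc; have t0 : t != 0 by lra.
have St := vc _ t01.
have St1 : [sequence t^-1 *: series (fun n => t ^+ n *: c n) n.+1]_n @ \oo --> (0 : V).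
  rewrite -(scaler0 _ t^-1); apply: cvgZl_tmp.
  by move: St; rewrite -(cvg_shiftS (series _)).
apply: cvg_trans St1; apply: near_eq_cvg; apply: nearW => N /=.
rewrite !seriesEord /= big_ord_recl c0 scaler0 add0r scaler_sumr.
apply: eq_bigr => i _; by rewrite scalerA lift0 exprS mulKf.
Qed.

Lemma vanishing_eq0 c : vanishing c -> forall n, c n = 0.
Proof.
move=> vc n; elim: n c vc => [|n IH] c vc; first exact: vanishing_c0.
exact: IH (vanishing_shift vc).
Qed.

End PowerSeries.

Section Expansions.
Context {R : realType}.
Implicit Types (f g : quat R -> quat R) (a : nat -> quat R) (p q x y c d : quat R).

Lemma qseriesE a q N : qseries a q N = \sum_(n < N) q ^+ n * a n.
Proof. by rewrite /qseries seriesEord. Qed.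

Lemma qreal_expr (t : R) n : (t *: (1 : quat R)) ^+ n = t ^+ n *: (1 : quat R).
Proof.
elim: n => [|n IH]; first by rewrite !expr0 scale1r.
by rewrite exprS IH qscaleAl mul1r scalerA exprS.
Qed.

(** Evaluation on the real points of the ball, where the powers of the variable are
    scalars. *)
Lemma expansion_unique f a b : has_expansion f a -> has_expansion f b -> a = b.
Proof.
move=> ea eb; apply/funext => n; apply/eqP; rewrite -subr_eq0; apply/eqP.
apply: (@vanishing_eq0 R (quat R) (fun n => a n - b n)) => t /andP[t0 t1].
have Bt : qball (t *: (1 : quat R)).
  by rewrite qballE qabs2Z qabs2_1 mulr1 expr_lt1 // ltW.
have h := cvgB (ea _ Bt) (eb _ Bt); rewrite subrr in h.
have -> : series (fun n => t ^+ n *: (a n - b n)) =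
    (fun N => qseries a (t *: (1 : quat R)) N - qseries b (t *: (1 : quat R)) N).
  apply/funext => N; rewrite seriesEord /= !qseriesE -sumrB.
  by apply: eq_bigr => i _; rewrite qreal_expr !qscaleAl !mul1r scalerBr.
exact: h.
Qed.

Lemma qcoef_eq f a : has_expansion f a -> qcoef f = a.
Proof.
move=> ea; apply: (expansion_unique (f := f)) => //.
exact: (@xgetPex _ (fun=> 0) [set a | has_expansion f a] (ex_intro _ a ea)).
Qed.

Lemma qseries_finite a q m : (forall n, (m <= n)%N -> a n = 0) ->
  qseries a q @ \oo --> \sum_(n < m) q ^+ n * a n.
Proof.
move=> a0; apply: cvg_near_cst.
exists m => // N /= mN; rewrite qseriesE.
rewrite -!(big_mkord xpredT (fun n => q ^+ n * a n)) (big_cat_nat (leq0n m) mN) /=.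
have -> : \sum_(m <= n < N) q ^+ n * a n = 0; last by rewrite addr0.
rewrite big_nat_cond; apply: big1 => i /andP[/andP[mi _] _].
by rewrite a0// mulr0.
Qed.

Definition affine_coef (c d : quat R) (n : nat) : quat R :=
  match n with 0 => d | 1 => c | _ => 0 end.

Lemma affine_cvg c d q : qseries (affine_coef c d) q @ \oo --> qaffine c d q.
Proof.
have := @qseries_finite (affine_coef c d) q 2; rewrite !big_ord_recl big_ord0 addr0 /=.
rewrite expr0 mul1r expr1 addrC; apply.
by move=> [|[|n]].
Qed.

Lemma affine_expansion c d : has_expansion (qaffine c d) (affine_coef c d).
Proof. by move=> q _; exact: affine_cvg. Qed.

Lemma reg_conj_affine c d : reg_conj (qaffine c d) = qaffine (qconj c) (qconj d).
Proof.
apply/funext => q; rewrite /reg_conj (qcoef_eq (@affine_expansion c d)).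
have -> : (fun n => qconj (affine_coef c d n)) = affine_coef (qconj c) (qconj d).
  by apply/funext => -[|[|n]] //=; exact: qconj0.
exact/cvg_lim/affine_cvg.
Qed.

(** The coefficients of the symmetrization are real, which is what makes its value
    commute with [q] in the next lemma. *)
Lemma symmetrization_affine c d q : symmetrization (qaffine c d) q =
  d * qconj d + q * (d * qconj c + c * qconj d) + q ^+ 2 * (c * qconj c).
Proof.
rewrite /symmetrization reg_conj_affine /star_mul !(qcoef_eq (@affine_expansion _ _)).
apply: cvg_lim => //.
set a := fun n : nat => _; have := @qseries_finite a q 3.
rewrite !big_ord_recl big_ord0 addr0 /= expr0 mul1r expr1 addrA.
have -> : a 0%N = d * qconj d by rewrite /a big_ord_recl big_ord0 /= addr0.
have -> : a 1%N = d * qconj c + c * qconj d.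
  by rewrite /a !big_ord_recl big_ord0 /= addr0.
have -> : a 2%N = c * qconj c.
  by rewrite /a !big_ord_recl big_ord0 /= !mulr0 mul0r add0r !addr0.
apply=> n n3; rewrite /a; apply: big1 => -[[|[|k]] kn] _ /=; last by rewrite mul0r.
  by case: n n3 kn => [|[|n]]//= _ _; rewrite mulr0.
by case: n n3 kn => [|[|[|n]]]//= _ _; rewrite mulr0.
Qed.

(** With P = conj(d) + q conj(c) the symmetrization is s = P d + q P c, and it commutes
    with [q]; so s^-1 P solves X d + q X c = 1.  It does not vanish, because |c| < |d| and
    |q| < 1. *)
Lemma star_inv_affine c d q : qball q -> qabs2 c < qabs2 d ->
  let X := star_inv (qaffine c d) q in X * d + q * X * c = 1.
Proof.
move=> Bq cd /=; rewrite /star_inv reg_conj_affine symmetrization_affine.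
set s := _ + _ + _; set P := qaffine _ _ q.
have sE : s = P * d + q * P * c.
  rewrite /s /P /qaffine !mulrDl !mulrDr !mulrDl.
  rewrite -!mulrA (_ : d * qconj d = qconj d * d); last by rewrite qmul_conj qconj_mul.
  rewrite (_ : c * qconj c = qconj c * c); last by rewrite qmul_conj qconj_mul.
  have -> : q * (d * qconj c) + q * (c * qconj d) = q * (qconj c * d) + q * (qconj d * c).
    rewrite -!mulrDr; congr (q * _); apply: quatP;
      by rewrite !qaddE !qmulE /qmul !mkqE; ring.
  rewrite [X in _ = _ + X]addrC [RHS]addrA; congr (_ + _).
  by rewrite addrA; congr (_ + _); rewrite addrC.
have P0 : P != 0.
  apply/eqP => /eqP; rewrite /P /qaffine addr_eq0 => /eqP e.
  have := congr1 (@qabs2 R) e; rewrite qabs2M !qabs2_conj.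
  have -> : qabs2 (- qconj d) = qabs2 d.
    by rewrite -scaleN1r qabs2Z qabs2_conj sqrrN expr1n mul1r.
  move: Bq; rewrite qballE => q1 h.
  have := qabs2_ge0 c; have := qabs2_ge0 q; nra.
have s0 : s != 0.
  apply/eqP => /eqP; rewrite sE addr_eq0 => /eqP e.
  have := congr1 (@qabs2 R) e.
  have -> : qabs2 (- (q * P * c)) = qabs2 (q * P * c).
    by rewrite -scaleN1r qabs2Z sqrrN expr1n mul1r.
  rewrite !qabs2M; have P2 : 0 < qabs2 P by rewrite qabs2_gt0.
  move: Bq; rewrite qballE => q1 h.
  have : qabs2 P * qabs2 d = qabs2 P * (qabs2 q * qabs2 c) by rewrite h; ring.
  move/(mulfI (lt0r_neq0 P2)) => h'.
  have := qabs2_ge0 c; have := qabs2_ge0 q; nra.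
have cs : q * s^-1 = s^-1 * q.
  have su : s \is a GRing.unit by [].
  apply: (mulrI su); apply: (mulIr su); rewrite !mulrA mulrV// mul1r -!mulrA mulVr// mulr1.
  have rc (r : R) : mkq r 0 0 0 * q = q * mkq r 0 0 0 by exact: mkq_realC.
  rewrite /s !qmul_conj.
  have -> : d * qconj c + c * qconj d = mkq (re (d * qconj c + c * qconj d)) 0 0 0.
    by apply: quatP; rewrite mkqE// !qaddE !qmulE /qmul !mkqE; ring.
  by rewrite !mulrDl !mulrDr expr2 -!mulrA !rc.
by rewrite mulrA cs -!mulrA -mulrDr !mulrA -sE mulVr.
Qed.

End Expansions.

(** * The zero of a slice regular Moebius transformation *)

Section Mobius.
Context {R : realType}.
Implicit Types (p q x y a b c d : quat R) (A M : 'M[quat R]_2).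

Lemma norm_le_qabs q : `|q : 'rV[R]_4| <= qabs q.
Proof.
rewrite {1}/Num.norm /= mx_normrE; apply: bigmax_le; first exact: qabs_ge0.
move=> [i j] _ /=; rewrite -(@ler_pXn2r _ 2) ?nnegrE ?qabs_ge0// real_normK ?num_real//.
rewrite sqr_qabs /qabs2 ord1 -[j]inord_val.
have [[[h0 h1] h2] h3] := (sqr_ge0 (re q), sqr_ge0 (im1 q), sqr_ge0 (im2 q),
    sqr_ge0 (im3 q)).
by case: j => -[|[|[|[|//]]]] ?;
    rewrite -?/(re q) -?/(im1 q) -?/(im2 q) -?/(im3 q); lra.
Qed.

Lemma qabsX q n : qabs (q ^+ n) = qabs q ^+ n.
Proof. by elim: n => [|n IH]; rewrite ?expr0 ?qabs1// !exprS qabsM IH. Qed.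

(** The norm of the underlying vector space is the sup norm, which is at most the
    modulus. *)
Lemma qcvg0 (u : nat -> quat R) (v : nat -> R) : (forall n, qabs (u n) <= v n) ->
  v @ \oo --> (0 : R) -> u @ \oo --> (0 : quat R).
Proof.
move=> uv v0; apply/cvgr0Pnorm_le => e e0.
have /cvgr0Pnorm_le/(_ _ e0) := v0; apply: filterS => n vn.
apply: le_trans (norm_le_qabs _) _; apply: le_trans (uv n) _.
exact: le_trans (ler_norm _) vn.
Qed.

Lemma qmul_continuous_l x : continuous (fun y => x * y).
Proof.
move=> y; apply: (smooth_continuous (O := setT)) => //.
exact: (smooth_qmul openT (smooth_cst _ openT) (smooth_id openT)).
Qed.

Lemma qmul_continuous_r x : continuous (fun y => y * x).
Proof.
move=> y; apply: (smooth_continuous (O := setT)) => //.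
exact: (smooth_qmul openT (smooth_id openT) (smooth_cst _ openT)).
Qed.

Lemma cvg_of_sub (V : normedModType R) (u : nat -> V) (l : V) :
  (fun n => u n - l) @ \oo --> (0 : V) -> u @ \oo --> l.
Proof. by move/subr_cvg0. Qed.

Lemma cvg_addseq (V : normedModType R) (u v : nat -> V) (l m : V) :
  u @ \oo --> l -> v @ \oo --> m -> (fun n => u n + v n) @ \oo --> l + m.
Proof. exact: cvgD. Qed.

(** Solving f * g = 1 degree by degree for f = q c + d gives this geometric sequence. *)
Definition geom_coef c d n : quat R := (- (d^-1 * c)) ^+ n * d^-1.

Lemma qabs_lt1 q : (qabs q < 1) = (qabs2 q < 1).
Proof. by rewrite /qabs -[X in _ < X]sqrtr1 ltr_sqrt. Qed.

(** K = X d satisfies K = 1 + q K e with e = - d^-1 c.  Iterating this equation N times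
    expresses K as the N-th partial sum plus q^N K e^N, and the remainder tends to 0 because
    |q| |e| < 1. *)
Lemma star_inv_expansion c d : qabs2 c < qabs2 d ->
  has_expansion (star_inv (qaffine c d)) (geom_coef c d).
Proof.
move=> cd q Bq; set X := star_inv _ q.
have XE : X * d + q * X * c = 1 by exact: star_inv_affine.
have d0 : d != 0 by rewrite -qabs2_gt0 (le_lt_trans (qabs2_ge0 c)).
have du : d \is a GRing.unit by [].
set e := - (d^-1 * c); pose K := X * d.
have KE : K = 1 + q * K * e.
  by rewrite -XE /K /e mulrN -!mulrA mulVKr// !mulrA addrK.
have partial N : K = \sum_(n < N) q ^+ n * e ^+ n + q ^+ N * K * e ^+ N.
  elim: N => [|N IH]; first by rewrite big_ord0 !expr0 mul1r mulr1 add0r.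
  rewrite big_ord_recr /= {1}IH -addrA; congr (_ + _).
  by rewrite {1}KE mulrDr mulr1 mulrDl exprSr exprS !mulrA.
have XK : X = K * d^-1 by rewrite /K mulrK.
apply: (@cvg_of_sub (quat R)).
have -> : (fun N => qseries (geom_coef c d) q N - X) =
    (fun N => q ^+ N * K * e ^+ N * - d^-1).
  apply/funext => N; rewrite qseriesE XK {1}(partial N) mulrDl opprD addrA.
  rewrite mulr_suml (eq_bigr (fun n : 'I_N => q ^+ n * e ^+ n * d^-1)) ?subrr ?sub0r ?mulrN//.
  by move=> i _; rewrite /geom_coef mulrA.
have q1 : qabs q < 1 by [].
have e1 : qabs e < 1.
  rewrite qabs_lt1 /e -scaleN1r qabs2Z sqrrN expr1n mul1r qabs2M qabs2V mulrC.
  by rewrite ltr_pdivrMr ?mul1r// qabs2_gt0.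
apply: (@qcvg0 _ (geometric (qabs K * qabs (- d^-1)) (qabs q * qabs e))).
  move=> n; rewrite /geometric /= !qabsM !qabsX exprMn le_eqVlt; apply/orP; left.
  by apply/eqP; ring.
apply: cvg_geometric; rewrite ger0_norm ?mulr_ge0 ?qabs_ge0//.
by rewrite mulr_ilt1 ?qabs_ge0.
Qed.

(** The n-th coefficient of the product with q a + b is the sum of b times the n-th
    and a times the previous coefficient of the reciprocal, all multiplications by a and b
    being on the right; so the partial sums are those of the reciprocal, multiplied by b,
    and q times the preceding ones, multiplied by a. *)
Lemma mobiusE A q : qball q -> qabs2 (A 0 1) < qabs2 (A 1 1) ->
  let X := star_inv (qaffine (A 0 1) (A 1 1)) q in
  mobius A q = X * A 1 0 + q * X * A 0 0.
Proof.
move=> Bq cd X; set c := A 0 1; set d := A 1 1.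
have eX := star_inv_expansion cd.
rewrite /mobius /star_mul (qcoef_eq eX) (qcoef_eq (@affine_expansion _ _ _)).
pose al := geom_coef c d.
pose be n := \sum_(k < n.+1) al k * affine_coef (A 0 0) (A 1 0) (n - k).
apply: cvg_lim => //; rewrite -/al -[qseries _ _]/(qseries be q).
rewrite -(cvg_shiftS (qseries _ _)).
have be0 : be 0%N = al 0%N * A 1 0 by rewrite /be big_ord_recl big_ord0 addr0.
have beS n : be n.+1 = al n.+1 * A 1 0 + al n * A 0 0.
  rewrite /be !big_ord_recr /= subnn subSnn /= big1 ?add0r 1?addrC// => -[k kn] _ /=.
  by rewrite subSn ?(ltnW kn)//; case: (n - k)%N (subn_gt0 k n) => [|m _];
    [rewrite kn|rewrite mulr0].
have -> : (fun n => qseries be q n.+1) =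
    (fun n => qseries al q n.+1 * A 1 0 + q * (qseries al q n * A 0 0)).
  apply/funext => N; rewrite !qseriesE !big_ord_recl /= !expr0 !mul1r be0 mulrDl -addrA.
  congr (_ + _).
  rewrite (eq_bigr (fun i : 'I_N => q ^+ i.+1 * al i.+1 * A 1 0 + q * (q ^+ i * al i * A 0 0))).
    by rewrite big_split /= !mulr_suml mulr_sumr.
  by move=> i _; rewrite /bump /= add1n beS mulrDr exprS !mulrA.
have h := eX _ Bq.
have h1 : [sequence qseries al q n.+1]_n @ \oo --> X by rewrite (cvg_shiftS (qseries al q)).
have h2 := cvg_comp _ _ h1 (@qmul_continuous_r (A 1 0) X).
have h3 := cvg_comp _ _ h (@qmul_continuous_r (A 0 0) X).
have h4 := cvg_comp _ _ h3 (@qmul_continuous_l q (X * A 0 0)).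
by rewrite -(mulrA q X); exact: (@cvg_addseq (quat R) _ _ _ _ h2 h4).
Qed.

(** The difference z of two solutions satisfies |z| |d| = |q| |z| |c|, which forces
    z = 0. *)
Lemma qmul_eq_unique c d q x y : qball q -> qabs2 c < qabs2 d ->
  x * d + q * x * c = y * d + q * y * c -> x = y.
Proof.
rewrite qballE => q1 cd e; apply/eqP; rewrite -subr_eq0 -qabs2_eq0; apply/eqP.
have {}e : (x - y) * d = - (q * (x - y) * c).
  apply/eqP; rewrite -addr_eq0; apply/eqP.
  by rewrite mulrBr !mulrBl addrACA -opprD e subrr.
have := congr1 (@qabs2 R) e.
have -> : qabs2 (- (q * (x - y) * c)) = qabs2 (q * (x - y) * c).
  by rewrite -scaleN1r qabs2Z sqrrN expr1n mul1r.
rewrite !qabs2M; move: (qabs2_ge0 (x - y)) (qabs2_ge0 q) (qabs2_ge0 c).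
move: q1 cd; move: (qabs2 (x - y)) (qabs2 q) (qabs2 c) (qabs2 d) => z r s t r1 st z0 r0 s0 e'.
have : z * (t - r * s) = 0 by rewrite mulrBr e'; ring.
by move/eqP; rewrite mulf_eq0 => /orP[/eqP//|/eqP h]; nra.
Qed.

(** The row (q X, X) times M^-1 is (F(q), 1), so that F(q) = 0 means (q X, X) = (0, 1) M;
    conversely, at q = b d^-1 the equation defining X is solved by d, and by nothing else. *)
Lemma mobius_invSp_eq0 M q : Sp11 M -> qball q ->
  (mobius (invSp M) q = 0) <-> q = qcoord M.
Proof.
move=> hM Bq; have [dE _ _ _] := Sp11_rows hM.
have d0 := Sp11_d_neq0 hM; have du : M 1 1 \is a GRing.unit by [].
have cd : qabs2 (invSp M 0 1) < qabs2 (invSp M 1 1).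
  by rewrite !invSpE -scaleN1r qabs2Z sqrrN expr1n mul1r !qabs2_conj dE; lra.
have mE := mobiusE Bq cd; have sE := star_inv_affine Bq cd; rewrite /= in mE sE.
have AM i j : invSp M i 0 * M 0 j + invSp M i 1 * M 1 j = (i == j)%:R.
  by rewrite -mulmx2E invSp_mul// mxE.
have MA i j : M i 0 * invSp M 0 j + M i 1 * invSp M 1 j = (i == j)%:R.
  by rewrite -mulmx2E mul_invSp// mxE.
move: mE sE; set X := star_inv _ q => mE sE.
rewrite mE; split=> [m0|qE].
  have col0 : q * X * invSp M 0 0 + X * invSp M 1 0 = 0 by rewrite addrC.
  have col1 : q * X * invSp M 0 1 + X * invSp M 1 1 = 1 by rewrite addrC.
  have row j : q * X * (invSp M 0 0 * M 0 j + invSp M 0 1 * M 1 j) +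
      X * (invSp M 1 0 * M 0 j + invSp M 1 1 * M 1 j) = M 1 j.
    transitivity ((q * X * invSp M 0 0 + X * invSp M 1 0) * M 0 j +
      (q * X * invSp M 0 1 + X * invSp M 1 1) * M 1 j).
      by rewrite !mulrDl !mulrDr !mulrA addrACA.
    by rewrite col0 col1 mul0r add0r mul1r.
  have := row 0; have := row 1; rewrite !AM /= !(mulr0, mulr1, addr0, add0r) => X1 qX.
  by rewrite /qcoord -qX X1 mulrK.
have qd : q * M 1 1 = M 1 0 by rewrite qE /qcoord divrK.
have XE : X = M 1 1.
  apply: (qmul_eq_unique Bq cd).
  by rewrite sE qd addrC (MA 1 1).
by rewrite XE qd addrC (MA 1 0).
Qed.

Lemma mobius_inv_invSp M : Sp11 M -> mobius_inv (invSp M) 0 = qcoord M.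
Proof.
move=> hM; have Bq := qcoord_ball hM.
have i0 : (mobius (invSp M) @` @qball R) 0.
  by exists (qcoord M) => //; exact/mobius_invSp_eq0.
have p0 : mobius (invSp M) (mobius_inv (invSp M) 0) = 0.
  by apply: pinvK; exact: mem_set.
apply/mobius_invSp_eq0 => //.
have sub : set_surj (@qball R) [set 0] (mobius (invSp M)) by move=> _ ->.
exact: (@surjpinv_image_sub _ _ (fun=> 0) _ _ _ sub _ (ex_intro2 _ _ 0 erefl erefl)).
Qed.

End Mobius.

(** * The double coset space *)

Theorem theorem4p3p5 (R : realType) :
  (exists A : set (chart R (coset_space R) 7),
    quotient_structure
      (submanifold_atlas mat_coords (X := @Sp11 R) (n := 10)) A (@coset_proj R))
  /\
  forall A : set (chart R (coset_space R) 7),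
  quotient_structure
    (submanifold_atlas mat_coords (X := @Sp11 R) (n := 10)) A (@coset_proj R) ->
  [/\ smooth_map
        (prod_atlas (submanifold_atlas mat_coords (X := @Sp1x1 R) (n := 3)) A) A
        (fun p => coset_act p.1 p.2),
      forall (g : set_type (@Sp1x1 R)) (x : coset_space R),
        coset_act g x = x -> set_val g = 1%:M,
      proper_map (fun p : set_type (@Sp1x1 R) * coset_space R =>
        (coset_act p.1 p.2, p.2)),
      exists B : set (chart R (dcoset_space R) 4),
        quotient_structure A B (@orbit_proj R) &
      exists Phi : dcoset_space R -> set_type (@qball R),
        (forall M : set_type (@Sp11 R),
           set_val (Phi (dcoset_proj M)) = mobius_inv (invSp (set_val M)) 0) /\
        forall B : set (chart R (dcoset_space R) 4),
          quotient_structure A B (@orbit_proj R) ->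
          diffeomorphism B (submanifold_atlas id (X := @qball R) (n := 4)) Phi].
Proof.
have scq : @second_countable (quat R) by exact: (@second_countable_mx R 1 4).
have sc2 := second_countable_prod scq scq.
rewrite atlas_Sp atlas_Sp1x1; split.
  exists (atlas_of (coset_retract (R := R)) 7); split.
    exact: (@smooth_rep_manifold R _ (@coset_retract R) 7 _ sc2 (@subset_refl _ _) (@covers_coset R)).
  exact: (split_submersion_submersion (@coset_proj_split R) (@subset_refl _ _)
    (@covers_Sp R) (@subset_refl _ _) (@covers_coset R)).
move=> A qA.
have AX : A `<=` atlas_of (coset_retract (R := R)) 7.
  exact: (smooth_structure_unique (@coset_proj_split R) (@subset_refl _ _)
    (@covers_Sp R) (@covers_coset R) qA).
have cA : covers A by case: qA => -[].
split.
- apply: (smooth_rep_map (prod_atlas_sub (@subset_refl _ _) AX) _ AX cA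
    (@act_smooth R)) => -[g x].
  have [phi aphi dg] := @covers_Sp1x1 R g; have [psi Apsi dx] := cA x.
  by exists (prod_chart phi psi) => //; exists (phi, psi).
- exact: act_free.
- exact: act_proper.
- exists (atlas_of (dcoset_retract (R := R)) 4); split.
    exact: (@smooth_rep_manifold R _ (@dcoset_retract R) 4 _ scq (@subset_refl _ _) (@covers_dcoset R)).
  exact: (split_submersion_submersion (@orbit_proj_split R) AX cA
    (@subset_refl _ _) (@covers_dcoset R)).
pose Phi (x : dcoset_space R) : set_type (@qball R) :=
  rret (@ball_retract R) (dcoset_coord x).
have PhiE x : set_val (Phi x) = dcoset_coord x.
  by apply: ball_rret; exact: dcoset_coord_dom.
exists Phi; split=> [M|B qB].
  by rewrite PhiE dcoset_coord_proj mobius_inv_invSp//; exact: SpP.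
have BY : B `<=` atlas_of (dcoset_retract (R := R)) 4.
  exact: (smooth_structure_unique (@orbit_proj_split R) AX cA (@covers_dcoset R) qB).
have cB : covers B by case: qB => -[].
have val_ball (y : set_type (@qball R)) : qball (set_val y) by exact: set_mem (valP y).
exists (fun y => dcoset_of (set_val y)); split.
- by move=> x; rewrite PhiE dcoset_coordK.
- move=> y; apply: val_inj; apply: etrans (PhiE _) _.
  by rewrite dcoset_ofK.
- apply: (smooth_rep_map BY cB (@subset_refl _ _) (@covers_ball R)).
  apply: (smooth_ext open_qball _ (smooth_id open_qball)) => q Bq.
  by apply/esym; apply: etrans (PhiE _) _; exact: dcoset_ofK.
- apply: (smooth_rep_map (@subset_refl _ _) (@covers_ball R) BY cB).
  apply: (smooth_ext open_qball _ (smooth_id open_qball)) => q Bq.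
  by rewrite ball_rret//; apply/esym; exact: dcoset_ofK.
Qed.
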